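(* Let $r\geqslant2$ and let $\mathcal L_1$ be the class of $r$th order linear ODEs in the rational form $$x^{(r)}+a_{r-2}(t)x^{(r-2)}+\dots+a_1(t)x'+a_0(t)x=b(t)$$ with arbitrary smooth functions $a_{r-2},\dots,a_0,b$ of $t$. The equivalence group $G^\sim_1$ of $\mathcal L_1$ consists of the transformations whose projections to the variable space have the form $$\tilde t=T(t),\quad \tilde x=C\,(T_t(t))^{\frac{r-1}2}x+X_0(t),$$ where $T$ and $X_0$ are arbitrary smooth functions of $t$ with $T_t\ne0$, and $C$ is an arbitrary nonzero constant. (For even $r$ the power of $T_t$ is half-integer, and then $|T_t|$ is substituted for $T_t$ in the real case, or a branch of the square root is fixed in the complex case.) The class $\mathcal L_1$ with $r=2$ is semi-normalized. If $r\geqslant3$, then the group $G^\sim_1$ generates the equivalence groupoid of $\mathcal L_1$, i.e., the class $\mathcal L_1$ is normalized.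
   Context: The underlying field $\mathbb F$ is $\mathbb R$ or $\mathbb C$; all variables, functions and constants are real or complex, respectively. $x=x(t)$ is the unknown function, $x^{(k)}=d^kx/dt^k$; subscripts $t$, $x$ of functions denote derivatives. Everything is local: functions and transformations are smooth and considered on suitable open domains. A point transformation is a transformation $\tilde t=T(t,x)$, $\tilde x=X(t,x)$ with nonvanishing Jacobian $\partial(T,X)/\partial(t,x)$; it acts on ODEs via prolongation to derivatives. The arbitrary elements of a class of ODEs are the functions (coefficients, right-hand side) parameterizing it. An admissible transformation of a class is a triple $(\mathcal E,\tilde{\mathcal E},\mathcal T)$, where $\mathcal E$ and $\tilde{\mathcal E}$ are equations of the class and $\mathcal T$ (the transformational part) is a point transformation mapping $\mathcal E$ to $\tilde{\mathcal E}$. The equivalence groupoid of the class is the set of all its admissible transformations with composition. The (usual) equivalence (pseudo)group of the class consists of the point transformations in the joint space of $t$, $x$, the derivatives of $x$ and the arbitrary elements that are consistent with the contact structure (the components for derivatives are obtained by prolongation), are projectable to the variable space, i.e. the $(t,x)$-space (the components for $t$ and $x$ depend only on $(t,x)$), and map every equation of the class to an equation of the class. An equivalence transformation generates the admissible transformations $(\mathcal E,\tilde{\mathcal E},\mathcal T)$ in which $\mathcal T$ is its projection to the $(t,x)$-space, $\mathcal E$ is any equation of the class and $\tilde{\mathcal E}$ is the image of $\mathcal E$. A class is normalized if its equivalence group generates its entire equivalence groupoid. A class is semi-normalized if for every admissible transformation $(\mathcal E,\tilde{\mathcal E},\mathcal T)$, $\mathcal T$ is the composition of a point symmetry transformation of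 $\mathcal E$ followed by the projection of an equivalence transformation. *)

(* Defs.v *)
From HB Require Import structures.
From mathcomp Require Import all_boot all_order all_algebra.
From mathcomp Require Import complex.
From mathcomp Require Import all_classical all_reals all_analysis.

Set Implicit Arguments.
Unset Strict Implicit.
Unset Printing Implicit Defensive.

Import Order.TTheory GRing.Theory Num.Theory.
Import numFieldNormedType.Exports.

Local Open Scope classical_set_scope.
Local Open Scope ring_scope.

(* The ground field F is a numFieldType, to be instantiated by a realType R or
   by R[i].  All derivatives are taken over F: for F = R[i] smooth functions are
   the holomorphic ones. *)

Section Smoothness.
Context {F : numFieldType} {V W : normedModType F}.

(* Iterated directional derivatives up to order n exist and are continuous;
   for open A and finite-dimensional V this is the class C^n. *)
Fixpoint Ck_on (n : nat) (A : set V) (f : V -> W) : Prop :=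
  (forall x, A x -> {for x, continuous f}) /\
  if n is m.+1 then
    forall v : V, (forall x, A x -> derivable f x v) /\
                  Ck_on m A (fun x => 'D_v f x)
  else True.

Definition smooth_on (A : set V) (f : V -> W) : Prop := forall n, Ck_on n A f.

End Smoothness.

Section LinearODEs.
Context {F : numFieldType}.

Definition is_domain (I : set F) : Prop := [/\ open I, I !=set0 & connected I].

(* A transformation phi of the (t,x)-plane is t~ = (phi (t,x)).1 = T(t,x),
   x~ = (phi (t,x)).2 = X(t,x); values outside the open set Om are junk. *)
Definition jacobian_tx (phi : F * F -> F * F) (z : F * F) : F :=
  let T w := (phi w).1 in let X w := (phi w).2 in
  'D_(1, 0) T z * 'D_(0, 1) X z - 'D_(0, 1) T z * 'D_(1, 0) X z.

Definition point_transformation (Om : set (F * F)) (phi : F * F -> F * F) :=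
  [/\ open Om, smooth_on Om phi & forall z, Om z -> jacobian_tx phi z != 0].

Section FixedOrder.
Variable r : nat.

(* jet: (t, y) with y_k standing for the derivative x^(k), 0 <= k <= r;
   arb: values ((a_0, ..., a_(r-2)), b) of the arbitrary elements. *)
Local Notation jet := (F * 'rV[F]_r.+1)%type.
Local Notation arb := ('rV[F]_(r.-1) * F)%type.
Local Notation joint := (jet * arb)%type.

Definition jet_base (p : jet) : F * F := (p.1, p.2 0 ord0).

(* D_t = d/dt + sum_k y_(k+1) d/dy_k as the derivative along the vector
   (1, y_1, ..., y_r, 0); the truncation in the last slot is immaterial for
   functions of jet order less than r, the only ones to which it is applied. *)
Definition total_derivative (f : jet -> F) (p : jet) : F :=
  'D_(1, \row_(i < r.+1) (if (i < r)%N then p.2 0 (inord i.+1) else 0)) f p.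

Definition DT (phi : F * F -> F * F) (p : jet) : F :=
  total_derivative (fun q => (phi (jet_base q)).1) p.

(* x~^(0) = X and x~^(k+1) = D_t x~^(k) / D_t T, defined where D_t T <> 0 *)
Fixpoint prolong_coord (phi : F * F -> F * F) (k : nat) : jet -> F :=
  if k is k'.+1 then
    fun p => total_derivative (prolong_coord phi k') p / DT phi p
  else fun p => (phi (jet_base p)).2.

Definition prolong (phi : F * F -> F * F) (p : jet) : jet :=
  ((phi (jet_base p)).1, \row_(k < r.+1) prolong_coord phi k p).

(* x^(r) + a_(r-2)(t) x^(r-2) + ... + a_0(t) x = b(t), for t in dom *)
Record lin_ode : Type := LinODE {
  dom : set F;
  coef : F -> 'rV[F]_(r.-1);
  rhs : F -> F;
  dom_open : open dom;
  coef_smooth : smooth_on dom coef;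
  rhs_smooth : smooth_on dom rhs
}.

Definition satisfies (E : lin_ode) (p : jet) : Prop :=
  p.2 0 ord_max + \sum_(j < r.-1) coef E p.1 0 j * p.2 0 (inord j) = rhs E p.1.

Definition maps_ode (Om : set (F * F)) (phi : F * F -> F * F)
    (E E' : lin_ode) : Prop :=
  (forall z, Om z -> dom E z.1 /\ dom E' (phi z).1) /\
  (forall p : jet, Om (jet_base p) -> DT phi p != 0 ->
     (satisfies E p <-> satisfies E' (prolong phi p))).

Definition admissible (E E' : lin_ode) (Om : set (F * F))
    (phi : F * F -> F * F) : Prop :=
  point_transformation Om phi /\ maps_ode Om phi E E'.

Definition point_symmetry (E : lin_ode) (Om : set (F * F))
    (phi : F * F -> F * F) : Prop := admissible E E Om phi.

Definition arb_of (E : lin_ode) (t : F) : arb := (coef E t, rhs E t).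

(* the part of the joint space over Om on which the prolongation of phi is
   defined; the arbitrary elements range over all values *)
Definition joint_over (Om : set (F * F)) (phi : F * F -> F * F)
 : set joint :=
  [set q | Om (jet_base q.1) /\ DT phi q.1 != 0].

(* Psi maps E to E' over U: as an equation, and at the level of the graphs of
   the arbitrary elements *)
Definition joint_maps_ode (U : set (F * F)) (phi : F * F -> F * F)
    (Psi : joint -> joint) (E E' : lin_ode) : Prop :=
  maps_ode U phi E E' /\
  (forall p : jet, U (jet_base p) -> DT phi p != 0 ->
     (Psi (p, arb_of E p.1)).2 = arb_of E' (phi (jet_base p)).1).

(* Psi is an element of the equivalence pseudogroup with projection phi on Om:
   a point transformation of the joint space (smooth, with nonsingular
   differential) whose (t,x)-components are phi and whose other jet components
   come from prolongation, and which maps every equation of the class to an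
   equation of the class, locally near each point. *)
Definition equivalence_transformation (Om : set (F * F))
    (phi : F * F -> F * F) (Psi : joint -> joint) : Prop :=
  [/\ point_transformation Om phi,
      smooth_on (joint_over Om phi) Psi,
      forall q, joint_over Om phi q -> forall v, 'D_v Psi q = 0 -> v = 0,
      forall q, joint_over Om phi q -> (Psi q).1 = prolong phi q.1
    & forall (E : lin_ode) z, Om z -> dom E z.1 ->
        exists (U : set (F * F)) (E' : lin_ode),
          [/\ open U, U z, U `<=` Om & joint_maps_ode U phi Psi E E']].

(* tau is T_t^((r-1)/2) on I, where, for even r, a square root s of T_t is
   provided by sqrt_branch *)
Definition power_branch (sqrt_branch : set F -> (F -> F) -> (F -> F) -> Prop)
    (I : set F) (dT tau : F -> F) : Prop :=
  if odd r then forall t, I t -> tau t = dT t ^+ (r.-1)./2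
  else exists s, sqrt_branch I dT s /\ forall t, I t -> tau t = s t ^+ r.-1.

Definition G1_form (sqrt_branch : set F -> (F -> F) -> (F -> F) -> Prop)
    (I J : set F) (phi : F * F -> F * F) : Prop :=
  exists (T X0 tau : F -> F) (C : F),
    [/\ smooth_on I T /\ (forall t, I t -> derive1 T t != 0),
        smooth_on I X0,
        C != 0,
        power_branch sqrt_branch I (derive1 T) tau
      & forall t x, I t -> J x -> phi (t, x) = (T t, C * tau t * x + X0 t)].

(* The expression of T and X0 as functions of t alone and the constancy of C
   are meaningful on products of domains only. *)
Definition equivalence_group_is
    (form : set F -> set F -> (F * F -> F * F) -> Prop) : Prop :=
  forall (Om : set (F * F)) (phi : F * F -> F * F), open Om ->
    (exists Psi, equivalence_transformation Om phi Psi) <->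
    (forall I J : set F, is_domain I -> is_domain J -> I `*` J `<=` Om ->
       form I J phi).

Definition normalized : Prop :=
  forall E E' Om phi, admissible E E' Om phi ->
    exists Psi, equivalence_transformation Om phi Psi /\
                joint_maps_ode Om phi Psi E E'.

(* The decomposition is local, near each point z of the domain. *)
Definition semi_normalized : Prop :=
  forall E E' Om phi, admissible E E' Om phi -> forall z, Om z ->
    exists (U : set (F * F)) (sigma : F * F -> F * F)
           (Om' : set (F * F)) (phi' : F * F -> F * F) Psi,
      [/\ [/\ open U, U z & U `<=` Om],
          point_symmetry E U sigma,
          equivalence_transformation Om' phi' Psi
        & forall w, U w -> Om' (sigma w) /\ phi w = phi' (sigma w)].

End FixedOrder.

(* for F = R[i]: a holomorphic branch of the square root of T_t *)
Definition smooth_sqrt_branch (I : set F) (g s : F -> F) : Prop :=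
  smooth_on I s /\ forall t, I t -> s t ^+ 2 = g t.

End LinearODEs.

(* sqrt |T_t| over the reals *)
Definition real_sqrt_branch (R : realType) (I : set R) (g s : R -> R) : Prop :=
  forall t, I t -> s t = Num.sqrt `|g t|.

(* Main.v *)
(* The components x~^(k) of a prolonged point transformation are polynomials in
   the jet coordinates, with 1/D_t T adjoined.  For r >= 3 the coefficients of
   y_2 y_(r-1) and y_1 y_(r-1) in x~^(r) vanish only if T_x = 0 and X_xx = 0;
   for r = 2 an equivalence transformation has to map both x'' = 0 and x'' = 1
   into the class, with the same consequence.  The prolongation is then affine,
   x~^(k) = sum_i N_ki(t) y_i + n_k(t), and the absence of x~^(r-1) amounts to
   N_(r,r-1) = 0, that is, to 2 T_t (X_x)_t = (r-1) X_x T_tt, whose solutions are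
   X_x = C T_t^((r-1)/2).  Conversely, for such a transformation the new
   coefficients are obtained by multiplying the old ones by the inverse of the
   triangular matrix N, which gives a transformation of the whole joint space.

   For r = 2, an equation with solutions u, p of the homogeneous and of the given
   equation is mapped to x'' = 0 by psi = (T, (x - p)/u), T_t = u^(-2).  An
   admissible transformation phi from E to E' then factors through the symmetry
   psi_E^(-1) o psi_E' o phi of E, followed by psi_E'^(-1) o psi_E.

   The ground field enters through the mean value inequality on segments,
   geometric completeness and square roots only. *)
Require Import Defs.
From mathcomp Require Import all_boot all_order all_algebra.
From mathcomp Require Import complex.
From mathcomp Require Import all_classical all_reals all_analysis.
From mathcomp Require Import ring lra zify.
Import Order.TTheory GRing.Theory Num.Theory.
Import numFieldNormedType.Exports.
Local Open Scope classical_set_scope.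
Local Open Scope ring_scope.

Set Implicit Arguments.
Unset Strict Implicit.
Unset Printing Implicit Defensive.

(** * Smooth functions over a normed field *)

(** Smoothness is given by directional derivatives, so additivity in the direction is not known at
    the outset; it is regained from the mean value inequality, for C^1 functions on the plane. Outer
    functions of one variable and inner affine maps then cover the compositions that occur. Over an
    abstract field neither integrals nor compactness are at hand; the inverse function, primitives
    and solutions of u'' = b - a u are limits of sequences converging like 2^-n. The border between
    r = 2 and r >= 3 arises as follows. An equation of the class does not contain y_(r-1), so two of
    its points may differ in y_(r-1) alone. For r >= 3 the components x~^(0), ..., x~^(r-2) and D_t
    T do not involve y_(r-1), hence x~^(r) has to agree at both points. For r = 2 the coordinate
    y_(r-1) = y_1 enters D_t T itself and the comparison breaks down; the projective symmetries of
    x'' = 0 show that it must. In the case r = 2 prolongations are never composed: two maps are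
    compared through their common straightened image. *)

Section DirectionalDerivatives.
Context {F : numFieldType}.

Lemma is_derive_near {V W : normedModType F} (A : set V) (f g : V -> W) x v d :
  open A -> A x -> (forall y, A y -> f y = g y) ->
  is_derive x v f d -> is_derive x v g d.
Proof.
move=> oA Ax fg; apply: near_eq_is_derive.
by apply: filterS (open_nbhs_nbhs (conj oA Ax)) => y /fg.
Qed.

Lemma derive_near {V W : normedModType F} (A : set V) (f g : V -> W) x v :
  open A -> A x -> (forall y, A y -> f y = g y) -> 'D_v f x = 'D_v g x.
Proof.
move=> oA Ax fg; apply: near_eq_derive.
by apply: filterS (open_nbhs_nbhs (conj oA Ax)) => y /fg.
Qed.

Lemma continuous_near {V W : normedModType F} (A : set V) (f g : V -> W) x :
  open A -> A x -> (forall y, A y -> f y = g y) ->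
  {for x, continuous f} -> {for x, continuous g}.
Proof.
move=> oA Ax fg; rewrite /prop_for /continuous_at -(fg _ Ax) => cf.
apply: cvg_trans cf; apply: near_eq_cvg.
by apply: filterS (open_nbhs_nbhs (conj oA Ax)) => y /fg.
Qed.

Lemma is_derive_unique {V W : normedModType F} (f : V -> W) x v d d' :
  is_derive x v f d -> is_derive x v f d' -> d = d'.
Proof. by move=> [_ <-] [_ <-]. Qed.

Lemma is_derive_postlin {V W W' : normedModType F} (l : W -> W') (f : V -> W)
    x v d : linear l -> continuous l ->
  is_derive x v f d -> is_derive x v (fun y => l (f y)) (l d).
Proof.
move=> ll cl [fx <-].
have lB a b : l (a - b) = l a - l b.
  by rewrite addrC -[- b]scaleN1r ll scaleN1r addrC.
have lZ k a : l (k *: a) = k *: l a.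
  have l0 : l 0 = 0 by have := ll (-1) 0 0; rewrite scaler0 addr0 scaleN1r addNr.
  by rewrite -[k *: a]addr0 ll l0 addr0.
suff H : h^-1 *: (l (f (h *: v + x)) - l (f x)) @[h --> 0^'] --> l ('D_v f x).
  by apply: DeriveDef; [apply/cvg_ex; exists (l ('D_v f x)) | exact: cvg_lim].
have -> : (fun h => h^-1 *: (l (f (h *: v + x)) - l (f x))) =
   l \o (fun h => h^-1 *: (f (h *: v + x) - f x)).
  by apply/funext => h /=; rewrite lZ lB.
by apply: continuous_cvg; [exact: cl | exact: fx].
Qed.

Lemma is_derive_preaff {V' V W : normedModType F} (l : V' -> V) (c : V)
    (f : V -> W) x v d : linear l ->
  is_derive (l x + c) (l v) f d -> is_derive x v (fun y => f (l y + c)) d.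
Proof.
move=> ll; have E : (fun h : F => h^-1 *: (((fun y => f (l y + c)) \o shift x) (h *: v)
     - f (l x + c))) =
  (fun h : F => h^-1 *: ((f \o shift (l x + c)) (h *: l v) - f (l x + c))).
  by apply/funext => h /=; rewrite ll addrA.
by move=> [h1 h2]; split; rewrite /derivable /derive E.
Qed.

(** Reduction to one variable, where derivability and differentiability coincide, so that the chain
    rule for differentials applies although f is only known to have a derivative along v. *)
Lemma is_derive_line {V W : normedModType F} (f : V -> W) x v d :
  is_derive x v f d <-> is_derive (0 : F) 1 (fun h : F => f (h *: v + x)) d.
Proof.
have E : (fun h : F => h^-1 *: ((f \o shift x) (h *: v) - f x)) =
  (fun h : F => h^-1 *: (((fun h : F => f (h *: v + x)) \o shift 0) (h *: 1)
    - f ((0 : F) *: v + x))).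
  by apply/funext => h /=; rewrite addr0 scale0r add0r [_%:A]mulr1.
by split=> -[h1 h2]; split; move: h1 h2; rewrite /derivable /derive E.
Qed.

Lemma is_derive_comp1 {V : normedModType F} (g : F -> F) (f : V -> F) x v d e :
  is_derive (f x) 1 g e -> is_derive x v f d ->
  is_derive x v (fun y => g (f y)) (e * d).
Proof.
move=> hg /is_derive_line hf; apply/is_derive_line.
set f1 := (fun h : F => f (h *: v + x)) in hf *.
have f10 : f1 0 = f x by rewrite /f1 scale0r add0r.
rewrite -f10 in hg; move: hf hg => [/derivable1_diffP df <-] [/derivable1_diffP dg <-].
have dgf : differentiable (g \o f1) 0 by exact: differentiable_comp.
split; first exact/derivable1_diffP.
rewrite -[LHS]/('D_1 (g \o f1) 0) -!derive1E derive1E' // diff_comp // !derive1E' //=.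
by rewrite -[X in 'd _ _ X = _]mulr1 [LHS]linearZ mulrC.
Qed.

(** Homogeneity in the direction is the chain rule on the line through x. Additivity needs more and
    is proved later for C^1 functions of two variables. *)
Lemma is_deriveZdir {V W : normedModType F} (f : V -> W) x v d a :
  is_derive x v f d -> is_derive x (a *: v) f (a *: d).
Proof.
move=> /is_derive_line hf; apply/is_derive_line.
set f1 := (fun h : F => f (h *: v + x)) in hf *.
have -> : (fun h : F => f (h *: (a *: v) + x)) = f1 \o ( *%R a).
  by apply/funext => h; rewrite /f1 /= scalerA mulrC.
move: hf => [/derivable1_diffP df <-].
have hl : is_derive (0 : F) 1 ( *%R a : F -> F) a.
  rewrite -[X in is_derive _ _ _ X]mulr1.
  by apply: (@is_derive_postlin _ _ _ ( *%R a : F -> F) id); [move=> k u w; rewrite mulrDr mulrCA|exact: mulrl_continuous].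
have dl : differentiable ( *%R a : F -> F) 0 by case: hl => /derivable1_diffP.
have df' : differentiable f1 (a * 0) by rewrite mulr0.
have dgf : differentiable (f1 \o ( *%R a)) 0 by exact: differentiable_comp.
split; first exact/derivable1_diffP.
rewrite -!derive1E derive1E' // diff_comp // mulr0 derive1E' //=.
rewrite -derive1E' // derive1E; case: hl => _ ->.
by rewrite -linearZ /= [_ *: _]mulr1.
Qed.

Lemma is_derive_continuous1 {W : normedModType F} (f : F -> W) (x : F) d :
  is_derive x 1 f d -> {for x, continuous f}.
Proof. by move=> [/derivable1_diffP/differentiable_continuous]. Qed.

Lemma is_derive_sumf {V W : normedModType F} (I : Type) (s : seq I)
  (f : I -> V -> W) (d : I -> W) x v :
  (forall i, is_derive x v (f i) (d i)) ->
  is_derive x v (fun y => \sum_(i <- s) f i y) (\sum_(i <- s) d i).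
Proof.
move=> h; elim: s => [|i s IH].
  rewrite big_nil (_ : (fun y => _) = cst 0); first exact: is_derive_cst.
  by apply/funext => y; rewrite big_nil.
rewrite big_cons (_ : (fun y => _) = f i + (fun y => \sum_(i <- s) f i y)).
  exact: is_deriveD.
by apply/funext => y; rewrite big_cons.
Qed.

End DirectionalDerivatives.

(** * Closure properties of C^n and smooth functions *)

Section SmoothClosure.
Context {F : numFieldType}.

Lemma Ck_continuous {V W : normedModType F} n (A : set V) (f : V -> W) x :
  Ck_on n A f -> A x -> {for x, continuous f}.
Proof. by case: n => [|n] [+ _]; apply. Qed.

Lemma Ck_derive {V W : normedModType F} n (A : set V) (f : V -> W) x v :
  Ck_on n.+1 A f -> A x -> is_derive x v f ('D_v f x).
Proof. by move=> [_ /(_ v) [h _]] /h; exact: derivableP. Qed.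

Lemma CkD_v {V W : normedModType F} n (A : set V) (f : V -> W) v :
  Ck_on n.+1 A f -> Ck_on n A ('D_v f).
Proof. by move=> [_ /(_ v) []]. Qed.

Lemma Ck_eq {V W : normedModType F} n (A : set V) (f g : V -> W) : open A ->
  (forall x, A x -> f x = g x) -> Ck_on n A f -> Ck_on n A g.
Proof.
move=> oA; elim: n f g => [|n IH] f g fg [cf hf].
  by split=> // x Ax; exact: (continuous_near oA Ax fg (cf x Ax)).
split=> [x Ax|v]; first exact: (continuous_near oA Ax fg (cf x Ax)).
have [dv Cv] := hf v; split=> [x Ax|].
  by have [] := is_derive_near oA Ax fg (derivableP (dv x Ax)).
by apply: IH Cv => x Ax; exact: (derive_near _ oA Ax fg).
Qed.

(** [Ck_on] speaks of the function ['D_v f], which has junk values off A. This introduction rule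
    lets an explicit formula valid on A take its place, which openness of A permits. *)
Lemma CkS {V W : normedModType F} n (A : set V) (f : V -> W) (df : V -> V -> W) : open A ->
  (forall x, A x -> {for x, continuous f}) ->
  (forall v x, A x -> is_derive x v f (df v x)) ->
  (forall v, Ck_on n A (df v)) -> Ck_on n.+1 A f.
Proof.
move=> oA cf hd hC; split=> // v; split=> [x Ax|]; first by have [] := hd v x Ax.
by apply: Ck_eq (hC v) => // x Ax; have [_ ->] := hd v x Ax.
Qed.

Lemma Ck_sub {V W : normedModType F} n (A B : set V) (f : V -> W) :
  B `<=` A -> Ck_on n A f -> Ck_on n B f.
Proof.
move=> BA; elim: n f => [|n IH] f [cf hf]; split=> //; first by move=> x /BA/cf.
  by move=> x /BA/cf.
by move=> v; have [h1 h2] := hf v; split; [move=> x /BA/h1 | exact: IH].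
Qed.

Lemma Ck_local {V W : normedModType F} n (A : set V) (f : V -> W) :
  (forall x, A x -> exists2 B, B x & Ck_on n B f) -> Ck_on n A f.
Proof.
elim: n f => [|n IH] f h.
  by split=> // x /h [B Bx [cf _]]; exact: cf.
split=> [x /h [B Bx [cf _]]|v]; first exact: cf.
split=> [x /h [B Bx [_ /(_ v) [dv _]]]|]; first exact: dv.
by apply: IH => x /h [B Bx [_ /(_ v) [_ Cv]]]; exists B.
Qed.

Lemma Ck_pred {V W : normedModType F} n (A : set V) (f : V -> W) :
  Ck_on n.+1 A f -> Ck_on n A f.
Proof.
elim: n f => [|n IH] f [cf hf]; first by split.
by split=> // v; have [h1 h2] := hf v; split => //; exact: IH.
Qed.

Lemma Ck_cst {V W : normedModType F} n (A : set V) (c : W) :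
  Ck_on n A (fun _ : V => c).
Proof.
elim: n c => [|n IH] c.
  by split=> // x _; exact: cvg_cst.
split=> [x _|v]; first exact: cvg_cst.
split=> [x _|]; first exact: derivable_cst.
by rewrite (_ : 'D_v _ = fun=> 0) //; apply/funext => x; exact: derive_cst.
Qed.

Lemma Ck_lin {V W : normedModType F} n (A : set V) (l : V -> W) :
  open A -> linear l -> continuous l -> Ck_on n A l.
Proof.
move=> oA ll cl; case: n => [|n]; first by split=> // x _; exact: cl.
apply: (@CkS _ _ _ _ _ (fun v _ => l v)) => // [x _|v x _|v]; first exact: cl.
  exact: (is_derive_postlin ll cl (is_derive_id x v)).
exact: Ck_cst.
Qed.

Lemma Ck_add {V W : normedModType F} n (A : set V) (f g : V -> W) : open A ->
  Ck_on n A f -> Ck_on n A g -> Ck_on n A (fun x => f x + g x).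
Proof.
move=> oA; elim: n f g => [|n IH] f g hf hg.
  split=> // x Ax; apply: continuousD.
    exact: Ck_continuous hf Ax.
  exact: Ck_continuous hg Ax.
apply: (@CkS _ _ _ _ _ (fun v x => 'D_v f x + 'D_v g x)) => //.
- move=> x Ax; apply: continuousD.
    exact: Ck_continuous hf Ax.
  exact: Ck_continuous hg Ax.
- by move=> v x Ax; apply: is_deriveD; [exact: Ck_derive hf Ax|exact: Ck_derive hg Ax].
by move=> v; apply: IH; exact: CkD_v.
Qed.

Lemma Ck_mul {V : normedModType F} n (A : set V) (f g : V -> F) : open A ->
  Ck_on n A f -> Ck_on n A g -> Ck_on n A (fun x => f x * g x).
Proof.
move=> oA; elim: n f g => [|n IH] f g hf hg.
  split=> // x Ax; apply: continuousM.
    exact: Ck_continuous hf Ax.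
  exact: Ck_continuous hg Ax.
apply: (@CkS _ _ _ _ _ (fun v x => f x * 'D_v g x + g x * 'D_v f x)) => //.
- move=> x Ax; apply: continuousM.
    exact: Ck_continuous hf Ax.
  exact: Ck_continuous hg Ax.
- by move=> v x Ax; apply: is_deriveM; [exact: Ck_derive hf Ax|exact: Ck_derive hg Ax].
by move=> v; apply: Ck_add => //; apply: IH; first [exact: CkD_v|exact: Ck_pred].
Qed.

Lemma is_derive_inv {V : normedModType F} (f : V -> F) x v d : f x != 0 ->
  is_derive x v f d -> is_derive x v (fun y => (f y)^-1) (- (f x) ^- 2 * d).
Proof.
move=> fx [h <-]; split; first exact: derivableV.
by rewrite -[LHS]/('D_v (fun y => (f y)^-1) x) deriveV.
Qed.

(** The derivative of 1/f is polynomial in 1/f and the derivative of f, so the induction hypothesis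
    for 1/f itself yields one more order. *)
Lemma Ck_inv {V : normedModType F} n (A : set V) (f : V -> F) : open A ->
  (forall x, A x -> f x != 0) ->
  Ck_on n A f -> Ck_on n A (fun x => (f x)^-1).
Proof.
move=> oA f0; elim: n f f0 => [|n IH] f f0 hf.
  by split=> // x Ax; apply: continuousV; [exact: f0|exact: Ck_continuous hf Ax].
have hI : Ck_on n A (fun x => (f x)^-1) by apply: IH => //; exact: Ck_pred.
apply: (@CkS _ _ _ _ _ (fun v x => (-1) * ((f x)^-1 * (f x)^-1) * 'D_v f x)) => //.
- by move=> x Ax; apply: continuousV; [exact: f0|exact: Ck_continuous hf Ax].
- move=> v x Ax; rewrite mulN1r -expr2 exprVn.
  by apply: is_derive_inv; [exact: f0|exact: Ck_derive hf Ax].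
move=> v; apply: Ck_mul => //; last exact: CkD_v.
by apply: Ck_mul => //; [exact: Ck_cst|exact: Ck_mul].
Qed.

Lemma Ck_postlin {V W W' : normedModType F} n (A : set V) (l : W -> W')
  (f : V -> W) : open A -> linear l -> continuous l ->
  Ck_on n A f -> Ck_on n A (fun x => l (f x)).
Proof.
move=> oA ll cl; elim: n f => [|n IH] f hf.
  split=> // x Ax.
  exact: continuous_comp (Ck_continuous hf Ax) (cl _).
apply: (@CkS _ _ _ _ _ (fun v x => l ('D_v f x))) => //.
- move=> x Ax; exact: continuous_comp (Ck_continuous hf Ax) (cl _).
- by move=> v x Ax; apply: is_derive_postlin => //; exact: Ck_derive hf Ax.
by move=> v; apply: IH; exact: CkD_v.
Qed.

Lemma Ck_preaff {V' V W : normedModType F} n (A : set V) (B : set V')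
  (l : V' -> V) c (f : V -> W) : open B -> linear l -> continuous l ->
  (forall x, B x -> A (l x + c)) ->
  Ck_on n A f -> Ck_on n B (fun x => f (l x + c)).
Proof.
move=> oB ll cl BA.
have cc x : {for x, continuous (fun y => l y + c)}.
  by apply: continuousD; [exact: cl|exact: cvg_cst].
elim: n f => [|n IH] f hf.
  split=> // x Bx.
  exact: (@continuous_comp _ _ _ _ f) (cc x) (Ck_continuous hf (BA _ Bx)).
apply: (@CkS _ _ _ _ _ (fun v x => 'D_(l v) f (l x + c))) => //.
- move=> x Bx.
  exact: (@continuous_comp _ _ _ _ f) (cc x) (Ck_continuous hf (BA _ Bx)).
- by move=> v x Bx; apply: is_derive_preaff => //; exact: Ck_derive hf (BA _ Bx).
by move=> v; exact: (IH _ (CkD_v (l v) hf)).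
Qed.

(** An outer function of one variable obeys the chain rule as soon as it is derivable; several
    variables would call for total differentiability. *)
Lemma Ck_comp1 {V : normedModType F} n (A : set V) (B : set F)
  (g : F -> F) (f : V -> F) : open A -> (forall x, A x -> B (f x)) ->
  Ck_on n B g -> Ck_on n A f -> Ck_on n A (fun x => g (f x)).
Proof.
move=> oA AB; elim: n g => [|n IH] g hg hf.
  split=> // x Ax.
  exact: continuous_comp (Ck_continuous hf Ax)
    (Ck_continuous hg (AB _ Ax)).
apply: (@CkS _ _ _ _ _ (fun v x => 'D_1 g (f x) * 'D_v f x)) => //.
- move=> x Ax; exact: continuous_comp (Ck_continuous hf Ax)
    (Ck_continuous hg (AB _ Ax)).
- move=> v x Ax; apply: is_derive_comp1; last exact: Ck_derive hf Ax.
  exact: Ck_derive hg (AB _ Ax).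
move=> v; apply: Ck_mul => //; last exact: CkD_v.
exact: (IH _ (CkD_v (1 : F) hg) (Ck_pred hf)).
Qed.

Lemma is_deriveMf {V : normedModType F} (f g : V -> F) p v df dg :
  is_derive p v f df -> is_derive p v g dg ->
  is_derive p v (fun q => f q * g q) (f p * dg + g p * df).
Proof. by move=> h1 h2; exact: is_deriveM h1 h2. Qed.

Lemma is_deriveDf {V : normedModType F} (f g : V -> F) p v df dg :
  is_derive p v f df -> is_derive p v g dg ->
  is_derive p v (fun q => f q + g q) (df + dg).
Proof. by move=> h1 h2; exact: is_deriveD h1 h2. Qed.

End SmoothClosure.

Section SmoothFunctions.
Context {F : numFieldType}.

Lemma smooth_eq {V W : normedModType F} (A : set V) (f g : V -> W) : open A ->
  (forall x, A x -> f x = g x) -> smooth_on A f -> smooth_on A g.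
Proof. by move=> oA fg hf n; apply: Ck_eq (hf n). Qed.

Lemma smooth_subset {V W : normedModType F} (A B : set V) (f : V -> W) :
  B `<=` A -> smooth_on A f -> smooth_on B f.
Proof. by move=> BA hf n; apply: Ck_sub (hf n). Qed.

Lemma smooth_local {V W : normedModType F} (A : set V) (f : V -> W) :
  (forall x, A x -> exists2 B, B x & smooth_on B f) -> smooth_on A f.
Proof. by move=> h n; apply: Ck_local => x /h [B Bx hB]; exists B. Qed.

Lemma smooth_continuous {V W : normedModType F} (A : set V) (f : V -> W) x :
  smooth_on A f -> A x -> {for x, continuous f}.
Proof. by move=> hf; exact: (Ck_continuous (hf 0%N)). Qed.

Lemma smooth_is_derive {V W : normedModType F} (A : set V) (f : V -> W) x v :
  smooth_on A f -> A x -> is_derive x v f ('D_v f x).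
Proof. by move=> hf; exact: (Ck_derive v (hf 1%N)). Qed.

Lemma smoothD_v {V W : normedModType F} (A : set V) (f : V -> W) v :
  smooth_on A f -> smooth_on A ('D_v f).
Proof. by move=> hf n; exact: (CkD_v v (hf n.+1)). Qed.

(** On the line every direction v is a multiple of 1, so one derivative generates all of them. *)
Lemma Ck_intro1 {W : normedModType F} n (A : set F) (f df : F -> W) : open A ->
  (forall x, A x -> is_derive x 1 f (df x)) -> Ck_on n A df -> Ck_on n.+1 A f.
Proof.
move=> oA hd hC; apply: (@CkS F F W n A f (fun (v : F) x => v *: df x)) => //.
- by move=> x Ax; exact: is_derive_continuous1 (hd x Ax).
- move=> v x Ax; rewrite -[X in is_derive _ X _ _]mulr1.
  exact: (is_deriveZdir v (hd x Ax)).
move=> v; apply: (@Ck_postlin _ _ _ _ n A ( *:%R v) df) => //.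
- by move=> k a b; rewrite scalerDr !scalerA mulrC.
- exact: scaler_continuous.
Qed.

Lemma smooth_intro1 {W : normedModType F} (A : set F) (f df : F -> W) : open A ->
  (forall x, A x -> is_derive x 1 f (df x)) -> smooth_on A df -> smooth_on A f.
Proof.
move=> oA hd hC [|n]; last exact: Ck_intro1 hd (hC n).
by split=> // x Ax; exact: is_derive_continuous1 (hd x Ax).
Qed.

Lemma smooth_cst {V W : normedModType F} (A : set V) (c : W) :
  smooth_on A (fun _ : V => c).
Proof. by move=> n; exact: Ck_cst. Qed.

Lemma smooth_lin {V W : normedModType F} (A : set V) (l : V -> W) :
  open A -> linear l -> continuous l -> smooth_on A l.
Proof. by move=> oA ll cl n; exact: Ck_lin. Qed.

Lemma smooth_id {V : normedModType F} (A : set V) : open A -> smooth_on A id.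
Proof. by move=> oA; apply: smooth_lin => // x; exact: cvg_id. Qed.

Lemma smooth_add {V W : normedModType F} (A : set V) (f g : V -> W) : open A ->
  smooth_on A f -> smooth_on A g -> smooth_on A (fun x => f x + g x).
Proof. by move=> oA hf hg n; exact: Ck_add. Qed.

Lemma smooth_mul {V : normedModType F} (A : set V) (f g : V -> F) : open A ->
  smooth_on A f -> smooth_on A g -> smooth_on A (fun x => f x * g x).
Proof. by move=> oA hf hg n; exact: Ck_mul. Qed.

Lemma smooth_inv {V : normedModType F} (A : set V) (f : V -> F) : open A ->
  (forall x, A x -> f x != 0) ->
  smooth_on A f -> smooth_on A (fun x => (f x)^-1).
Proof. by move=> oA f0 hf n; exact: Ck_inv. Qed.

Lemma smooth_div {V : normedModType F} (A : set V) (f g : V -> F) : open A ->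
  (forall x, A x -> g x != 0) ->
  smooth_on A f -> smooth_on A g -> smooth_on A (fun x => f x / g x).
Proof. by move=> oA f0 hf hg; apply: smooth_mul => //; exact: smooth_inv. Qed.

Lemma smooth_postlin {V W W' : normedModType F} (A : set V) (l : W -> W')
  (f : V -> W) : open A -> linear l -> continuous l ->
  smooth_on A f -> smooth_on A (fun x => l (f x)).
Proof. by move=> oA ll cl hf n; exact: Ck_postlin. Qed.

Lemma smooth_preaff {V' V W : normedModType F} (A : set V) (B : set V')
  (l : V' -> V) c (f : V -> W) : open B -> linear l -> continuous l ->
  (forall x, B x -> A (l x + c)) ->
  smooth_on A f -> smooth_on B (fun x => f (l x + c)).
Proof. by move=> oA ll cl BA hf n; exact: Ck_preaff (hf n). Qed.

Lemma smooth_comp1 {V : normedModType F} (A : set V) (B : set F)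
  (g : F -> F) (f : V -> F) : open A -> (forall x, A x -> B (f x)) ->
  smooth_on B g -> smooth_on A f -> smooth_on A (fun x => g (f x)).
Proof. by move=> oA AB hg hf n; exact: Ck_comp1 (hg n) (hf n). Qed.

Lemma smooth_opp {V : normedModType F} (A : set V) (f : V -> F) : open A ->
  smooth_on A f -> smooth_on A (fun x => - f x).
Proof.
move=> oA hf; apply: (@smooth_eq _ _ _ (fun x => (-1) * f x)) => //.
  by move=> x _; rewrite mulN1r.
by apply: smooth_mul => //; exact: smooth_cst.
Qed.

Lemma smooth_sub {V : normedModType F} (A : set V) (f g : V -> F) : open A ->
  smooth_on A f -> smooth_on A g -> smooth_on A (fun x => f x - g x).
Proof. by move=> oA hf hg; apply: smooth_add => //; exact: smooth_opp. Qed.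

Lemma smooth_sum {V W : normedModType F} (A : set V) (I : Type) (s : seq I)
  (f : I -> V -> W) : open A -> (forall i, smooth_on A (f i)) ->
  smooth_on A (fun x => \sum_(i <- s) f i x).
Proof.
move=> oA hf; elim: s => [|i s IH].
  apply: (@smooth_eq _ _ _ (fun _ => 0)) => //; last exact: smooth_cst.
  by move=> x _; rewrite big_nil.
apply: (@smooth_eq _ _ _ (fun x => f i x + \sum_(i <- s) f i x)) => //.
  by move=> x _; rewrite big_cons.
exact: smooth_add.
Qed.

Lemma smooth_prod {V : normedModType F} (A : set V) (I : Type) (s : seq I)
  (f : I -> V -> F) : open A -> (forall i, smooth_on A (f i)) ->
  smooth_on A (fun x => \prod_(i <- s) f i x).
Proof.
move=> oA hf; elim: s => [|i s IH].
  apply: (@smooth_eq _ _ _ (fun _ => (1 : F))) => //; last exact: smooth_cst.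
  by move=> x _; rewrite big_nil.
apply: (@smooth_eq _ _ _ (fun x => f i x * \prod_(i <- s) f i x)) => //.
  by move=> x _; rewrite big_cons.
exact: smooth_mul.
Qed.

Lemma smooth_exp {V : normedModType F} (A : set V) (f : V -> F) k : open A ->
  smooth_on A f -> smooth_on A (fun x => f x ^+ k).
Proof.
move=> oA hf; elim: k => [|k IH]; first exact: smooth_cst.
apply: (@smooth_eq _ _ _ (fun x => f x * f x ^+ k)) => //.
  by move=> x _; rewrite exprS.
exact: smooth_mul.
Qed.

Section Pairs.
Context {U W : normedModType F}.

Lemma fst_lin : linear (@fst U W). Proof. by []. Qed.
Lemma snd_lin : linear (@snd U W). Proof. by []. Qed.
Lemma fst_cont : continuous (@fst U W). Proof. by move=> x; exact: cvg_fst. Qed.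
Lemma snd_cont : continuous (@snd U W). Proof. by move=> x; exact: cvg_snd. Qed.

Lemma inl_lin : linear (fun x : U => (x, 0 : W)).
Proof.
by move=> k a b; rewrite [RHS]/GRing.add /= /add_pair /= [in RHS]scaler0 addr0.
Qed.
Lemma inr_lin : linear (fun x : W => (0 : U, x)).
Proof.
by move=> k a b; rewrite [RHS]/GRing.add /= /add_pair /= [in RHS]scaler0 addr0.
Qed.
Lemma inl_cont : continuous (fun x : U => (x, 0 : W)).
Proof. by move=> x; apply: cvg_pair => //=; exact: cvg_cst. Qed.
Lemma inr_cont : continuous (fun x : W => (0 : U, x)).
Proof. by move=> x; apply: cvg_pair => //=; exact: cvg_cst. Qed.

Context {V : normedModType F}.

Lemma smooth_fst (A : set V) (f : V -> U * W) : open A ->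
  smooth_on A f -> smooth_on A (fun x => (f x).1).
Proof. by move=> oA; apply: smooth_postlin => //; exact: fst_cont. Qed.

Lemma smooth_snd (A : set V) (f : V -> U * W) : open A ->
  smooth_on A f -> smooth_on A (fun x => (f x).2).
Proof. by move=> oA; apply: smooth_postlin => //; exact: snd_cont. Qed.

Lemma smooth_pair (A : set V) (f : V -> U) (g : V -> W) : open A ->
  smooth_on A f -> smooth_on A g -> smooth_on A (fun x => (f x, g x)).
Proof.
move=> oA hf hg.
apply: (@smooth_eq _ _ _ (fun x => (f x, 0) + (0, g x))) => //.
  by move=> x _; rewrite /GRing.add /= /add_pair /= add0r addr0.
apply: smooth_add => //.
  exact: (@smooth_postlin _ _ _ _ (fun x : U => (x, 0 : W)) f oA inl_lin inl_cont).
exact: (@smooth_postlin _ _ _ _ (fun x : W => (0 : U, x)) g oA inr_lin inr_cont).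
Qed.

End Pairs.

Section Rows.
Context {V : normedModType F} {n : nat}.

Lemma coord_lin j : linear (fun y : 'rV[F]_n => y 0 j).
Proof. by move=> k a b; rewrite !mxE. Qed.

Lemma coord_cont j : continuous (fun y : 'rV[F]_n => y 0 j).
Proof. exact: coord_continuous. Qed.

Lemma delta_lin j : linear (fun x : F => x *: (delta_mx 0 j : 'rV[F]_n)).
Proof. by move=> k a b; rewrite scalerDl scalerA. Qed.

Lemma delta_cont j : continuous (fun x : F => x *: (delta_mx 0 j : 'rV[F]_n)).
Proof. exact: scalel_continuous. Qed.

Lemma smooth_coord (A : set V) (f : V -> 'rV[F]_n) j : open A ->
  smooth_on A f -> smooth_on A (fun x => f x 0 j).
Proof.
move=> oA; exact: (smooth_postlin oA (@coord_lin j) (@coord_cont j)).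
Qed.

Lemma smooth_row (A : set V) (f : 'I_n -> V -> F) : open A ->
  (forall j, smooth_on A (f j)) -> smooth_on A (fun x => \row_j f j x).
Proof.
move=> oA hf.
apply: (@smooth_eq _ _ _ (fun x => \sum_j f j x *: (delta_mx 0 j : 'rV[F]_n))) => //.
  move=> x _; rewrite [RHS]row_sum_delta.
  by apply: eq_bigr => j _; rewrite mxE.
apply: smooth_sum => // j.
exact: (smooth_postlin oA (@delta_lin j) (@delta_cont j)).
Qed.

End Rows.

Lemma open_box (Om : set (F * F)) z : open Om -> Om z ->
  exists2 d : F, 0 < d & forall w, `|z.1 - w.1| < d -> `|z.2 - w.2| < d -> Om w.
Proof.
move=> oO Oz; have /nbhs_ballP [d /= d0 hd] := open_nbhs_nbhs (conj oO Oz).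
by exists d => // w h1 h2; apply: hd; split; rewrite -ball_normE.
Qed.

Lemma open_ball1 (I : set F) t : open I -> I t ->
  exists2 d : F, 0 < d & forall s, `|t - s| < d -> I s.
Proof.
move=> oO Oz; have /nbhs_ballP [d /= d0 hd] := open_nbhs_nbhs (conj oO Oz).
by exists d => // w h1; apply: hd; rewrite -ball_normE.
Qed.

Lemma open_disk (c d : F) : open [set x | `|c - x| < d].
Proof. by move: (@ball_open F F c d); rewrite -ball_normE. Qed.

Lemma open_rect (I J : set F) : open I -> open J -> open (I `*` J).
Proof.
move=> oI oJ; rewrite (_ : I `*` J = (fst @^-1` I) `&` (snd @^-1` J)) //.
by apply: openI; apply: open_comp => // x _; [exact: cvg_fst|exact: cvg_snd].
Qed.

End SmoothFunctions.

(** * Consequences of the mean value inequality *)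

(** An inequality, because the mean value theorem as an equality fails for complex functions; posed
    on disks, because these make sense in any normed field. *)
Definition mean_value_ineq (F : numFieldType) : Prop :=
  forall (f : F -> F) (c rho M : F),
  (forall x, `|c - x| < rho -> exists2 d, is_derive x 1 f d & `|d| <= M) ->
  forall x y, `|c - x| < rho -> `|c - y| < rho -> `|f x - f y| <= M * `|x - y|.

Section MeanValue.
Context {F : numFieldType} (mv : mean_value_ineq F).

(** With M = 0 the inequality makes f locally constant; the level set of f s is then open and closed
    in the connected set I. *)
Lemma derive0_const (I : set F) (f : F -> F) : open I -> connected I ->
  (forall t, I t -> is_derive t 1 f 0) -> forall s t, I s -> I t -> f s = f t.
Proof.
move=> oI cI df s t Is It.
have loc u : I u -> exists2 d : F, 0 < d & forall w, `|u - w| < d -> I w /\ f w = f u.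
  move=> Iu; have [d d0 hd] := open_ball1 oI Iu; exists d => // w hw.
  split; first exact: hd.
  apply/eqP; rewrite -subr_eq0 -normr_le0.
  apply: le_trans (mv (c := u) (rho := d) (M := 0) _ hw _) _.
  - by move=> x /hd /df hx; exists 0; rewrite ?normr0.
  - by rewrite subrr normr0.
  - by rewrite mul0r.
(* Local constancy makes every preimage open. This is used for the level set and for its
   complement. *)
have op (P : set F) : open [set u | I u /\ P (f u)].
  rewrite openE => u /= [Iu Pu]; have [d d0 hd] := loc u Iu.
  apply/nbhs_ballP; exists d => //= w; rewrite -ball_normE /= => /hd [Iw fw].
  by rewrite fw.
have E : [set u | I u /\ f u = f s] = I; last by move: It; rewrite -E => -[_ ->].
apply: cI; first by exists s.
- exists [set u | I u /\ f u = f s]; first exact: (op [set y | y = f s]).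
  by apply/seteqP; split=> u /=; [move=> [] | move=> [_ []]].
exists (~` [set u | I u /\ f u <> f s]).
  exact/open_closedC/(op [set y | y <> f s]).
apply/seteqP; split=> u /=; first by move=> [Iu fu]; split=> // -[].
by move=> [Iu h]; split=> //; apply: contrapT => h'; apply: h.
Qed.

(** Connectedness is itself a consequence of the mean value inequality: the indicator function of a
    relatively clopen subset has derivative 0, hence is constant. *)
Lemma connected_disk (c d : F) : connected [set x | `|c - x| < d].
Proof.
move=> B [b Bb] [C oC BC] [C' cC' BC'].
have bd : `|c - b| < d by move: Bb; rewrite BC => -[].
apply/seteqP; split=> [x|x hx]; first by rewrite BC => -[].
pose f (y : F) : F := if `[< B y >] then 1 else 0.
have h : `|f x - f b| <= 0 * `|x - b|.
  apply: (mv (c := c) (rho := d)) => // y hy.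
  exists 0; last by rewrite normr0.
  have oA := @open_disk F c d.
  have [By|nBy] := pselect (B y).
    apply: (@is_derive_near F F F ([set x | `|c - x| < d] `&` C) (cst (1 : F))).
    - exact: openI.
    - by rewrite -BC.
    by move=> w; rewrite -BC /f /= => Bw; rewrite asboolT.
  apply: (@is_derive_near F F F ([set x | `|c - x| < d] `&` ~` C') (cst (0 : F))).
  - by apply: openI => //; exact: closed_openC.
  - by split=> // C'y; apply: nBy; rewrite BC'.
  by move=> w [_ nw]; rewrite /f asboolF // BC' => -[].
move: h; rewrite mul0r normr_le0 subr_eq0 /f (asboolT Bb).
by case: asboolP => // _; rewrite eq_sym oner_eq0.
Qed.

Lemma is_domain_disk (c d : F) : 0 < d -> is_domain [set x : F | `|c - x| < d].
Proof.
move=> d0; split; first exact: open_disk.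
  by exists c; rewrite /= subrr normr0.
exact: connected_disk.
Qed.

Lemma is_derive_fix1 (f : F * F -> F) s t d : is_derive (s, t) (0 : F, 1 : F) f d ->
  is_derive t (1 : F) (fun x => f (s, x)) d.
Proof.
move=> /is_derive_line H; apply/is_derive_line.
apply: (eq_ind _ (fun g => is_derive (0 : F) 1 g d) H).
by apply/funext => h; congr (f (_, _)); rewrite /= ?scaler0 ?add0r.
Qed.

Lemma is_derive_fix2 (f : F * F -> F) s t d : is_derive (s, t) (1 : F, 0 : F) f d ->
  is_derive s (1 : F) (fun x => f (x, t)) d.
Proof.
move=> /is_derive_line H; apply/is_derive_line.
apply: (eq_ind _ (fun g => is_derive (0 : F) 1 g d) H).
by apply/funext => h; congr (f (_, _)); rewrite /= ?scaler0 ?add0r.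
Qed.

(** The increment is split into a step along t, handled by homogeneity, and a step along x, whose
    deviation from b f_x is bounded by the mean value inequality and the continuity of f_x at z. *)
Lemma derive_dir (Om : set (F * F)) (f : F * F -> F) z (a b : F) : open Om ->
  Ck_on 1 Om f -> Om z ->
  is_derive z (a, b) f (a * 'D_(1, 0) f z + b * 'D_(0, 1) f z).
Proof.
move=> oO hf Oz.
set ft := 'D_(1, 0) f z; set fx := 'D_(0, 1) f z.
have ht : is_derive z (a, 0 : F) f (a * ft).
  have -> : (a, 0) = a *: (1, 0) :> F * F.
    by congr (_, _); rewrite /GRing.scale /= ?mulr1 ?mulr0.
  exact: is_deriveZdir (Ck_derive _ hf Oz).
suff Q : h^-1 *: (f (h *: (a, b) + z) - f (h *: (a, 0) + z)) @[h --> 0^'] --> b * fx.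
  suff H : h^-1 *: (f (h *: (a, b) + z) - f z) @[h --> 0^'] --> a * ft + b * fx.
    by apply: DeriveDef; [apply/cvg_ex; exists (a * ft + b * fx) | exact: cvg_lim].
  have -> : (fun h => h^-1 *: (f (h *: (a, b) + z) - f z)) =
    (fun h => h^-1 *: (f (h *: (a, 0) + z) - f z)) \+
    (fun h => h^-1 *: (f (h *: (a, b) + z) - f (h *: (a, 0) + z))).
    by apply/funext => h /=; rewrite -scalerDr; congr (_ *: _); ring.
  apply: cvgD => //; case: ht => ht <-; exact: ht.
apply/cvgrPdist_le => e e0.
(* The summand 1 avoids a division by zero for b = 0; the same device serves in the bound on h. *)
pose e' := e / (`|b| + 1).
have b1 : 0 < `|b| + 1 by rewrite ltr_wpDl.
have e'0 : 0 < e' by rewrite divr_gt0.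
have cx : {for z, continuous ('D_(0, 1) f)} := Ck_continuous (CkD_v (0 : F, 1 : F) hf) Oz.
move: cx => /cvgrPdist_le /(_ e' e'0).
move=> /(filterI (open_nbhs_nbhs (conj oO Oz))) /nbhs_ballP [d /= d0 hd].
have dd : 0 < d / (`|a| + `|b| + 1) by rewrite divr_gt0 // ltr_wpDl // addr_ge0.
near=> h.
have h0 : h != 0 by near: h; exact: nbhs_dnbhs_neq.
have hs : `|h| * (`|a| + `|b| + 1) < d.
  rewrite -ltr_pdivlMr ?ltr_wpDl ?addr_ge0 //; near: h; apply: dnbhs0_lt => //.
have ha : `|h * a| < d.
  apply: le_lt_trans hs; rewrite normrM ler_wpM2l // -addrA lerDl addr_ge0 //.
have hb : `|h * b| < d.
  apply: le_lt_trans hs; rewrite normrM ler_wpM2l // addrAC lerDr addr_ge0 //.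
(* With the linear part subtracted, the slope of [g] is the deviation of f_x from its value at z, at
   most [e']. *)
pose g s := f (h * a + z.1, s) - s * fx.
have P x : `|z.2 - x| < d -> exists2 d, is_derive x 1 g d & `|d| <= e'.
  move=> hx; pose w := (h * a + z.1, x).
  have [Ow hw] : Om w /\ `|fx - 'D_(0, 1) f w| <= e'.
    apply: hd; split; rewrite -ball_normE //= opprD addrCA subrr addr0 normrN //.
  exists ('D_(0, 1) f w - fx); last by rewrite distrC.
  apply: is_deriveB; first exact: is_derive_fix1 (Ck_derive _ hf Ow).
  have := is_deriveM (is_derive_id x (1 : F)) (is_derive_cst fx x 1).
  by rewrite scaler0 add0r /GRing.scale /= mulr1.
have z2 : `|z.2 - z.2| < d by rewrite subrr normr0.
have zb : `|z.2 - (h * b + z.2)| < d by rewrite opprD addrCA subrr addr0 normrN.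
have := mv P zb z2; rewrite /g addrK => gg.
have -> : b * fx - h^-1 *: (f (h *: (a, b) + z) - f (h *: (a, 0) + z)) =
   - h^-1 * (f (h * a + z.1, h * b + z.2) - (h * b + z.2) * fx -
             (f (h * a + z.1, z.2) - z.2 * fx)).
  rewrite (_ : h *: (a, b) + z = (h * a + z.1, h * b + z.2)) //.
  rewrite (_ : h *: (a, 0) + z = (h * a + z.1, z.2)); last first.
    by congr (_, _); rewrite /= scaler0 add0r.
  rewrite /GRing.scale /=; field; exact: h0.
rewrite normrM normrN normfV ler_pdivrMl ?normr_gt0 //.
have e'b : e' * `|b| <= e.
  by rewrite /e' mulrAC ler_pdivrMr // ler_wpM2l ?(ltW e0) // lerDl.
by apply: le_trans gg _; rewrite normrM mulrCA ler_wpM2l.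
Unshelve. all: by end_near.
Qed.

End MeanValue.

(** The derivative is bounded only on the segment from x to y, with s between 0 and 1 and therefore
    real. Taylor remainders need this sharper form, since there the bound depends on the distance to
    the centre. *)
Definition mean_value_segment (F : numFieldType) : Prop :=
  forall (f : F -> F) (x y M : F),
  (forall s : F, 0 <= s -> s <= 1 ->
    exists2 d, is_derive (s * (y - x) + x) 1 f d & `|d| <= M) ->
  `|f x - f y| <= M * `|x - y|.

Lemma disk_convex (F : numFieldType) (c x y rho s : F) :
  `|c - x| < rho -> `|c - y| < rho -> 0 <= s -> s <= 1 -> `|c - (s * (y - x) + x)| < rho.
Proof.
(* Strictness is taken from the term with factor s, so s = 0 is treated apart. *)
move=> hx hy s0 s1; have [->|sn] := eqVneq s 0; first by rewrite mul0r add0r.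
have -> : c - (s * (y - x) + x) = (1 - s) * (c - x) + s * (c - y) by ring.
have -> : rho = (1 - s) * rho + s * rho by ring.
apply: le_lt_trans (ler_normD _ _) _; rewrite !normrM.
have p : 0 <= 1 - s by rewrite subr_ge0.
rewrite (ger0_norm s0) (ger0_norm p); apply: ler_ltD.
  by apply: ler_wpM2l => //; exact: ltW.
by rewrite ltr_pM2l // lt_neqAle eq_sym sn.
Qed.

Lemma mean_value_disk_ineq (F : numFieldType) : mean_value_segment F -> mean_value_ineq F.
Proof.
move=> ms f c rho M H x y hx hy; apply: ms => s s0 s1.
by apply: H; exact: disk_convex.
Qed.

(** * Point transformations and jets *)

Section TimeFunctions.
Context {F : numFieldType} (mv : mean_value_ineq F).
Implicit Types (f g : F * F -> F) (z : F * F).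

Definition dt f : F * F -> F := 'D_(1, 0) f.
Definition dx f : F * F -> F := 'D_(0, 1) f.

Lemma is_derive_dt (Om : set (F * F)) f z : smooth_on Om f -> Om z ->
  is_derive z (1, 0) f (dt f z).
Proof. by move=> sf Oz; exact: smooth_is_derive Oz. Qed.

Lemma is_derive_dx (Om : set (F * F)) f z : smooth_on Om f -> Om z ->
  is_derive z (0, 1) f (dx f z).
Proof. by move=> sf Oz; exact: smooth_is_derive Oz. Qed.

Lemma smooth_dt (Om : set (F * F)) f : smooth_on Om f -> smooth_on Om (dt f).
Proof. exact: smoothD_v. Qed.

Lemma smooth_dx (Om : set (F * F)) f : smooth_on Om f -> smooth_on Om (dx f).
Proof. exact: smoothD_v. Qed.

(** Dependence on t alone is expressed infinitesimally: over an arbitrary open Om the slice at a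
    given t may be disconnected, and the value may differ from one component to another. *)
Definition time_fun (Om : set (F * F)) f :=
  smooth_on Om f /\ forall z, Om z -> dx f z = 0.

Section Closure.
Context (Om : set (F * F)) (oOm : open Om).

Lemma time_fun_dx f z : time_fun Om f -> Om z -> is_derive z (0, 1) f 0.
Proof. by move=> [sf f0] Oz; have := is_derive_dx sf Oz; rewrite f0. Qed.

Lemma time_funI f : smooth_on Om f ->
  (forall z, Om z -> is_derive z (0, 1) f 0) -> time_fun Om f.
Proof. by move=> sf h; split=> // z /h [_]. Qed.

Lemma time_fun_cst c : time_fun Om (fun=> c).
Proof. by apply: time_funI; exact: smooth_cst. Qed.

Lemma time_fun_add f g : time_fun Om f -> time_fun Om g ->
  time_fun Om (fun z => f z + g z).
Proof.
move=> hf hg; apply: time_funI.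
  by apply: smooth_add => //; [case: hf|case: hg].
move=> z Oz; rewrite -[X in is_derive _ _ _ X]addr0.
by apply: is_deriveD; exact: time_fun_dx.
Qed.

Lemma time_fun_mul f g : time_fun Om f -> time_fun Om g ->
  time_fun Om (fun z => f z * g z).
Proof.
move=> hf hg; apply: time_funI.
  by apply: smooth_mul => //; [case: hf|case: hg].
move=> z Oz; have := is_deriveM (time_fun_dx hf Oz) (time_fun_dx hg Oz).
by rewrite !scaler0 addr0.
Qed.

Lemma time_fun_inv f : (forall z, Om z -> f z != 0) -> time_fun Om f ->
  time_fun Om (fun z => (f z)^-1).
Proof.
move=> f0 hf; apply: time_funI.
  by apply: smooth_inv => //; case: hf.
move=> z Oz; have := is_derive_inv (f0 z Oz) (time_fun_dx hf Oz).
by rewrite mulr0.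
Qed.

Lemma time_fun_div f g : (forall z, Om z -> g z != 0) ->
  time_fun Om f -> time_fun Om g -> time_fun Om (fun z => f z / g z).
Proof. by move=> g0 hf hg; apply: time_fun_mul => //; exact: time_fun_inv. Qed.

Lemma time_fun_const f (t : F) (J : set F) x y : time_fun Om f -> open J -> connected J ->
  (forall w, J w -> Om (t, w)) -> J x -> J y -> f (t, x) = f (t, y).
Proof.
move=> hf oJ cJ JO Jx Jy.
apply: (derive0_const mv oJ cJ (f := fun w => f (t, w))) => // w /JO Ow.
exact: is_derive_fix1 (time_fun_dx hf Ow).
Qed.

Lemma time_fun_box f (z : F * F) (d : F) w : time_fun Om f ->
  (forall w, `|z.1 - w.1| < d -> `|z.2 - w.2| < d -> Om w) ->
  `|z.1 - w.1| < d -> `|z.2 - w.2| < d -> f w = f (w.1, z.2).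
Proof.
case: w => t x hf bO /= ht hx.
apply: (time_fun_const (J := [set y | `|z.2 - y| < d])) => //.
- exact: open_disk.
- exact: connected_disk.
- by move=> y hy; exact: bO.
- by rewrite /= subrr normr0; exact: le_lt_trans hx.
Qed.

(** Instead of interchanging mixed derivatives, f is replaced on a box by its restriction to the
    line x = z.2, whose t-derivative visibly does not depend on x. *)
Lemma time_fun_dt f : time_fun Om f -> time_fun Om (dt f).
Proof.
move=> hf; apply: time_funI; first by apply: smooth_dt; case: hf.
move=> z Oz; have [d d0 hd] := open_box oOm Oz.
pose B := [set y | `|z.1 - y| < d] `*` [set y | `|z.2 - y| < d].
have oB : open B by apply: open_rect; exact: open_disk.
have Bz : B z by split; rewrite /= subrr normr0.
pose l (w : F * F) : F * F := (w.1, 0).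
have ll : linear l.
  by move=> k a b; rewrite /l; congr (_, _); rewrite /= ?scaler0 ?addr0.
have E w : B w -> f w = f (w.1, z.2) by move=> [h1 h2]; exact: time_fun_box h1 h2.
have lE w : l w + (0, z.2) = (w.1, z.2).
  by rewrite /l; congr (_, _); rewrite /= ?add0r ?addr0.
have OB w : B w -> Om (w.1, z.2).
  by move=> [h1 h2]; apply: hd => //=; rewrite subrr normr0.
have D w : B w -> dt f w = dt f (l w + (0, z.2)).
  move=> Bw; rewrite /dt (@derive_near _ _ _ B f (fun w => f (l w + (0, z.2)))) //.
    have [|_ e] := @is_derive_preaff _ _ _ _ l (0, z.2) f w (1, 0) (dt f (l w + (0, z.2))) ll.
    by rewrite lE; apply: is_derive_dt (OB _ Bw); case: hf.
  exact: e.
  by move=> y By; rewrite lE -E.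
apply: (@is_derive_near _ _ _ B (fun w => dt f (l w + (0, z.2)))) => //.
  by move=> y By; rewrite -D.
apply: is_derive_preaff => //.
by rewrite (_ : l (0, 1) = 0) //; exact: is_derive0.
Qed.

End Closure.
End TimeFunctions.

Section Jets.
Context {F : numFieldType} (mv : mean_value_ineq F) (r : nat).
Local Notation jet := (F * 'rV[F]_r.+1)%type.

Lemma jet_base_lin : linear (@jet_base F r).
Proof. by move=> k a b; rewrite /jet_base; congr (_, _); rewrite /= !mxE. Qed.

Lemma jet_base_cont : continuous (@jet_base F r).
Proof.
move=> p; rewrite /continuous_at.
have h1 : (fun q : jet => q.1) @ p --> p.1 by exact: cvg_fst.
have h2 : (fun q : jet => q.2 0 ord0) @ p --> p.2 0 ord0.
  apply: (@continuous_comp _ _ _ (@snd F 'rV[F]_r.+1) (fun y : 'rV[F]_r.+1 => y 0 ord0)).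
    exact: cvg_snd.
  exact: coord_continuous.
exact: cvg_pair h1 h2.
Qed.

Lemma open_over (Om : set (F * F)) : open Om -> open [set p : jet | Om (jet_base p)].
Proof. by move=> oO; apply: open_comp => // p _; exact: jet_base_cont. Qed.

Lemma is_derive_prelin {V' V W : normedModType F} (l : V' -> V)
    (f : V -> W) x v d : linear l ->
  is_derive (l x) (l v) f d -> is_derive x v (fun y => f (l y)) d.
Proof.
move=> ll h; have := @is_derive_preaff _ _ _ _ l 0 f x v d ll.
by rewrite addr0 => /(_ h); under eq_fun do rewrite addr0.
Qed.

Lemma smooth_prelin {V' V W : normedModType F} (A : set V) (B : set V')
  (l : V' -> V) (f : V -> W) : open B -> linear l -> continuous l ->
  (forall x, B x -> A (l x)) ->
  smooth_on A f -> smooth_on B (fun x => f (l x)).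
Proof.
move=> oB ll cl BA hf.
apply: (@smooth_eq _ _ _ _ (fun x => f (l x + 0))) => //.
  by move=> x _; rewrite addr0.
by apply: smooth_preaff hf => // x /BA; rewrite addr0.
Qed.

Lemma is_derive_base (Om : set (F * F)) (f : F * F -> F) (p v : jet) :
  open Om -> smooth_on Om f -> Om (jet_base p) ->
  is_derive p v (fun q => f (jet_base q))
    (v.1 * dt f (jet_base p) + v.2 0 ord0 * dx f (jet_base p)).
Proof.
move=> oO sf Op; apply: is_derive_prelin; first exact: jet_base_lin.
exact: (derive_dir mv _ _ oO (sf 1%N) Op).
Qed.

Definition jet_dir (p : jet) : jet :=
  (1, \row_(i < r.+1) (if (i < r)%N then p.2 0 (inord i.+1) else 0)).

Lemma is_derive_jet (i : 'I_r.+1) (p v : jet) :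
  is_derive p v (fun q : jet => q.2 0 i) (v.2 0 i).
Proof.
apply: (@is_derive_prelin _ _ _ snd (fun y : 'rV[F]_r.+1 => y 0 i)) => //.
exact: (is_derive_postlin (@coord_lin _ _ i) (@coord_cont _ _ i)).
Qed.

End Jets.

(** * Prolongation of transformations with T_x = 0 and X_xx = 0 *)

Section Prolongation.
Context {F : numFieldType} (mv : mean_value_ineq F) (r : nat) (hr : (2 <= r)%N).
Local Notation jet := (F * 'rV[F]_r.+1)%type.
Implicit Types (phi : F * F -> F * F).

Definition tcomp phi : F * F -> F := fun z => (phi z).1.
Definition xcomp phi : F * F -> F := fun z => (phi z).2.

Lemma smooth_tcomp (Om : set (F * F)) phi : open Om -> smooth_on Om phi ->
  smooth_on Om (tcomp phi).
Proof. exact: smooth_fst. Qed.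

Lemma smooth_xcomp (Om : set (F * F)) phi : open Om -> smooth_on Om phi ->
  smooth_on Om (xcomp phi).
Proof. exact: smooth_snd. Qed.

(** The entries N_ki of the affine prolongation x~^(k) = sum_i N_ki y_i + n_k; [pshift] is n_k. The
    recursion is D_t followed by division by T_t: y_i arises from N_ki y_i by differentiating the
    coefficient, and from N_(k,i-1) y_(i-1) by differentiating the jet coordinate. *)
Fixpoint pcoef phi (k i : nat) : F * F -> F :=
  if k is k'.+1 then
    fun z => (dt (pcoef phi k' i) z + (if i is i'.+1 then pcoef phi k' i' z else 0))
               / dt (tcomp phi) z
  else fun z => if i is 0%N then dx (xcomp phi) z else 0.

Fixpoint pshift phi (k : nat) : F * F -> F :=
  if k is k'.+1 then fun z => dt (pshift phi k') z / dt (tcomp phi) z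
  else fun z => xcomp phi z - dx (xcomp phi) z * z.2.

Definition fibre_affine (Om : set (F * F)) phi :=
  forall z, Om z -> dx (tcomp phi) z = 0 /\ dx (dx (xcomp phi)) z = 0.

Lemma jacobianE phi z : jacobian_tx phi z =
  dt (tcomp phi) z * dx (xcomp phi) z - dx (tcomp phi) z * dt (xcomp phi) z.
Proof. by []. Qed.

Section FibreAffine.
Context (Om : set (F * F)) phi.
Context (pt : point_transformation Om phi) (fa : fibre_affine Om phi).

Let oOm : open Om. Proof. by case: pt. Qed.
Let sphi : smooth_on Om phi. Proof. by case: pt. Qed.

Lemma fibre_jacobian z : Om z ->
  dt (tcomp phi) z != 0 /\ dx (xcomp phi) z != 0.
Proof.
move=> Oz; case: pt => _ _ /(_ z Oz); rewrite jacobianE.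
by have [-> _] := fa Oz; rewrite mul0r subr0 mulf_eq0 negb_or => /andP.
Qed.

Lemma time_fun_tcomp : time_fun Om (tcomp phi).
Proof. by split=> [|z /fa []//]; exact: smooth_tcomp. Qed.

Lemma time_fun_dxx : time_fun Om (dx (xcomp phi)).
Proof. by split=> [|z /fa []//]; apply: smooth_dx; exact: smooth_xcomp. Qed.

Lemma is_derive_snd2 (z v : F * F) : is_derive z v (fun w : F * F => w.2) v.2.
Proof. by apply: (@is_derive_postlin F _ _ _ (@snd F F) id) => //; exact: snd_cont. Qed.

Lemma time_fun_pcoef k i : time_fun Om (pcoef phi k i).
Proof.
elim: k i => [|k IH] i /=.
  by case: i => [|i]; [exact: time_fun_dxx|exact: time_fun_cst].
apply: time_fun_div => //; first by move=> z /fibre_jacobian [].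
  apply: time_fun_add => //; first exact: time_fun_dt.
  by case: i => [|i]; [exact: time_fun_cst|exact: IH].
by apply: time_fun_dt => //; exact: time_fun_tcomp.
Qed.

Lemma time_fun_pshift k : time_fun Om (pshift phi k).
Proof.
elim: k => [|k IH] /=.
  have sx : smooth_on Om (fun z : F * F => z.2).
    by apply: smooth_lin => //; exact: snd_cont.
  apply: time_funI.
    apply: smooth_sub => //; first exact: smooth_xcomp.
    by apply: smooth_mul => //; case: time_fun_dxx.
  move=> z Oz.
  have h1 := is_derive_dx (smooth_xcomp oOm sphi) Oz.
  have h2 := is_deriveM (time_fun_dx time_fun_dxx Oz) (is_derive_snd2 z (0, 1)).
  have := is_deriveB h1 h2.
  by rewrite scaler0 addr0 /GRing.scale /= mulr1 subrr.
apply: time_fun_div => //; first by move=> z /fibre_jacobian [].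
  exact: time_fun_dt.
by apply: time_fun_dt => //; exact: time_fun_tcomp.
Qed.

Lemma pcoef_gt k i z : (k < i)%N -> Om z -> pcoef phi k i z = 0.
Proof.
elim: k i z => [|k IH] [|i] z //= ki Oz.
rewrite IH // addr0 (_ : dt _ z = 0) ?mul0r //.
rewrite /dt (@derive_near _ _ _ Om _ (cst 0)) //; first exact: derive_cst.
by move=> y Oy; rewrite IH // ltnW.
Qed.

Lemma pcoef_diag k z : Om z ->
  pcoef phi k k z = dx (xcomp phi) z / dt (tcomp phi) z ^+ k.
Proof.
elim: k => [|k IH] Oz /=; first by rewrite expr0 divr1.
rewrite IH // (_ : dt _ z = 0) ?add0r; last first.
  rewrite /dt (@derive_near _ _ _ Om _ (cst 0)) //; first exact: derive_cst.
  by move=> y Oy; rewrite pcoef_gt.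
by rewrite -mulrA -invfM exprSr.
Qed.

(** Each step of the recursion adds the t-derivative of a diagonal entry X_x / T_t^j. The exponents
    j, summed up to k, give the binomial coefficient. *)
Lemma pcoef_subdiag k z : Om z ->
  pcoef phi k.+1 k z * dt (tcomp phi) z ^+ k.+2 =
  k.+1%:R * dt (dx (xcomp phi)) z * dt (tcomp phi) z
    - 'C(k.+1, 2)%:R * dx (xcomp phi) z * dt (dt (tcomp phi)) z.
Proof.
move=> Oz; have [T0 X0] := fibre_jacobian Oz.
set T1 := dt (tcomp phi) z in T0 *; set T2 := dt (dt (tcomp phi)) z.
set A := dx (xcomp phi) z in X0 *; set A1 := dt (dx (xcomp phi)) z.
have D j : dt (pcoef phi j j) z = A1 / T1 ^+ j - j%:R * A * T2 / T1 ^+ j.+1.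
  rewrite /dt (@derive_near _ _ _ Om _
    (fun z => dx (xcomp phi) z * (dt (tcomp phi) z ^+ j)^-1)) //; last first.
    by move=> y Oy; rewrite pcoef_diag.
  have h1 := is_derive_dt (smooth_dx (smooth_xcomp oOm sphi)) Oz.
  have h2 := is_derive_dt (smooth_dt (smooth_tcomp oOm sphi)) Oz.
  have h3 := is_deriveX j h2.
  have h3' : is_derive z (1, 0) (fun z => dt (tcomp phi) z ^+ j)
     (j%:R * T1 ^+ j.-1 * T2).
    have e : (fun z => dt (tcomp phi) z ^+ j) = dt (tcomp phi) ^+ j.
      by rewrite exprfctE.
    by rewrite e.
  have Tj : (fun z => dt (tcomp phi) z ^+ j) z != 0 by rewrite expf_neq0.
  have := is_deriveM h1 (@is_derive_inv F _ (fun z => dt (tcomp phi) z ^+ j) _ _ _ Tj h3').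
  case=> _ ->; rewrite /GRing.scale /= -/T1 -/T2 -/A -/A1.
  case: j {h3 h3' Tj} => [|j]; first by rewrite /= !expr0; field.
  rewrite [X in j.+1%:R * X]/= !exprS; field.
  by rewrite T0 expf_neq0.
elim: k => [|k IH].
  rewrite [pcoef _ _ _]/= -/(dt (dx _)).
  by rewrite bin_small // mul0r mul0r subr0 addr0 -/T1 -/A1 expr2 mulrA divfK // mul1r.
have -> : pcoef phi k.+2 k.+1 z = (dt (pcoef phi k.+1 k.+1) z + pcoef phi k.+1 k z) / T1 by [].
rewrite [T1 ^+ k.+3]exprSr -mulrA [T1^-1 * _]mulrCA mulVf // mulr1 mulrDl IH D.
rewrite (_ : 'C(k.+2, 2) = (k.+1 + 'C(k.+1, 2))%N); last by rewrite binS bin1 addnC.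
rewrite natrD [k.+2%:R]mulrSr !exprS; field.
by rewrite T0 expf_neq0.
Qed.

Lemma DT_fibre (p : jet) : Om (jet_base p) -> DT phi p = dt (tcomp phi) (jet_base p).
Proof.
move=> Op; have [_] := is_derive_base mv (jet_dir p) oOm (smooth_tcomp oOm sphi) Op.
by have [-> _] := fa Op; rewrite mulr0 addr0 mul1r => h; exact: h.
Qed.

Lemma prolong_fibre k (p : jet) : (k <= r)%N -> Om (jet_base p) ->
  prolong_coord phi k p =
  \sum_(i < r.+1) pcoef phi k i (jet_base p) * p.2 0 i + pshift phi k (jet_base p).
Proof.
elim: k p => [|k IH] p kr Op.
  rewrite big_ord_recl big1 ?addr0 /=; last by move=> i _; rewrite mul0r.
  by rewrite [dx _ _ * p.2 0 ord0]mulrC addrC [p.2 0 ord0 * _]mulrC subrK.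
rewrite [LHS]/= DT_fibre //.
have fE q : Om (jet_base q) -> prolong_coord phi k q =
  \sum_(i < r.+1) pcoef phi k i (jet_base q) * q.2 0 i + pshift phi k (jet_base q).
  by move=> Oq; apply: IH => //; exact: ltnW.
have oO := @open_over F r _ oOm.
have tf f : time_fun Om f -> is_derive p (jet_dir p) (fun q => f (jet_base q)) (dt f (jet_base p)).
  move=> [sf f0]; have := is_derive_base mv (jet_dir p) oOm sf Op.
  by rewrite f0 // mulr0 addr0 mul1r.
rewrite /total_derivative (derive_near (jet_dir p) oO Op fE).
have h (i : 'I_r.+1) := is_deriveM (tf _ (time_fun_pcoef k i)) (is_derive_jet i p (jet_dir p)).
have := is_deriveD (is_derive_sumf (index_enum 'I_r.+1) h) (tf _ (time_fun_pshift k)).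
case=> _ ->.
rewrite mulrDl; congr (_ + _).
rewrite big_distrl /=.
pose G (i : 'I_r.+1) := if (i : nat) is i'.+1 then pcoef phi k i' (jet_base p) else 0.
rewrite (eq_bigr (fun i : 'I_r.+1 => (dt (pcoef phi k i) (jet_base p) * p.2 0 i +
   pcoef phi k i (jet_base p) * (jet_dir p).2 0 i) / dt (tcomp phi) (jet_base p))); last first.
  by move=> i _; rewrite /GRing.scale /= addrC [p.2 0 i * _]mulrC.
rewrite [RHS](eq_bigr (fun i : 'I_r.+1 => (dt (pcoef phi k i) (jet_base p) * p.2 0 i +
   G i * p.2 0 i) / dt (tcomp phi) (jet_base p))); last first.
  by move=> i _; rewrite -mulrDl mulrAC.
rewrite -!big_distrl /=; congr (_ / _); rewrite !big_split /=; congr (_ + _).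
(* The last slot of [jet_dir] and the first value of [G] vanish; what remains are two sums over i <
   r with matching terms. *)
rewrite big_ord_recr /= mxE ltnn mulr0 addr0 [RHS]big_ord_recl /= mul0r add0r.
apply: eq_bigr => i _; rewrite mxE /= ltn_ord; congr (_ * p.2 0 _).
by apply: val_inj; rewrite /= inordK // ltnS.
Qed.

End FibreAffine.
End Prolongation.

(** * Action of a prolongation on the coefficients of an equation *)

Section CoefficientTransform.
Context {F : numFieldType} (mv : mean_value_ineq F) (r : nat) (hr : (2 <= r)%N).
Local Notation jet := (F * 'rV[F]_r.+1)%type.
Local Notation arb := ('rV[F]_(r.-1) * F)%type.
Local Notation joint := (jet * arb)%type.
Implicit Types (phi : F * F -> F * F) (a : 'rV[F]_(r.-1)).

(* the column (a_0, ..., a_(r-2), 0, 1), so that the equation for the row y of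
   derivatives of x reads y *m eq_col a = b *)
Definition eq_col a : 'cV[F]_r.+1 :=
  delta_mx ord_max 0 + \sum_(j < r.-1) a 0 j *: delta_mx (inord j) 0.

Lemma inord_lt (j : 'I_r.-1) : (inord j : 'I_r.+1) = j :> nat.
Proof.
rewrite inordK //; apply: leq_trans (ltn_ord j) _.
by rewrite (leq_trans (leq_pred r)).
Qed.

Lemma eq_colE a i : eq_col a i 0 =
  (i == ord_max)%:R + \sum_(j < r.-1) a 0 j * (i == inord j)%:R.
Proof.
rewrite !mxE summxE andbT; congr (_ + _).
by apply: eq_bigr => j _; rewrite !mxE andbT.
Qed.

Lemma ltr_pred : (r.-1 < r)%N. Proof. by case: r hr. Qed.

Lemma eq_col_last a : eq_col a ord_max 0 = 1.
Proof.
rewrite eq_colE eqxx big1 ?addr0 // => j _.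
rewrite (_ : (_ == _) = false) ?mulr0 //.
apply/eqP => /(congr1 val) /=; rewrite inord_lt => h.
by move: (ltn_trans (ltn_ord j) ltr_pred) h; move: (nat_of_ord j) => n + h; rewrite h ltnn.
Qed.

Lemma eq_col_pred a : eq_col a (inord r.-1) 0 = 0.
Proof.
have e : (inord r.-1 : 'I_r.+1) = r.-1 :> nat by rewrite inordK // ltnS ltnW // ltr_pred.
rewrite eq_colE big1 => [|j _].
  rewrite addr0 (_ : (_ == _) = false) //; apply/eqP => /(congr1 val) /=.
  by rewrite e => h; have := ltr_pred; rewrite {1}h ltnn.
rewrite (_ : (_ == _) = false) ?mulr0 //.
apply/eqP => /(congr1 val) /=; rewrite inord_lt e => h.
by move: (ltn_ord j) h; move: (nat_of_ord j) => n + h; rewrite h ltnn.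
Qed.

Lemma eq_col_lt a (j : 'I_r.-1) : eq_col a (inord j) 0 = a 0 j.
Proof.
rewrite eq_colE (bigD1 j) //= eqxx mulr1 big1 ?addr0 => [|i ij].
  rewrite (_ : (_ == _) = false) ?add0r //.
  apply/eqP => /(congr1 val) /=; rewrite inord_lt => h.
  by move: (ltn_trans (ltn_ord j) ltr_pred) h; move: (nat_of_ord j) => n + h; rewrite h ltnn.
rewrite (_ : (_ == _) = false) ?mulr0 //.
apply/eqP => /(congr1 val) /=; rewrite !inord_lt => h.
by move/eqP: ij; apply; apply: val_inj.
Qed.

(** The two conditions single out the class: leading coefficient 1 and no term in x^(r-1). *)
Lemma eq_col_char (c : 'cV[F]_r.+1) : c ord_max 0 = 1 -> c (inord r.-1) 0 = 0 ->
  c = eq_col (\row_j c (inord j) 0).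
Proof.
move=> c1 c0; apply/matrixP => i k; rewrite (ord1 k) {k}.
have [ir|ir] := eqVneq (i : nat) r.
  by rewrite (_ : i = ord_max) ?eq_col_last //; apply: val_inj.
have [ip|ip] := eqVneq (i : nat) r.-1.
  rewrite (_ : i = inord r.-1) ?eq_col_pred //; apply: val_inj => /=.
  by rewrite ip inordK // ltnS ltnW // ltr_pred.
have il : (i < r.-1)%N.
  have i1 : (i < r)%N by rewrite ltn_neqAle ir -ltnS ltn_ord.
  by rewrite ltn_neqAle ip -ltnS prednK // (leq_trans _ hr).
rewrite (_ : i = inord (Ordinal il)) ?eq_col_lt ?mxE //.
by apply: val_inj; rewrite /= inordK.
Qed.

Lemma eq_col_inj a a' : eq_col a = eq_col a' -> a = a'.
Proof. by move=> h; apply/rowP => j; rewrite -!eq_col_lt h. Qed.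

Lemma satisfiesE (E : @lin_ode F r) (p : jet) :
  satisfies E p <-> (p.2 *m eq_col (coef E p.1)) 0 0 = rhs E p.1.
Proof.
rewrite /satisfies (_ : (p.2 *m _) 0 0 = p.2 0 ord_max +
  \sum_(j < r.-1) coef E p.1 0 j * p.2 0 (inord j)) //.
rewrite mulmxDr mulmx_sumr !mxE summxE; congr (_ + _).
  rewrite (bigD1 ord_max) //= mxE !eqxx mulr1 big1 ?addr0 // => i /negbTE ir.
  by rewrite mxE ir mulr0.
apply: eq_bigr => j _; rewrite -scalemxAr !mxE; congr (_ * _).
rewrite (bigD1 (inord j)) //= mxE !eqxx mulr1 big1 ?addr0 // => i /negbTE ir.
by rewrite mxE ir mulr0.
Qed.

Definition pmx phi z : 'M[F]_r.+1 := \matrix_(i, k) pcoef phi k i z.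
Definition prow phi z : 'rV[F]_r.+1 := \row_k pshift phi k z.
Definition plead phi z : F := pcoef phi r r z.
(** With y~ = y N + n, where N is [pmx] and n is [prow], the equation y~ c' = b' reads y (N c') = b'
    - n c'. It is equivalent to y c = b if N c' is a nonzero multiple of c and the right-hand sides
    match; the last entries fix the factor as N_rr. Hence c' = N_rr N^(-1) c and b' = N_rr b + n
    c'. *)
Definition tmx phi z : 'M[F]_r.+1 := plead phi z *: invmx (pmx phi z).
Definition new_coef phi z a : 'rV[F]_(r.-1) :=
  \row_j (tmx phi z *m eq_col a) (inord j) 0.
Definition new_rhs phi z a (b : F) : F :=
  plead phi z * b + (prow phi z *m (tmx phi z *m eq_col a)) 0 0.
Definition joint_map phi (q : joint) : joint :=
  (prolong phi q.1, (new_coef phi (jet_base q.1) q.2.1,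
                     new_rhs phi (jet_base q.1) q.2.1 q.2.2)).

Section Fibre.
Context (Om : set (F * F)) phi.
Context (pt : point_transformation Om phi) (fa : fibre_affine Om phi).

Let oOm : open Om. Proof. by case: pt. Qed.

Lemma prolong_mx (p : jet) : Om (jet_base p) ->
  (prolong phi p).2 = p.2 *m pmx phi (jet_base p) + prow phi (jet_base p).
Proof.
move=> Op; apply/rowP => k; rewrite /= !mxE (prolong_fibre mv pt fa) -1?ltnS //.
by congr (_ + _); apply: eq_bigr => i _; rewrite !mxE mulrC.
Qed.

Lemma plead_neq0 z : Om z -> plead phi z != 0.
Proof.
move=> Oz; have [T0 X0] := fibre_jacobian pt fa Oz.
by rewrite /plead (pcoef_diag pt) // mulf_neq0 // invr_neq0 // expf_neq0.
Qed.

Lemma pmx_unit z : Om z -> pmx phi z \in unitmx.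
Proof.
move=> Oz; have [T0 X0] := fibre_jacobian pt fa Oz.
rewrite unitmxE unitfE -det_tr det_trig.
  apply/prodf_neq0 => i _; rewrite !mxE (pcoef_diag pt) //.
  by rewrite mulf_neq0 // invr_neq0 // expf_neq0.
by apply/is_trig_mxP => i j ij; rewrite !mxE (pcoef_gt pt).
Qed.

Lemma tmx_eq z a : Om z -> pmx phi z *m (tmx phi z *m eq_col a) = plead phi z *: eq_col a.
Proof.
by move=> Oz; rewrite /tmx -scalemxAl -scalemxAr mulmxA mulmxV ?pmx_unit // mul1mx.
Qed.

Lemma pmx_row_pred z (c : 'cV[F]_r.+1) : Om z ->
  (pmx phi z *m c) (inord r.-1) 0 = pcoef phi r.-1 r.-1 z * c (inord r.-1) 0 +
    pcoef phi r r.-1 z * c ord_max 0.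
Proof.
move=> Oz.
have e : (inord r.-1 : 'I_r.+1) = r.-1 :> nat by rewrite inordK // ltnS ltnW // ltr_pred.
have ne : ord_max != inord r.-1 :> 'I_r.+1.
  by apply/eqP => /(congr1 val) /=; rewrite e => h; have := ltr_pred; rewrite -h ltnn.
rewrite mxE (bigD1 (inord r.-1)) //= (bigD1 ord_max) //= big1 ?addr0.
  by rewrite !mxE e.
move=> i /andP [i1 i2]; rewrite mxE e (pcoef_gt pt) ?mul0r //.
rewrite ltn_neqAle; apply/andP; split.
  by apply/eqP => h; move/eqP: i1; apply; apply: val_inj; rewrite /= e.
have : (i < r)%N.
  rewrite ltn_neqAle -ltnS ltn_ord andbT; apply/eqP => h.
  by move/eqP: i2; apply; apply: val_inj.
by move=> ir; rewrite -ltnS prednK // (leq_trans _ hr).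
Qed.

Lemma pmx_row_last z (c : 'cV[F]_r.+1) : Om z ->
  (pmx phi z *m c) ord_max 0 = plead phi z * c ord_max 0.
Proof.
move=> Oz; rewrite mxE (bigD1 ord_max) //= big1 ?addr0; first by rewrite !mxE.
move=> i ir; rewrite mxE (pcoef_gt pt) ?mul0r //.
rewrite ltn_neqAle -ltnS ltn_ord andbT; apply/eqP => h.
by move/eqP: ir; apply; apply: val_inj.
Qed.

(** By triangularity the last two entries of the transformed column are read off from the last two
    rows of the matrix; N_(r,r-1) = 0 makes the entry at r-1 vanish. *)
Lemma eq_col_tmx z a : Om z -> pcoef phi r r.-1 z = 0 ->
  tmx phi z *m eq_col a = eq_col (new_coef phi z a).
Proof.
move=> Oz N0; have T := tmx_eq a Oz.
have l0 := plead_neq0 Oz; have [T0 X0] := fibre_jacobian pt fa Oz.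
have c1 : (tmx phi z *m eq_col a) ord_max 0 = 1.
  have := pmx_row_last (tmx phi z *m eq_col a) Oz.
  rewrite T mxE eq_col_last mulr1 => h.
  by apply: (mulfI l0); rewrite -h mulr1.
apply: eq_col_char => //.
have := pmx_row_pred (tmx phi z *m eq_col a) Oz.
rewrite T mxE eq_col_pred N0 mulr0 mul0r addr0 => /esym/eqP.
rewrite mulf_eq0 (pcoef_diag pt) // mulf_eq0 invr_eq0 expf_eq0.
by rewrite (negbTE T0) (negbTE X0) andbF /= => /eqP.
Qed.

Lemma prolong_tmx (p : jet) a : Om (jet_base p) ->
  ((prolong phi p).2 *m (tmx phi (jet_base p) *m eq_col a)) 0 0 =
  new_rhs phi (jet_base p) a ((p.2 *m eq_col a) 0 0).
Proof.
move=> Op; rewrite prolong_mx // mulmxDl -mulmxA tmx_eq // -scalemxAr.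
by rewrite [LHS]mxE; congr (_ + _); rewrite mxE.
Qed.

(* y_0 = x has to stay in the domain, so its coefficient is found from small
   variations only. *)
Lemma compare_coef z (d : F) (E E' : @lin_ode F r) : 0 < d ->
  (forall w, `|z.1 - w.1| < d -> `|z.2 - w.2| < d -> Om w) ->
  (forall p : jet, p.1 = z.1 -> `|z.2 - p.2 0 ord0| < d ->
     satisfies E p -> satisfies E' (prolong phi p)) ->
  pmx phi z *m eq_col (coef E' (phi z).1) = plead phi z *: eq_col (coef E z.1).
Proof.
move=> d0 bO H.
set al := eq_col (coef E z.1); set al' := eq_col (coef E' (phi z).1).
set be := pmx phi z *m al'.
have Oz : Om z by apply: bO; rewrite subrr normr0.
have zz1 : `|z.1 - z.1| < d by rewrite subrr normr0.
have K (y : 'rV[F]_r.+1) : `|z.2 - y 0 ord0| < d -> (y *m al) 0 0 = rhs E z.1 ->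
    (y *m be) 0 0 + (prow phi z *m al') 0 0 = rhs E' (phi z).1.
  move=> y0 yb; have Oy : Om (jet_base (z.1, y)) by apply: bO.
  have := H (z.1, y) erefl y0; rewrite !satisfiesE /= => /(_ yb).
  have tf f : time_fun Om f -> f (jet_base (z.1, y)) = f z.
    move=> hf; rewrite /jet_base (time_fun_box mv hf bO) //=.
    by congr f; case: (z).
  rewrite -!/(tcomp phi _) (tf (tcomp phi)); last exact: time_fun_tcomp.
  have := prolong_mx Oy; rewrite /prolong [X in X = _ -> _]/= => ->.
  rewrite (_ : pmx phi (jet_base (z.1, y)) = pmx phi z); last first.
    by apply/matrixP => i k; rewrite !mxE tf //; exact: (time_fun_pcoef mv pt fa).
  rewrite (_ : prow phi (jet_base (z.1, y)) = prow phi z); last first.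
    by apply/rowP => k; rewrite !mxE tf //; exact: (time_fun_pshift mv pt fa).
  by rewrite /= mulmxDl -mulmxA mxE.
have max0 : ord_max != ord0 :> 'I_r.+1.
  by apply/eqP => /(congr1 val) /= h; move: hr; rewrite h.
have dmul (c : 'cV[F]_r.+1) i : (delta_mx 0 i *m c) 0 0 = c i 0.
  rewrite mxE (bigD1 i) //= mxE !eqxx mul1r big1 ?addr0 // => j /negbTE ji.
  by rewrite mxE ji mul0r.
have LD (y y' : 'rV[F]_r.+1) (c : 'cV[F]_r.+1) :
    ((y + y') *m c) 0 0 = (y *m c) 0 0 + (y' *m c) 0 0 by rewrite mulmxDl mxE.
have LB (y y' : 'rV[F]_r.+1) (c : 'cV[F]_r.+1) :
    ((y - y') *m c) 0 0 = (y *m c) 0 0 - (y' *m c) 0 0.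
  by rewrite mulmxBl mxE [X in _ + X]mxE.
have LZ k (y : 'rV[F]_r.+1) (c : 'cV[F]_r.+1) :
    ((k *: y) *m c) 0 0 = k * (y *m c) 0 0 by rewrite -scalemxAl mxE.
(* A point of E over z with zero intermediate derivatives and y_r solved from the equation. *)
pose y0 : 'rV[F]_r.+1 := z.2 *: delta_mx 0 ord0 +
  (rhs E z.1 - z.2 * al ord0 0) *: delta_mx 0 ord_max.
have alr : al ord_max 0 = 1 by exact: eq_col_last.
have y0a : (y0 *m al) 0 0 = rhs E z.1.
  by rewrite LD !LZ !dmul alr mulr1 addrC subrK.
have y00 : y0 0 ord0 = z.2.
  by rewrite !mxE !eqxx [_ == ord_max]eq_sym (negbTE max0) mulr1 mulr0 addr0.
(* Moving from [y0] along e_i - al_i e_r stays on E. The size s = d/2 keeps x in the box when i = 0,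
   and the coefficient is recovered on division by s. *)
have P i : be i 0 = al i 0 * be ord_max 0.
  pose s := d / 2%:R.
  have s0 : s != 0 by rewrite mulf_neq0 ?invr_neq0 ?pnatr_eq0 // gt_eqF.
  have sd : `|s| < d.
    rewrite gtr0_norm ?divr_gt0 // ltr_pdivrMr // ltr_pMr // ltr1n //.
  pose y1 := y0 + s *: (delta_mx 0 i - al i 0 *: delta_mx 0 ord_max).
  have y1E (c : 'cV[F]_r.+1) : (y1 *m c) 0 0 =
      (y0 *m c) 0 0 + s * (c i 0 - al i 0 * c ord_max 0).
    by rewrite LD LZ LB !LZ !dmul.
  have k0 : (y0 *m be) 0 0 + (prow phi z *m al') 0 0 = rhs E' (phi z).1.
    by apply: K; rewrite ?y00 // subrr normr0.
  have k1 : (y1 *m be) 0 0 + (prow phi z *m al') 0 0 = rhs E' (phi z).1.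
    apply: K.
      rewrite mxE y00 !mxE eqxx [ord0 == ord_max]eq_sym (negbTE max0) mulr0 subr0.
      rewrite opprD addrA subrr sub0r normrN /=.
      by case: (_ == _); rewrite ?mulr1 ?mulr0 ?normr0.
    by rewrite y1E y0a alr mulr1 subrr mulr0 addr0.
  have : (y1 *m be) 0 0 = (y0 *m be) 0 0 by apply: (addIr ((prow phi z *m al') 0 0)); rewrite k1 k0.
  rewrite y1E => /eqP.
  by rewrite -subr_eq0 addrC addKr mulf_eq0 (negbTE s0) /= subr_eq0 => /eqP.
apply/colP => i; rewrite P [RHS]mxE mulrC; congr (_ * _).
by rewrite pmx_row_last // eq_col_last mulr1.
Qed.

End Fibre.
End CoefficientTransform.

(** * The inverse function theorem in one variable *)

(** The bound 2 C / 2^n is the tail of the geometric series from n on. *)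
Definition geometric_complete (F : numFieldType) : Prop :=
  forall (u : nat -> F) (C : F), (forall n, `|u n.+1 - u n| <= C / 2%:R ^+ n) ->
  exists l, forall n, `|u n - l| <= 2%:R * C / 2%:R ^+ n.

(** The Archimedean property, in a form that makes sense in the partially ordered complex field. *)
Definition half_pow_small (F : numFieldType) : Prop :=
  forall C e : F, 0 <= C -> 0 < e -> exists n : nat, C / 2%:R ^+ n < e.

Section InverseFunction.
Context {F : numFieldType} (mv : mean_value_ineq F)
  (gc : geometric_complete F) (hp : half_pow_small F).

Lemma small_eq0 (x C : F) : (forall n, `|x| <= C / 2%:R ^+ n) -> x = 0.
Proof.
move=> h; apply/eqP; rewrite -normr_le0; apply: contrapT => /negP hn.
have x0 : x != 0 by apply: contraNneq hn => ->; rewrite normr0.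
have C0 : 0 <= C by have := h 0%N; rewrite expr0 divr1; exact: le_trans.
have xp : 0 < `|x| by rewrite normr_gt0.
have [n hlt] := hp C0 xp.
by have := le_lt_trans (h n) hlt; rewrite ltxx.
Qed.

(** Caratheodory's argument: the difference quotient [ph] of T, completed by D at 0, is continuous,
    and h = k ph(k) for the increment k of S, so that k / h tends to 1 / D. *)
Lemma is_derive_inverse (T S : F -> F) (w D : F) : {for w, continuous S} -> D != 0 ->
  (\forall v \near w, T (S v) = v) -> is_derive (S w) 1 T D ->
  is_derive w 1 S D^-1.
Proof.
move=> cS D0 TS [dT TD].
pose b := S w.
pose ph (k : F) := if k == 0 then D else k^-1 * (T (k + b) - T b).
have cph : {for 0, continuous ph}.
  apply/continuous_withinNx; rewrite {2}/ph eqxx.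
  have : k^-1 *: (T (k *: 1 + b) - T b) @[k --> 0^'] --> D by rewrite -TD; exact: dT.
  apply: cvg_trans; apply: near_eq_cvg; near=> k.
  have k0 : k != 0 by near: k; exact: nbhs_dnbhs_neq.
  by rewrite /ph (negbTE k0) /GRing.scale /= mulr1.
pose kk (h : F) := S (h + w) - S w.
have s0 : (fun h : F => h + w) @ nbhs (0 : F) --> nbhs w.
  have -> : nbhs w = nbhs (0 + w) by rewrite add0r.
  by apply: cvgD; [exact: cvg_id|exact: cvg_cst].
have ckk : kk @ nbhs (0 : F) --> nbhs (kk 0).
  by rewrite {2}/kk add0r; apply: cvgB; [exact: cvg_comp s0 cS|exact: cvg_cst].
have kk0 : kk 0 = 0 by rewrite /kk add0r subrr.
have c2 : (fun h => ph (kk h)) @ nbhs (0 : F) --> nbhs D.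
  have -> : D = ph 0 by rewrite /ph eqxx.
  by rewrite kk0 in ckk; exact: cvg_comp ckk cph.
have lim : ((ph (kk h))^-1 : F) @[h --> 0^'] --> D^-1.
  by apply: cvg_within_filter; exact: cvgV.
have TSw : T b = w by exact: nbhs_singleton TS.
suff H : h^-1 *: (S (h *: 1 + w) - S w) @[h --> 0^'] --> D^-1.
  by apply: DeriveDef; [apply/cvg_ex; exists D^-1 | exact: cvg_lim].
apply: cvg_trans lim; apply: near_eq_cvg; near=> h.
have h0 : h != 0 by near: h; exact: nbhs_dnbhs_neq.
have TSh : T (S (h + w)) = h + w.
  near: h; exact: (@cvg_within _ (nbhs (0 : F)) _ _ _ (s0 _ TS)).
have E : kk h * ph (kk h) = h.
  have Tk : T (kk h + b) = h + w by rewrite /kk subrK.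
  have k0 : kk h != 0.
    apply: contraNneq h0 => k0; move: Tk; rewrite k0 add0r TSw => /eqP.
    by rewrite -subr_eq0 opprD addrCA subrr addr0 oppr_eq0.
  by rewrite /ph (negbTE k0) mulVKf // Tk TSw addrK.
have k0 : kk h != 0 by apply: contraNneq h0 => k0; rewrite -E k0 mul0r.
have p0 : ph (kk h) != 0 by apply: contraNneq h0 => p0; rewrite -E p0 mulr0.
rewrite /GRing.scale /= mulr1 -/(kk h) -[X in X^-1 * kk h]E invfM mulrAC mulVf // mul1r.
Unshelve. all: by end_near.
Qed.

(** Newton iteration with the slope frozen at t0: the fixed points of [g w] are the solutions of T t
    = w, and [g w] contracts a disk. The contraction also bounds the increments of T from below
    ([low]), which gives the continuity of S and S (T t) = t. *)
Lemma inverse_function (I : set F) (T : F -> F) (t0 : F) :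
  open I -> smooth_on I T -> I t0 -> 'D_1 T t0 != 0 ->
  exists (K : set F) (S : F -> F) (d : F),
    [/\ open K, smooth_on K S, (forall w, K w -> I (S w) /\ T (S w) = w), 0 < d
      & forall t, `|t0 - t| < d -> [/\ I t, K (T t) & S (T t) = t]].
Proof.
move=> oI sT It0 c0; set c := 'D_1 T t0 in c0.
have cn : 0 < `|c| by rewrite normr_gt0.
have cdT : {for t0, continuous ('D_1 T)} := smooth_continuous (smoothD_v (1 : F) sT) It0.
(* A deviation of T' by at most |c|/4 makes [g w] contract by 1/4, so the increments of the
   iteration decrease at least like 2^-n, as [geometric_complete] requires. *)
have c4 : 0 < `|c| / 4%:R by rewrite divr_gt0.
move/cvgrPdist_le: cdT => /(_ _ c4) cdT.
have [d0 /= d0p hd0] : exists2 d : F, 0 < d & forall t, `|t0 - t| < d ->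
    I t /\ `|c - 'D_1 T t| <= `|c| / 4%:R.
  have nb : nbhs t0 (I `&` [set t | `|c - 'D_1 T t| <= `|c| / 4%:R]).
    exact: filterI (open_nbhs_nbhs (conj oI It0)) cdT.
  have /nbhs_ballP [d /= dp hd] := nb.
  by exists d => // t ht; apply: hd; rewrite -ball_normE.
pose g (w t : F) := t + (w - T t) / c.
have gl (w s t : F) : `|t0 - s| < d0 -> `|t0 - t| < d0 ->
    `|g w s - g w t| <= 4%:R^-1 * `|s - t|.
  apply: (mv (M := 4%:R^-1)) => x /hd0 [Ix hx].
  exists (1 + (0 - 'D_1 T x) / c); last first.
    rewrite sub0r mulNr (_ : 1 - _ = (c - 'D_1 T x) / c); last by field.
    by rewrite normrM normfV ler_pdivrMr // mulrC.
  have dTx := smooth_is_derive (1 : F) sT Ix.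
  have h1 := is_deriveB (is_derive_cst w x (1 : F)) dTx.
  have h2 := is_deriveD (is_derive_id x (1 : F)) (is_deriveM h1 (is_derive_cst c^-1 x (1 : F))).
  by apply: (is_derive_eq h2); rewrite scaler0 [X in 1 + X = _]add0r /GRing.scale /= mulrC.
have low (s t : F) : `|t0 - s| < d0 -> `|t0 - t| < d0 -> `|s - t| <= 2%:R / `|c| * `|T s - T t|.
  move=> hs ht; have := gl 0 s t hs ht; rewrite /g !sub0r => h.
  have e : s - t = (s + - T s / c - (t + - T t / c)) + (T s - T t) / c by field; exact: c0.
  have : `|s - t| <= 4%:R^-1 * `|s - t| + `|T s - T t| / `|c|.
    rewrite {1}e; apply: le_trans (ler_normD _ _) _.
    by apply: lerD => //; rewrite normrM normfV.
  move=> h2; rewrite mulrAC -mulrA.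
  move: h2; rewrite -lerBlDl => h2.
  have n0 := normr_ge0 (s - t).
  set A := `|s - t| in h2 n0 *; set B := (`|T s - T t| / `|c|) in h2 *.
  rewrite -(ler_pM2l (x := 2%:R^-1)) ?invr_gt0 // mulKf ?pnatr_eq0 //.
  apply: le_trans h2.
  rewrite -{2}[A]mul1r -mulrBl ler_wpM2r //.
  have e3 : 2%:R^-1 + 4%:R^-1 = 3%:R / 4%:R :> F by field.
  by rewrite lerBrDr e3 ler_pdivrMr // mul1r ler_nat.
(* The first increment is then below d0 / 4, and all iterates and their limit stay in the disk of
   radius d0. *)
pose K := [set w | `|T t0 - w| < `|c| * d0 / 4%:R].
have ex (w : F) : K w -> exists l, `|t0 - l| < d0 /\ T l = w.
  move=> Kw; pose u n := iter n (g w) t0.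
  pose eta := `|u 1%N - u 0%N|.
  have etaE : eta = `|T t0 - w| / `|c|.
    by rewrite /eta /u /= /g addrC addKr normrM normfV distrC.
  have eta4 : eta * 4%:R < d0.
    rewrite etaE mulrAC ltr_pdivrMr // [d0 * _]mulrC -ltr_pdivlMr //.
  have eta0 : 0 <= eta by exact: normr_ge0.
  have two n : 2%:R * eta * (1 - (2%:R ^+ n)^-1) < d0.
    apply: le_lt_trans eta4; rewrite mulrC [eta * _]mulrC mulrA ler_wpM2r //.
    apply: (@le_trans _ _ (1 * 2%:R)); last by rewrite mul1r ler_nat.
    by rewrite ler_wpM2r // lerBlDr lerDl invr_ge0 exprn_ge0.
  have P n : `|t0 - u n| <= 2%:R * eta * (1 - (2%:R ^+ n)^-1) /\
     `|u n.+1 - u n| <= eta / 2%:R ^+ n.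
    elim: n => [|n [h1 h2]].
      split; first by rewrite /u /= expr0 invr1 !subrr mulr0 normr0.
      by rewrite expr0 divr1.
    have h3 : `|t0 - u n.+1| <= 2%:R * eta * (1 - (2%:R ^+ n.+1)^-1).
      apply: le_trans (ler_distD (u n) _ _) _; rewrite [`|u n - _|]distrC.
      apply: le_trans (lerD h1 h2) _; rewrite le_eqVlt; apply/orP; left; apply/eqP.
      rewrite exprS; field; exact: expf_neq0.
    split=> //; apply: le_trans (gl w _ _ (le_lt_trans h3 (two _)) (le_lt_trans h1 (two _))) _.
    apply: le_trans (ler_wpM2l _ h2) _; first by rewrite invr_ge0.
    rewrite mulrCA ler_wpM2l // exprS invfM ler_wpM2r ?invr_ge0 ?exprn_ge0 //.
    by rewrite lef_pV2 ?posrE // ler_nat.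
  have [l hl] := gc (fun n => (P n).2).
  have lt0 : `|t0 - l| < d0.
    apply: le_lt_trans eta4; have := hl 0%N; rewrite expr0 divr1 /u /= => h.
    by apply: le_trans h _; rewrite mulrC ler_wpM2l // ler_nat.
  exists l; split => //.
  have /eqP : g w l - l = 0.
    apply: (@small_eq0 _ (2%:R * eta)) => n.
    apply: le_trans (ler_distD (u n.+1) _ _) _.
    rewrite [u n.+1]/(g w (u n)).
    have h1 := gl w l (u n) lt0 (le_lt_trans (P n).1 (two n)).
    apply: le_trans (lerD h1 (hl n.+1)) _; rewrite [`|l - _|]distrC.
    have h2 := hl n; apply: le_trans (lerD (ler_wpM2l _ h2) (lexx _)) _.
      by rewrite invr_ge0.
    have -> : 4%:R^-1 * (2%:R * eta / 2%:R ^+ n) + 2%:R * eta / 2%:R ^+ n.+1 =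
        3%:R / 4%:R * (2%:R * eta / 2%:R ^+ n).
      by rewrite exprS; field; exact: expf_neq0.
    apply: ler_piMl; last by rewrite ler_pdivrMr // mul1r ler_nat.
    by rewrite mulr_ge0 ?mulr_ge0 // invr_ge0 exprn_ge0.
  rewrite /g addrAC subrr add0r mulf_eq0 invr_eq0 (negbTE c0) orbF subr_eq0.
  by move=> /eqP.
pose S (w : F) : F := xget t0 [set l | `|t0 - l| < d0 /\ T l = w].
have SP (w : F) : K w -> `|t0 - S w| < d0 /\ T (S w) = w.
  by move=> /ex [l hl]; apply: (@xgetPex _ t0 [set l | `|t0 - l| < d0 /\ T l = w]); exists l.
have oK : open K by exact: open_disk.
have cS (w : F) : K w -> S @ nbhs w --> nbhs (S w).
  move=> Kw; apply/cvgrPdist_le => e e0.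
  have e'0 : 0 < e / (2%:R / `|c|) by rewrite divr_gt0 // divr_gt0.
  near=> v.
  have Kv : K v by near: v; exact: (open_nbhs_nbhs (conj oK Kw)).
  have Nv : `|w - v| <= e / (2%:R / `|c|).
    near: v; have : (fun v : F => v) @ nbhs w --> nbhs w by exact: cvg_id.
    by move=> /cvgr_dist_le; apply.
  have [h1 h2] := SP w Kw; have [h3 h4] := SP v Kv.
  apply: le_trans (low _ _ h1 h3) _; rewrite h2 h4 mulrC -ler_pdivlMr ?divr_gt0 //.
have D0 (t : F) : `|t0 - t| < d0 -> 'D_1 T t != 0.
  move=> /hd0 [_ h]; apply/eqP => e; move: h; rewrite e subr0.
  rewrite ler_pdivlMr // -[X in _ <= X]mulr1 ler_pM2l // (_ : 1 = 1%:R) // ler_nat //.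
have dS (w : F) : K w -> is_derive w 1 S ('D_1 T (S w))^-1.
  move=> Kw; have [h1 h2] := SP w Kw.
  apply: (@is_derive_inverse T) => //; [exact: cS|exact: D0| |].
    by apply: filterS (open_nbhs_nbhs (conj oK Kw)) => v /SP [].
  by apply: (smooth_is_derive (1 : F) sT); case: (hd0 _ h1).
have sS : smooth_on K S.
  have oD := @open_disk F t0 d0.
  have sI : smooth_on [set t | `|t0 - t| < d0] (fun t => ('D_1 T t)^-1).
    apply: smooth_inv => //.
    by apply: (smooth_subset (A := I)); [move=> t /hd0 []|exact: smoothD_v].
  (* Bootstrap: S' = 1 / T'(S) is of class C^n if S is. *)
  elim=> [|n IH]; first by split.
  apply: (@CkS _ _ _ _ _ _ (fun (v : F) w => v * ('D_1 T (S w))^-1)) => //.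
    move=> v x Kx; have := is_deriveZdir v (dS x Kx).
    by rewrite /GRing.scale /= mulr1.
  move=> v; apply: Ck_mul => //; first exact: Ck_cst.
  by apply: (Ck_comp1 oK _ (sI n) IH) => x /SP [].
have cT : {for t0, continuous T} := smooth_continuous sT It0.
have K0 : 0 < `|c| * d0 / 4%:R by rewrite divr_gt0 // mulr_gt0.
have nb : nbhs t0 (ball t0 d0 `&` [set t | K (T t)]).
  by apply: filterI; [exact: nbhsx_ballx|exact: cvgr_dist_lt cT _ K0].
have /nbhs_ballP [d /= dp hd] := nb.
exists K, S, d; split => //.
  by move=> w /SP [/hd0 [Iw _] e].
move=> t ht; have [h1 h2] : ball t0 d0 t /\ K (T t).
  by apply: hd; rewrite -ball_normE.
have h3 : `|t0 - t| < d0 by move: h1; rewrite -ball_normE.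
split => //; first by case: (hd0 t h3).
have [h4 h5] := SP _ h2; apply/eqP; rewrite -subr_eq0 -normr_le0.
by apply: le_trans (low _ _ h4 h3) _; rewrite h5 subrr normr0 mulr0.
Unshelve. all: by end_near.
Qed.

End InverseFunction.

(** * Equivalence transformations *)

Section SmoothMatrices.
Context {F : numFieldType} {V : normedModType F}.

Lemma smooth_det n (A : set V) (M : V -> 'M[F]_n) : open A ->
  (forall i j, smooth_on A (fun x => M x i j)) -> smooth_on A (fun x => \det (M x)).
Proof.
move=> oA hM; rewrite /determinant; apply: smooth_sum => // s.
by apply: smooth_mul => //; [exact: smooth_cst|exact: smooth_prod].
Qed.

(** By the adjugate formula: cofactors are polynomials in the entries, and the determinant does not
    vanish. *)
Lemma smooth_invmx n (A : set V) (M : V -> 'M[F]_n) i j : open A ->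
  (forall x, A x -> M x \in unitmx) ->
  (forall i j, smooth_on A (fun x => M x i j)) ->
  smooth_on A (fun x => invmx (M x) i j).
Proof.
move=> oA uM hM.
apply: (@smooth_eq _ _ _ _ (fun x => (\det (M x))^-1 *
  ((-1) ^+ (j + i) * \det (row' j (col' i (M x)))))) => //.
  by move=> x /uM ux; rewrite /invmx ux !mxE.
apply: smooth_mul => //.
  apply: smooth_inv => //; last exact: smooth_det.
  by move=> x /uM; rewrite unitmxE unitfE.
apply: smooth_mul => //; first exact: smooth_cst.
apply: smooth_det => // k l; apply: smooth_eq (hM (lift j k) (lift i l)) => // x _.
by rewrite !mxE.
Qed.

End SmoothMatrices.

(** The witness d e / (d + e) lies below both numbers without any comparison between them. *)
Lemma pos_min (F : numFieldType) (d e : F) : 0 < d -> 0 < e ->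
  exists m, [/\ 0 < m, m <= d & m <= e].
Proof.
move=> d0 e0; have de : 0 < d + e by exact: addr_gt0.
exists (d * e / (d + e)); split; first by rewrite divr_gt0 // mulr_gt0.
  by rewrite ler_pdivrMr // ler_pM2l // lerDr ltW.
by rewrite ler_pdivrMr // mulrC ler_pM2l // lerDl ltW.
Qed.

Section FibrePreserving.
Context {F : numFieldType} (mv : mean_value_ineq F)
  (gc : geometric_complete F) (hp : half_pow_small F).
Context (r : nat) (hr : (2 <= r)%N).
Local Notation jet := (F * 'rV[F]_r.+1)%type.
Local Notation arb := ('rV[F]_(r.-1) * F)%type.
Local Notation joint := (jet * arb)%type.

Definition normal_form (Om : set (F * F)) (phi : F * F -> F * F) :=
  fibre_affine Om phi /\ forall z, Om z -> pcoef phi r r.-1 z = 0.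

Context (Om : set (F * F)) (phi : F * F -> F * F).
Context (pt : point_transformation Om phi) (nf : normal_form Om phi).

Let fa : fibre_affine Om phi. Proof. by case: nf. Qed.
Let oOm : open Om. Proof. by case: pt. Qed.
Let sphi : smooth_on Om phi. Proof. by case: pt. Qed.

Definition joint_base (q : joint) : F * F := jet_base q.1.

Lemma joint_base_lin : linear joint_base.
Proof. by move=> k a b; rewrite /joint_base -jet_base_lin. Qed.

Lemma joint_base_cont : continuous joint_base.
Proof.
move=> q; apply: (@continuous_comp _ _ _ (@fst jet arb) (@jet_base F r)).
  exact: cvg_fst.
exact: jet_base_cont.
Qed.

Lemma joint_overE : joint_over Om phi = joint_base @^-1` Om.
Proof.
apply/seteqP; split=> q /=; first by case.
move=> Oq; split=> //; rewrite (DT_fibre mv pt fa) //.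
by have [] := fibre_jacobian pt fa Oq.
Qed.

Let open_joint : open (joint_base @^-1` Om).
Proof. by apply: open_comp => // p _; exact: joint_base_cont. Qed.

Lemma smooth_joint_base (f : F * F -> F) :
  smooth_on Om f -> smooth_on (joint_base @^-1` Om) (fun q => f (joint_base q)).
Proof.
by apply: smooth_prelin => //; [exact: joint_base_lin|exact: joint_base_cont].
Qed.

Lemma smooth_pmx i j : smooth_on Om (fun z => (pmx r phi z : 'M[F]_r.+1) i j).
Proof.
apply: (@smooth_eq _ _ _ _ (pcoef phi j i)) => //; first by move=> x _; rewrite mxE.
by case: (time_fun_pcoef mv pt fa j i).
Qed.

Lemma smooth_tmx i j : smooth_on Om (fun z => (tmx r phi z : 'M[F]_r.+1) i j).
Proof.
apply: (@smooth_eq _ _ _ _ (fun z => plead r phi z * (invmx (pmx r phi z : 'M[F]_r.+1)) i j)) => //.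
  by move=> z Oz; rewrite mxE.
apply: smooth_mul => //; first by case: (time_fun_pcoef mv pt fa r r).
apply: smooth_invmx => //; last exact: smooth_pmx.
by move=> z Oz; exact: (pmx_unit _ pt).
Qed.

Section Target.
Context {V : normedModType F} (A : set V) (b : V -> F * F) (a : V -> 'rV[F]_(r.-1))
  (c : V -> F).
Context (oA : open A) (AO : forall x, A x -> Om (b x))
  (hb : forall f : F * F -> F, smooth_on Om f -> smooth_on A (fun x => f (b x)))
  (ha : smooth_on A a) (hc : smooth_on A c).

Lemma smooth_tmx_eq_col i : smooth_on A (fun x => (tmx r phi (b x) *m eq_col (a x)) i 0).
Proof.
apply: (@smooth_eq _ _ _ _ (fun x => \sum_k tmx r phi (b x) i k * eq_col (a x) k 0)) => //.
  by move=> x _; rewrite mxE.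
apply: smooth_sum => // k; apply: smooth_mul => //.
  by apply: (hb (f := fun z => tmx r phi z i k)); exact: smooth_tmx.
apply: (@smooth_eq _ _ _ _ (fun x => (k == ord_max)%:R +
   \sum_(j < r.-1) a x 0 j * (k == inord j)%:R)) => //.
  by move=> x _; rewrite eq_colE.
apply: smooth_add => //; first exact: smooth_cst.
apply: smooth_sum => // j; apply: smooth_mul => //; last exact: smooth_cst.
exact: smooth_coord.
Qed.

Lemma smooth_new_coef : smooth_on A (fun x => new_coef phi (b x) (a x)).
Proof. by apply: smooth_row => // j; exact: smooth_tmx_eq_col. Qed.

Lemma smooth_new_rhs : smooth_on A (fun x => new_rhs phi (b x) (a x) (c x)).
Proof.
apply: smooth_add => //.
  apply: smooth_mul => //; apply: hb.
  by case: (time_fun_pcoef mv pt fa r r).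
apply: (@smooth_eq _ _ _ _ (fun x => \sum_(k < r.+1) pshift phi k (b x) *
   (tmx r phi (b x) *m eq_col (a x)) k 0)) => //.
  by move=> x _; rewrite [RHS]mxE; apply: eq_bigr => k _; congr (_ * _); rewrite mxE.
apply: smooth_sum => // k; apply: smooth_mul => //; last exact: smooth_tmx_eq_col.
by apply: hb; case: (time_fun_pshift mv pt fa k).
Qed.

End Target.

Lemma smooth_joint_map : smooth_on (@joint_over F r Om phi) (joint_map phi : joint -> joint).
Proof.
rewrite joint_overE; apply: smooth_pair => //; last first.
  have sa : smooth_on (joint_base @^-1` Om) (fun q : joint => q.2.1).
    by apply: smooth_fst => //; apply: smooth_snd => //; exact: smooth_id.
  have sb : smooth_on (joint_base @^-1` Om) (fun q : joint => q.2.2).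
    by apply: smooth_snd => //; apply: smooth_snd => //; exact: smooth_id.
  apply: smooth_pair => //.
    apply: (smooth_new_coef open_joint _ sa) => // f; exact: smooth_joint_base.
  apply: (smooth_new_rhs open_joint _ sa sb) => // f; exact: smooth_joint_base.
apply: smooth_pair => //.
  by apply: (smooth_joint_base (f := tcomp phi)); exact: smooth_tcomp.
apply: smooth_row => // k.
apply: (@smooth_eq _ _ _ _ (fun q : joint => \sum_(i < r.+1)
   pcoef phi k i (joint_base q) * q.1.2 0 i + pshift phi k (joint_base q))) => //.
  by move=> q Oq; rewrite (prolong_fibre mv pt fa) // -ltnS.
apply: smooth_add => //.
  apply: smooth_sum => // i; apply: smooth_mul => //.
    by apply: smooth_joint_base; case: (time_fun_pcoef mv pt fa k i).
  apply: smooth_coord => //; apply: smooth_snd => //; apply: smooth_fst => //.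
  exact: smooth_id.
by apply: smooth_joint_base; case: (time_fun_pshift mv pt fa k).
Qed.

Lemma is_derive_joint (f : F * F -> F) (q v : joint) :
  time_fun Om f -> Om (joint_base q) ->
  is_derive q v (fun q => f (joint_base q)) (v.1.1 * dt f (joint_base q)).
Proof.
move=> [sf f0] Oq; apply: is_derive_prelin; first exact: joint_base_lin.
have := derive_dir mv v.1.1 (v.1.2 0 ord0) oOm (sf 1%N) Oq.
by rewrite -/(dx f _) f0 // mulr0 addr0.
Qed.

(** The differential is block triangular with respect to t, y, a, b, with diagonal blocks T_t, N,
    the linear part of [new_coef] and N_rr. So the components of v vanish one after the other. *)
Lemma joint_map_nonsingular (q v : joint) : joint_over Om phi q ->
  'D_v (joint_map phi : joint -> joint) q = 0 -> v = 0.
Proof.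
move=> Jq D0; have := smooth_is_derive v smooth_joint_map Jq; rewrite D0 => dP.
move: Jq; rewrite joint_overE => Oq; have [T0 X0] := fibre_jacobian pt fa Oq.
have vt : v.1.1 = 0.
  have d1 := is_derive_postlin (@fst_lin _ _ _) (@fst_cont _ _ _)
    (is_derive_postlin (@fst_lin _ _ _) (@fst_cont _ _ _) dP).
  have d2 := is_derive_joint v (time_fun_tcomp pt fa) Oq.
  have /eqP := is_derive_unique d2 d1.
  by rewrite mulf_eq0 (negbTE T0) orbF => /eqP.
have vy : v.1.2 = 0.
  suff H : v.1.2 *m pmx r phi (joint_base q) = 0.
    have := mulmxK (pmx_unit _ pt fa Oq) v.1.2.
    by rewrite H mul0mx => <-.
  apply/rowP => k.
  have d1 := is_derive_postlin (@coord_lin _ _ k) (@coord_cont _ _ k)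
    (is_derive_postlin (@snd_lin _ _ _) (@snd_cont _ _ _)
    (is_derive_postlin (@fst_lin _ _ _) (@fst_cont _ _ _) dP)).
  have fE q' : (joint_base @^-1` Om) q' -> (joint_map phi q').1.2 0 k =
    \sum_(i < r.+1) pcoef phi k i (joint_base q') * q'.1.2 0 i + pshift phi k (joint_base q').
    by move=> Oq'; rewrite /= mxE (prolong_fibre mv pt fa) // -ltnS.
  have d1' := is_derive_near open_joint Oq fE d1.
  have dy (i : 'I_r.+1) : is_derive q v (fun q : joint => q.1.2 0 i) (v.1.2 0 i).
    by apply: (@is_derive_prelin _ _ _ _ (@fst jet arb) (fun p : jet => p.2 0 i)) => //; exact: is_derive_jet.
  have h (i : 'I_r.+1) := is_deriveM (is_derive_joint v (time_fun_pcoef mv pt fa k i) Oq) (dy i).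
  have d2 := is_deriveD (is_derive_sumf (index_enum 'I_r.+1) h)
    (is_derive_joint v (time_fun_pshift mv pt fa k) Oq).
  have := is_derive_unique d2 d1'.
  rewrite vt mul0r addr0 => e0; apply: (etrans _ (etrans e0 _)) => //; rewrite [LHS]mxE.
  apply: eq_bigr => i _.
  by rewrite mul0r scaler0 addr0 !mxE /GRing.scale /= mulrC.
(* Without motion in t and y the line q + h v stays over one base point, where the transformation of
   the arbitrary elements has fixed coefficients. *)
have jb h : joint_base (h *: v + q) = joint_base q.
  rewrite /joint_base /jet_base /= vt vy !scaler0 add0r.
  by congr (_, _); rewrite !mxE add0r.
have va : v.2.1 = 0.
  set a := q.2.1; set z := joint_base q.
  have N0 : pcoef phi r r.-1 z = 0 by case: nf => _; apply.
  (* [new_coef] is affine in a, so its derivative along v is a difference of two values; the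
     invertible matrix then carries equality of the values back to the arguments. *)
  suff H : new_coef phi z (a + v.2.1) = new_coef phi z a.
    have : eq_col (a + v.2.1) = eq_col a.
      have l0 := plead_neq0 r pt fa Oq.
      apply: (scalerI l0); rewrite -!(tmx_eq pt fa _ Oq).
      by rewrite !(eq_col_tmx hr pt fa) // H.
    by move=> /(eq_col_inj hr) /(congr1 (fun x => x - a)); rewrite subrr addrC addKr.
  have eD (h : F) : eq_col (a + h *: v.2.1) = eq_col a + h *: (eq_col (a + v.2.1) - eq_col a).
    apply/colP => i; rewrite !mxE !summxE opprD addrACA subrr add0r -sumrB mulr_sumr -addrA.
    congr (_ + _); rewrite -big_split /=; apply: eq_bigr => j _.
    by rewrite !mxE; ring.
  apply/rowP => j.
  have d1 := is_derive_postlin (@coord_lin _ _ j) (@coord_cont _ _ j)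
    (is_derive_postlin (@fst_lin _ _ _) (@fst_cont _ _ _)
    (is_derive_postlin (@snd_lin _ _ _) (@snd_cont _ _ _) dP)).
  have d2 : is_derive q v (fun q => (joint_map phi q).2.1 0 j)
     (new_coef phi z (a + v.2.1) 0 j - new_coef phi z a 0 j).
    apply/is_derive_line.
    have e h : (joint_map phi (h *: v + q)).2.1 0 j = new_coef phi z a 0 j +
       h * (new_coef phi z (a + v.2.1) 0 j - new_coef phi z a 0 j).
      rewrite -[(joint_map phi _).2.1]/(new_coef phi (joint_base (h *: v + q)) (h *: v.2.1 + q.2.1)).
      have nc a' : new_coef phi z a' 0 j = (tmx r phi z *m eq_col a') (inord j) 0.
        by rewrite mxE.
      rewrite jb -/z -/a [_ + a]addrC !nc eD mulmxDr -scalemxAr mulmxBr.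
      by rewrite [LHS]mxE [X in _ + X = _]mxE [X in _ + _ * X = _]mxE [X in _ + _ * (_ + X) = _]mxE.
    under eq_fun do rewrite e.
    have := is_deriveD (is_derive_cst (new_coef phi z a 0 j) (0 : F) (1 : F))
       (is_deriveM (is_derive_id (0 : F) (1 : F)) (is_derive_cst (new_coef phi z (a + v.2.1) 0 j - new_coef phi z a 0 j) (0 : F) (1 : F))).
    by move=> hh; apply: (is_derive_eq hh); rewrite scaler0 !add0r /GRing.scale /= mulr1.
  apply/eqP; rewrite -subr_eq0; apply/eqP.
  by apply: (etrans (is_derive_unique d2 d1)); rewrite /= mxE.
have vb : v.2.2 = 0.
  set z := joint_base q.
  have d1 := is_derive_postlin (@snd_lin _ _ _) (@snd_cont _ _ _)
    (is_derive_postlin (@snd_lin _ _ _) (@snd_cont _ _ _) dP).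
  have d2 : is_derive q v (fun q => (joint_map phi q).2.2) (plead r phi z * v.2.2).
    apply/is_derive_line.
    have e h : (joint_map phi (h *: v + q)).2.2 = new_rhs phi z q.2.1 q.2.2 +
       h * (plead r phi z * v.2.2).
      rewrite -[(joint_map phi _).2.2]/(new_rhs phi (joint_base (h *: v + q))
        (h *: v.2.1 + q.2.1) (h *: v.2.2 + q.2.2)).
      rewrite jb -/z va scaler0 add0r /new_rhs.
      by rewrite /GRing.scale /=; ring.
    under eq_fun do rewrite e.
    have := is_deriveD (is_derive_cst (new_rhs phi z q.2.1 q.2.2) (0 : F) (1 : F))
       (is_deriveM (is_derive_id (0 : F) (1 : F)) (is_derive_cst (plead r phi z * v.2.2) (0 : F) (1 : F))).
    by move=> hh; apply: (is_derive_eq hh); rewrite scaler0 !add0r /GRing.scale /= mulr1.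
  have /eqP := is_derive_unique d2 d1.
  by rewrite mulf_eq0 (negbTE (plead_neq0 r pt fa Oq)) => /eqP.
case: v vt vy va vb {D0 dP jb} => -[vt vy] [va vb] /= -> -> -> -> //.
Qed.

Lemma equivalence_joint_map : equivalence_transformation Om phi (joint_map phi : joint -> joint).
Proof.
split=> //; [exact: smooth_joint_map|by move=> q Jq v; exact: joint_map_nonsingular|].
move=> E z0 Oz0 Ez0.
have [d d0 hd] : exists2 d : F, 0 < d & forall w, `|z0.1 - w.1| < d -> `|z0.2 - w.2| < d ->
    Om w /\ dom E w.1.
  have oE : open (Om `&` fst @^-1` (dom E)).
    apply: openI => //; apply: open_comp; last exact: dom_open.
    by move=> x _; exact: cvg_fst.
  by have [d d0 hd] := open_box oE (conj Oz0 Ez0); exists d.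
have bO w : `|z0.1 - w.1| < d -> `|z0.2 - w.2| < d -> Om w by move=> h1 h2; case: (hd w h1 h2).
pose I := [set t : F | `|z0.1 - t| < d].
have oI : open I by exact: open_disk.
have x0 : `|z0.2 - z0.2| < d by rewrite subrr normr0.
have IO t : I t -> Om (t, z0.2) by move=> It; exact: bO.
have Iz : I z0.1 by rewrite /I /= subrr normr0.
have z0E : (z0.1, z0.2) = z0 by case: (z0).
pose line (t : F) : F * F := (t, 0) + (0, z0.2).
have lineE t : line t = (t, z0.2) by rewrite /line /GRing.add /= /add_pair /= addr0 add0r.
have sline (f : F * F -> F) : smooth_on Om f -> smooth_on I (fun t => f (t, z0.2)).
  move=> sf; apply: (@smooth_eq _ _ _ _ (fun t => f (line t))) => //.
    by move=> t _; rewrite lineE.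
  apply: (smooth_preaff (A := Om) (l := fun t : F => (t, 0 : F)) oI (@inl_lin _ _ _) (@inl_cont _ _ _) _ sf).
  by move=> t It; rewrite -/(line t) lineE; exact: IO.
pose T t := tcomp phi (t, z0.2).
have sT : smooth_on I T by apply: sline; exact: smooth_tcomp.
have dT : 'D_1 T z0.1 != 0.
  have h := is_derive_dt (smooth_tcomp oOm sphi) (IO _ Iz).
  have [_ ->] := is_derive_fix2 h.
  by rewrite z0E; have [] := fibre_jacobian pt fa Oz0.
have [K [S [e [oK sS KS e0 eP]]]] := inverse_function mv gc hp oI sT Iz dT.
have sb (f : F * F -> F) : smooth_on Om f -> smooth_on K (fun w => f (S w, z0.2)).
  move=> sf; apply: (smooth_comp1 (B := I) oK _ (sline _ sf) sS).
  by move=> w /KS [].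
have KE w : K w -> dom E (S w) by move=> /KS [Iw _]; case: (hd (S w, z0.2) Iw x0).
have KO w : K w -> Om (S w, z0.2) by move=> /KS [Iw _]; exact: IO.
have sca : smooth_on K (fun w => coef E (S w)).
  move=> n; have := coef_smooth E; move=> sc.
  have h j : smooth_on K (fun w => coef E (S w) 0 j).
    apply: (smooth_comp1 (g := fun t => coef E t 0 j) oK KE) => //.
    by apply: smooth_coord => //; exact: dom_open.
  apply: (@smooth_eq _ _ _ _ (fun w => \row_j coef E (S w) 0 j)) => //.
    by move=> w _; apply/rowP => j; rewrite mxE.
  exact: smooth_row.
have scb : smooth_on K (fun w => rhs E (S w)).
  by apply: (smooth_comp1 oK KE) => //; exact: rhs_smooth.
pose E' := @LinODE F r K (fun w => new_coef phi (S w, z0.2) (coef E (S w)))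
  (fun w => new_rhs phi (S w, z0.2) (coef E (S w)) (rhs E (S w))) oK
  (smooth_new_coef oK sb sca) (smooth_new_rhs oK sb sca scb).
have [m [m0 md me]] := pos_min d0 e0.
(* In t the box has to fit both into Om and dom E and into the disk on which S inverts T. *)
pose U := [set t : F | `|z0.1 - t| < m] `*` [set x : F | `|z0.2 - x| < d].
have mm t : `|z0.1 - t| < m -> `|z0.1 - t| < d /\ `|z0.1 - t| < e.
  by move=> h; split; exact: lt_le_trans h _.
have UO : U `<=` Om by move=> w [/mm [h1 _] h2]; exact: bO.
have tf f w : time_fun Om f -> U w -> f (w.1, z0.2) = f w.
  by move=> hf [/mm [h1 _] h2]; rewrite -(time_fun_box mv hf bO).
have TE w : U w -> K (phi w).1 /\ S (phi w).1 = w.1.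
  move=> Uw; have [/mm [_ h1] h2] := Uw; have [_ k1 k2] := eP _ h1.
  by rewrite -/(tcomp phi w) -(tf _ _ (time_fun_tcomp pt fa) Uw).
have pE w : U w -> pmx r phi (w.1, z0.2) = pmx r phi w :> 'M[F]_r.+1.
  by move=> Uw; apply/matrixP => i j; rewrite !mxE tf //; exact: time_fun_pcoef.
have lE w : U w -> plead r phi (w.1, z0.2) = plead r phi w.
  by move=> Uw; rewrite /plead tf //; exact: time_fun_pcoef.
have sE w : U w -> prow r phi (w.1, z0.2) = prow r phi w :> 'rV[F]_r.+1.
  by move=> Uw; apply/rowP => i; rewrite !mxE tf //; exact: time_fun_pshift.
have cE w : U w -> new_coef phi (w.1, z0.2) (coef E w.1) = new_coef phi w (coef E w.1).
  by move=> Uw; rewrite /new_coef /tmx pE // lE.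
have rE w b : U w -> new_rhs phi (w.1, z0.2) (coef E w.1) b = new_rhs phi w (coef E w.1) b.
  by move=> Uw; rewrite /new_rhs /tmx pE // lE // sE.
have oU : open U by apply: open_rect; exact: open_disk.
exists U, E'; split => //; first by split; rewrite /= subrr normr0.
have main (p : jet) : U (jet_base p) ->
  coef E' (phi (jet_base p)).1 = new_coef phi (jet_base p) (coef E p.1) /\
  rhs E' (phi (jet_base p)).1 = new_rhs phi (jet_base p) (coef E p.1) (rhs E p.1).
  by move=> Up; have [k1 k2] := TE _ Up; rewrite /E' /= k2 -(cE _ Up) -(rE _ _ Up).
split; last by move=> p Up _; have [h1 h2] := main _ Up; rewrite /joint_map /arb_of h1 h2.
split.
  by move=> w Uw; have [k1 k2] := TE _ Uw; split=> //; case: Uw => /mm [h1 _] h2; case: (hd w h1 h2).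
move=> p Up _; have [h1 h2] := main _ Up; have Op := UO _ Up.
rewrite !satisfiesE -[(prolong phi p).1]/((phi (jet_base p)).1) h1 h2 -(eq_col_tmx hr pt fa) //; last by case: nf => _; apply.
rewrite (prolong_tmx mv pt fa) // /new_rhs; split=> [->//|/addIr].
exact: (mulfI (plead_neq0 r pt fa Op)).
Qed.

(** Here the target E' is given, so its arbitrary elements must be shown equal to the computed ones.
    For the coefficients this is [compare_coef]; for the right-hand side one point of E over the
    same base suffices. *)
Lemma joint_maps_admissible (E E' : @lin_ode F r) : maps_ode Om phi E E' ->
  joint_maps_ode Om phi (joint_map phi : joint -> joint) E E'.
Proof.
move=> hm; split=> // p Op DT0.
have [d d0 hd] := open_box oOm Op.
have C : pmx r phi (jet_base p) *m eq_col (coef E' (phi (jet_base p)).1) =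
   plead r phi (jet_base p) *: eq_col (coef E p.1).
  apply: (compare_coef mv hr pt fa d0 hd) => q q1 q2.
  have Oq : Om (jet_base q) by apply: hd => //; rewrite /= q1 subrr normr0.
  apply hm => //; rewrite (DT_fibre mv pt fa) //.
  by have [] := fibre_jacobian pt fa Oq.
have N0 : pcoef phi r r.-1 (jet_base p) = 0 by case: nf => _; apply.
have C2 : tmx r phi (jet_base p) *m eq_col (coef E p.1) =
    eq_col (coef E' (phi (jet_base p)).1).
  by rewrite /tmx -scalemxAl scalemxAr -C mulKmx // (pmx_unit _ pt fa).
have C3 : new_coef phi (jet_base p) (coef E p.1) = coef E' (phi (jet_base p)).1.
  by apply: (eq_col_inj hr); rewrite -C2 (eq_col_tmx hr pt fa).
rewrite /joint_map /arb_of /= C3; congr (_, _).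
(* A point of E with the base of p, zero intermediate derivatives and the highest one solved from
   the equation. *)
pose y : 'rV[F]_r.+1 := \row_i (if i == ord0 then p.2 0 ord0 else
   if i == ord_max then rhs E p.1 - eq_col (coef E p.1) ord0 0 * p.2 0 ord0 else 0).
have max0 : ord_max != ord0 :> 'I_r.+1.
  by apply/eqP => /(congr1 val) /= h; move: hr; rewrite h.
have yv i : y 0 i = if i == ord0 then p.2 0 ord0 else
   if i == ord_max then rhs E p.1 - eq_col (coef E p.1) ord0 0 * p.2 0 ord0 else 0.
  by rewrite mxE.
have yb : (y *m eq_col (coef E p.1)) 0 0 = rhs E p.1.
  rewrite mxE (bigD1 ord0) //= (bigD1 ord_max) //= big1 ?addr0.
    by rewrite !yv eqxx (negbTE max0) eqxx eq_col_last // mulr1 mulrC addrC subrK.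
  by move=> i /andP [/negbTE i0 /negbTE i1]; rewrite mxE i0 i1 mul0r.
have y0 : jet_base (p.1, y) = jet_base p by rewrite /jet_base /= mxE.
have Oy : Om (jet_base (p.1, y)) by rewrite y0.
have Dy : DT phi (p.1, y) != 0.
  by rewrite (DT_fibre mv pt fa) //; have [] := fibre_jacobian pt fa Oy.
have [+ _] := hm.2 _ Oy Dy; rewrite !satisfiesE /= => /(_ yb).
rewrite y0 -C2 -{1}y0; have := prolong_tmx mv pt fa (coef E p.1) Oy.
by rewrite /prolong /= y0 => ->; rewrite yb.
Qed.

End FibrePreserving.

(** * Prolongations as polynomials in the jet coordinates *)

Module Jet.

Section JetAlgebra.
Local Opaque dt dx.
Context {F : numFieldType} (mv : mean_value_ineq F) (r : nat) (hr : (2 <= r)%N).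
Local Notation jet := (F * 'rV[F]_r.+1)%type.
Context (Om : set (F * F)) (phi : F * F -> F * F).
Context (pt : point_transformation Om phi).

Let oOm : open Om. Proof. by case: pt. Qed.
Let sphi : smooth_on Om phi. Proof. by case: pt. Qed.
Let sT : smooth_on Om (tcomp phi). Proof. exact: smooth_tcomp. Qed.
Let sX : smooth_on Om (xcomp phi). Proof. exact: smooth_xcomp. Qed.

Definition jcoord (i : nat) (p : jet) : F := p.2 0 (inord i).
Definition at_base (c : F * F -> F) (p : jet) : F := c (jet_base p).
Definition total1 (c : F * F -> F) (p : jet) : F :=
  at_base (dt c) p + jcoord 1 p * at_base (dx c) p.
(* D_t (total1 c) = total2 c + y_2 c_x *)
Definition total2 (c : F * F -> F) (p : jet) : F :=
  at_base (dt (dt c)) p + jcoord 1 p * at_base (dx (dt c)) p +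
  jcoord 1 p * (at_base (dt (dx c)) p + jcoord 1 p * at_base (dx (dx c)) p).
Definition dten (p : jet) : F := total1 (tcomp phi) p.
Definition jet_dom : set jet := [set p | Om (jet_base p) /\ dten p != 0].

Inductive jet_alg (m : nat) : (jet -> F) -> Prop :=
| JetBase c : smooth_on Om c -> jet_alg m (at_base c)
| JetCoord i : (i <= m)%N -> jet_alg m (jcoord i)
| JetInv : (1 <= m)%N -> jet_alg m (fun p => (dten p)^-1)
| JetAdd f g : jet_alg m f -> jet_alg m g -> jet_alg m (fun p => f p + g p)
| JetMul f g : jet_alg m f -> jet_alg m g -> jet_alg m (fun p => f p * g p).

Lemma jet_alg_cst m c : jet_alg m (fun=> c).
Proof. exact: (JetBase m (@smooth_cst _ _ _ Om c)). Qed.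

Lemma jet_alg_exp m f k : jet_alg m f -> jet_alg m (fun p => f p ^+ k).
Proof.
move=> hf; elim: k => [|k IH]; first exact: jet_alg_cst.
by rewrite (_ : (fun p => _) = (fun p => f p * f p ^+ k));
  [exact: JetMul|apply/funext => p; rewrite exprS].
Qed.

Lemma jet_alg_mono m n f : (m <= n)%N -> jet_alg m f -> jet_alg n f.
Proof.
move=> mn; elim=> [c hc|i im|m1|f1 g1 _ h1 _ h2|f1 g1 _ h1 _ h2].
- exact: JetBase.
- by apply: JetCoord; exact: leq_trans mn.
- by apply: JetInv; exact: leq_trans mn.
- exact: JetAdd.
- exact: JetMul.
Qed.

Lemma jet_baseE (p q : jet) : p.1 = q.1 -> jcoord 0 p = jcoord 0 q -> jet_base p = jet_base q.
Proof.
rewrite /jcoord /jet_base => -> h; congr (_, _); move: h.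
by rewrite (_ : inord 0 = ord0) //; apply: val_inj; rewrite /= inordK.
Qed.

Lemma jet_alg_dep m f (p q : jet) : jet_alg m f -> p.1 = q.1 ->
  (forall i, (i <= m)%N -> jcoord i p = jcoord i q) -> f p = f q.
Proof.
move=> hf e1 e2; have eb := jet_baseE e1 (e2 0%N (leq0n _)).
elim: hf => [c hc|i im|m1|f1 g1 _ h1 _ h2|f1 g1 _ h1 _ h2].
- by rewrite /at_base eb.
- exact: e2.
- by rewrite /dten /total1 /at_base eb e2.
- by rewrite h1 h2.
- by rewrite h1 h2.
Qed.

Lemma jet_base1 (p : jet) : (jet_dir p).2 0 ord0 = jcoord 1 p.
Proof. by rewrite mxE /= (leq_trans _ hr). Qed.

Lemma is_derive_at_base c (p : jet) : smooth_on Om c -> Om (jet_base p) ->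
  is_derive p (jet_dir p) (at_base c)
    (at_base (dt c) p + jcoord 1 p * at_base (dx c) p).
Proof.
move=> sc Op; have := is_derive_base mv (jet_dir p) oOm sc Op.
by rewrite jet_base1 mul1r.
Qed.

Lemma is_derive_jcoord i (p : jet) : (i < r)%N ->
  is_derive p (jet_dir p) (jcoord i) (jcoord i.+1 p).
Proof.
move=> ir; have := is_derive_jet (inord i) p (jet_dir p).
by rewrite mxE inordK ?ir // ltnS ltnW.
Qed.

Lemma jet_alg_total1 c : smooth_on Om c -> jet_alg 1 (total1 c).
Proof.
move=> sc; apply: JetAdd; first by apply: JetBase; exact: smooth_dt.
by apply: JetMul; [exact: JetCoord|apply: JetBase; exact: smooth_dx].
Qed.

Lemma jet_alg_total2 c : smooth_on Om c -> jet_alg 1 (total2 c).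
Proof.
move=> sc; have b c' : smooth_on Om c' -> jet_alg 1 (at_base c') by exact: JetBase.
have y1 : jet_alg 1 (jcoord 1) by exact: JetCoord.
have b1 := b _ (smooth_dt (smooth_dt sc)); have b2 := b _ (smooth_dx (smooth_dt sc)).
have b3 := b _ (smooth_dt (smooth_dx sc)); have b4 := b _ (smooth_dx (smooth_dx sc)).
apply: JetAdd; first by apply: JetAdd => //; exact: JetMul.
by apply: JetMul => //; apply: JetAdd => //; exact: JetMul.
Qed.

Lemma is_derive_total1 c (p : jet) : smooth_on Om c -> Om (jet_base p) ->
  is_derive p (jet_dir p) (total1 c) (total2 c p + jcoord 2 p * at_base (dx c) p).
Proof.
move=> sc Op.
have h := is_deriveD (is_derive_at_base (smooth_dt sc) Op)
  (is_deriveM (is_derive_jcoord p (leq_trans (leqnn 2) hr)) (is_derive_at_base (smooth_dx sc) Op)).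
apply: (is_derive_eq h).
have E (a b c' d e y1 y2 : F) : a + y1 * b + (y1 *: (c' + y1 * d : F^o) + e *: (y2 : F^o)) =
   a + y1 * b + y1 * (c' + y1 * d) + y2 * e by rewrite /GRing.scale /=; ring.
exact: E.
Qed.

Lemma is_derive_dinv (p : jet) : jet_dom p ->
  is_derive p (jet_dir p) (fun p => (dten p)^-1)
   (- (dten p)^-1 ^+ 2 * (total2 (tcomp phi) p + jcoord 2 p * at_base (dx (tcomp phi)) p)).
Proof.
move=> [Op p0]; have := is_derive_inv p0 (is_derive_total1 sT Op).
by rewrite exprVn.
Qed.

Lemma jet_alg_derive m f : (m < r)%N -> jet_alg m f ->
  exists2 g, jet_alg m.+1 g & forall p, jet_dom p -> is_derive p (jet_dir p) f (g p).
Proof.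
move=> mr; have mm : (m <= m.+1)%N by [].
have y1 : jet_alg m.+1 (jcoord 1) by exact: JetCoord.
elim=> [c hc|i im|m1|f1 g1 a1 [f' a1' h1] a2 [g' a2' h2]|f1 g1 a1 [f' a1' h1] a2 [g' a2' h2]].
- exists (fun p => at_base (dt c) p + jcoord 1 p * at_base (dx c) p).
    apply: JetAdd; first by apply: JetBase; exact: smooth_dt.
    by apply: JetMul => //; apply: JetBase; exact: smooth_dx.
  by move=> p [Op _]; exact: is_derive_at_base.
- exists (jcoord i.+1); first by apply: JetCoord.
  by move=> p _; apply: is_derive_jcoord; exact: leq_ltn_trans mr.
- exists (fun p => (-1 * (dten p)^-1 ^+ 2) * (total2 (tcomp phi) p + jcoord 2 p * at_base (dx (tcomp phi)) p)).
    apply: JetMul.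
      by apply: JetMul; [exact: jet_alg_cst|apply: jet_alg_exp; exact: JetInv].
    apply: JetAdd; first exact: jet_alg_mono (jet_alg_total2 sT).
    apply: JetMul; first exact: JetCoord.
    by apply: JetBase; exact: smooth_dx.
  by move=> p hp; rewrite mulN1r; exact: is_derive_dinv.
- exists (fun p => f' p + g' p); first exact: JetAdd.
  by move=> p hp; apply: is_deriveDf; [exact: h1|exact: h2].
exists (fun p => f1 p * g' p + g1 p * f' p).
  by apply: JetAdd; apply: JetMul => //; exact: jet_alg_mono mm _.
by move=> p hp; apply: is_deriveMf; [exact: h1|exact: h2].
Qed.

(** Knowing that D_t f has order 2 would not separate the monomials of x~^(3): the dependence on y_2
    is affine, with coefficients of order 1. *)
Lemma jet_alg_derive1 f : jet_alg 1 f ->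
  exists f1 f0, [/\ jet_alg 1 f1, jet_alg 1 f0 &
    forall p, jet_dom p -> is_derive p (jet_dir p) f (f1 p * jcoord 2 p + f0 p)].
Proof.
have y1 : jet_alg 1 (jcoord 1) by exact: JetCoord.
elim=> [c hc|i im|m1|f1 g1 a1 [f' [f0 [b1 b2 h1]]] a2 [g' [g0 [b3 b4 h2]]]
  |f1 g1 a1 [f' [f0 [b1 b2 h1]]] a2 [g' [g0 [b3 b4 h2]]]].
- exists (fun=> 0), (fun p => at_base (dt c) p + jcoord 1 p * at_base (dx c) p); split.
  + exact: jet_alg_cst.
  + apply: JetAdd; first by apply: JetBase; exact: smooth_dt.
    by apply: JetMul => //; apply: JetBase; exact: smooth_dx.
  by move=> p [Op _]; rewrite mul0r add0r; exact: is_derive_at_base.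
- case: i im => [|[|//]] _.
    exists (fun=> 0), (jcoord 1); split; [exact: jet_alg_cst|by []|].
    by move=> p _; rewrite mul0r add0r; apply: is_derive_jcoord; exact: leq_trans hr.
  exists (fun=> 1), (fun=> 0); split; [exact: jet_alg_cst|exact: jet_alg_cst|].
  by move=> p _; rewrite mul1r addr0; apply: is_derive_jcoord; exact: leq_trans hr.
- exists (fun p => (-1 * (dten p)^-1 ^+ 2) * at_base (dx (tcomp phi)) p),
    (fun p => (-1 * (dten p)^-1 ^+ 2) * total2 (tcomp phi) p).
  have w1 : jet_alg 1 (fun p => -1 * (dten p)^-1 ^+ 2).
    by apply: JetMul; [exact: jet_alg_cst|apply: jet_alg_exp; exact: JetInv].
  split.
  + by apply: JetMul => //; apply: JetBase; exact: smooth_dx.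
  + by apply: JetMul => //; exact: (jet_alg_total2 sT).
  move=> p hp; apply: (is_derive_eq (is_derive_dinv hp)).
  have E (a b c d : F) : - a ^+ 2 * (b + c * d) = -1 * a ^+ 2 * d * c + -1 * a ^+ 2 * b by ring.
  exact: E.
- exists (fun p => f' p + g' p), (fun p => f0 p + g0 p); split; try exact: JetAdd.
  move=> p hp; apply: (is_derive_eq (is_deriveDf (h1 p hp) (h2 p hp))).
  by move: (f' p) (f0 p) (g' p) (g0 p) (jcoord 2 p) => *; ring.
exists (fun p => f1 p * g' p + g1 p * f' p), (fun p => f1 p * g0 p + g1 p * f0 p).
split; try by apply: JetAdd; apply: JetMul.
move=> p hp; apply: (is_derive_eq (is_deriveMf (h1 p hp) (h2 p hp))).
by move: (f1 p) (g1 p) (f' p) (f0 p) (g' p) (g0 p) (jcoord 2 p) => *; ring.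
Qed.

Lemma dten_cont (p : jet) : Om (jet_base p) -> {for p, continuous dten}.
Proof.
move=> Op; have c f : smooth_on Om f -> {for p, continuous (at_base f)}.
  move=> sf; apply: continuous_comp; first exact: jet_base_cont.
  exact: smooth_continuous Op.
apply: continuousD; first by apply: c; exact: smooth_dt.
apply: continuousM; last by apply: c; exact: smooth_dx.
apply: (@continuous_comp _ _ _ (@snd F 'rV[F]_r.+1) (fun y : 'rV[F]_r.+1 => y 0 (inord 1))).
  exact: cvg_snd.
exact: coord_continuous.
Qed.

Lemma open_jet_dom : open jet_dom.
Proof.
rewrite openE => p [Op p0].
have n1 := open_nbhs_nbhs (conj (open_over (r := r) oOm) Op).
have n2 : \forall q \near nbhs p, dten q != 0 by exact: (cvgr_neq0 (dten p) (dten_cont Op) p0).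
by apply: filterS (filterI n1 n2) => q [].
Qed.

Lemma DT_dten (p : jet) : Om (jet_base p) -> DT phi p = dten p.
Proof. by move=> Op; case: (is_derive_at_base sT Op). Qed.

Lemma prolongS k f (g : jet -> F) :
  (forall p, jet_dom p -> prolong_coord phi k p = f p) ->
  (forall p, jet_dom p -> is_derive p (jet_dir p) f (g p)) ->
  forall p, jet_dom p -> prolong_coord phi k.+1 p = g p * (dten p)^-1.
Proof.
move=> kf fg p hp; rewrite /= DT_dten; last by case: hp.
congr (_ / _); rewrite /total_derivative -/(jet_dir p).
by rewrite (derive_near _ open_jet_dom hp kf); case: (fg p hp).
Qed.

Lemma prolong_alg k : (k <= r)%N -> exists2 g, jet_alg (maxn k 1) g &
  forall p, jet_dom p -> prolong_coord phi k p = g p.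
Proof.
case: k => [_|k]; first by exists (at_base (xcomp phi)) => //; exact: JetBase.
rewrite maxnE subSS sub0n addn0; elim: k => [_|k IH kr].
  have [g ag hg] := jet_alg_derive (ltnW hr) (JetBase 0 sX).
  exists (fun p => g p * (dten p)^-1); last exact: prolongS hg.
  by apply: JetMul => //; exact: JetInv.
have [g ag hg] := IH (ltnW kr); have [g' ag' hg'] := jet_alg_derive kr ag.
exists (fun p => g' p * (dten p)^-1); last exact: prolongS hg hg'.
by apply: JetMul => //; exact: JetInv.
Qed.

End JetAlgebra.

End Jet.
Import Jet.

(** * The first two prolonged components in closed form *)

Section SecondOrder.
Context {F : numFieldType} (mv : mean_value_ineq F) (r : nat) (hr : (2 <= r)%N).
Local Opaque dt dx.
Local Notation jet := (F * 'rV[F]_r.+1)%type.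
Local Notation jcoord := (@jcoord F r).
Local Notation at_base := (@at_base F r).
Context (Om : set (F * F)) (phi : F * F -> F * F).
Context (pt : point_transformation Om phi).
Local Notation total1 := (@total1 F r).
Local Notation total2 := (@total2 F r).
Local Notation dten := (@dten F r phi).
Local Notation jet_dom := (@jet_dom F r Om phi).
Local Notation jet_alg := (@jet_alg F r Om phi).

Let oOm : open Om. Proof. by case: pt. Qed.
Let sphi : smooth_on Om phi. Proof. by case: pt. Qed.
Let sT : smooth_on Om (tcomp phi). Proof. exact: smooth_tcomp. Qed.
Let sX : smooth_on Om (xcomp phi). Proof. exact: smooth_xcomp. Qed.

Definition jac (z : F * F) : F :=
  dt (tcomp phi) z * dx (xcomp phi) z - dx (tcomp phi) z * dt (xcomp phi) z.

Lemma smooth_jac : smooth_on Om jac.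
Proof.
by apply: smooth_sub => //; apply: smooth_mul => //;
  first [exact: (smooth_dt sT)|exact: (smooth_dx sT)|exact: (smooth_dt sX)|exact: (smooth_dx sX)].
Qed.

Lemma jac_neq0 z : Om z -> jac z != 0.
Proof. by case: pt => _ _; apply. Qed.

Lemma prolong1E p : jet_dom p ->
  prolong_coord phi 1 p = total1 (xcomp phi) p * (dten p)^-1.
Proof.
apply: (prolongS mv hr pt (f := at_base (xcomp phi))) => // q [Oq _].
exact: (is_derive_at_base mv hr pt).
Qed.

Definition second_rest (p : jet) : F :=
  (total2 (xcomp phi) p * dten p - total1 (xcomp phi) p * total2 (tcomp phi) p)
  * (dten p)^-1 ^+ 3.

(** The coefficient of y_2 is X_x D_t T - T_x D_t X up to powers of D_t T; its terms with y_1 cancel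
    and leave the Jacobian. *)
Lemma prolong2E p : jet_dom p -> prolong_coord phi 2 p =
  at_base jac p * (dten p)^-1 ^+ 3 * jcoord 2 p + second_rest p.
Proof.
move=> hp.
have D q : jet_dom q -> is_derive q (jet_dir q) (fun q => total1 (xcomp phi) q * (dten q)^-1)
    (total1 (xcomp phi) q * (- (dten q)^-1 ^+ 2 *
      (total2 (tcomp phi) q + jcoord 2 q * at_base (dx (tcomp phi)) q))
     + (dten q)^-1 * (total2 (xcomp phi) q + jcoord 2 q * at_base (dx (xcomp phi)) q)).
  move=> hq; apply: is_deriveMf; last exact: (is_derive_dinv mv hr pt).
  by apply: (is_derive_total1 mv hr pt) => //; case: hq.
rewrite (prolongS mv hr pt prolong1E D hp).
have [_ w0] := hp; have wE : (at_base (dt (tcomp phi)) p + jcoord 1 p * at_base (dx (tcomp phi)) p) * (dten p)^-1 = 1.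
  exact: mulfV.
rewrite /second_rest.
have E (w Tt Tx Xt Xx y1 y2 t2 x2 : F) : (Tt + y1 * Tx) * w = 1 ->
  ((Xt + y1 * Xx) * (- w ^+ 2 * (t2 + y2 * Tx)) + w * (x2 + y2 * Xx)) * w =
  (Tt * Xx - Tx * Xt) * w ^+ 3 * y2 + (x2 * (Tt + y1 * Tx) - (Xt + y1 * Xx) * t2) * w ^+ 3.
  move=> h; apply/eqP; rewrite -subr_eq0; apply/eqP.
  (* Both sides agree modulo the relation (T_t + y_1 T_x) w = 1; their difference is displayed as a
     multiple of it. *)
  have -> : ((Xt + y1 * Xx) * (- w ^+ 2 * (t2 + y2 * Tx)) + w * (x2 + y2 * Xx)) * w -
    ((Tt * Xx - Tx * Xt) * w ^+ 3 * y2 + (x2 * (Tt + y1 * Tx) - (Xt + y1 * Xx) * t2) * w ^+ 3)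
    = (w ^+ 2 * Xx * y2 + x2 * w ^+ 2) * (1 - (Tt + y1 * Tx) * w) by ring.
  by rewrite h subrr mulr0.
exact: (E _ _ _ _ _ _ _ _ _ wE).
Qed.

Lemma second_rest_alg : jet_alg 1 second_rest.
Proof.
apply: JetMul; last by apply: jet_alg_exp; exact: JetInv.
have a1 := jet_alg_total1 r phi sX; have a2 := jet_alg_total2 r phi sX.
have b1 := jet_alg_total1 r phi sT; have b2 := jet_alg_total2 r phi sT.
rewrite (_ : (fun p => _) = (fun p => total2 (xcomp phi) p * dten p +
  (-1) * (total1 (xcomp phi) p * total2 (tcomp phi) p))); last first.
  by apply/funext => p; rewrite mulN1r.
apply: JetAdd; first exact: JetMul.
by apply: JetMul; [exact: jet_alg_cst|exact: JetMul].
Qed.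

End SecondOrder.

(** * The quadratic monomial that detects T_x *)

Section Straightening.
Context {F : numFieldType} (mv : mean_value_ineq F) (r : nat) (hr : (2 <= r)%N).
Local Opaque dt dx.
Local Notation jet := (F * 'rV[F]_r.+1)%type.
Local Notation jcoord := (@jcoord F r).
Local Notation at_base := (@at_base F r).
Context (Om : set (F * F)) (phi : F * F -> F * F).
Context (pt : point_transformation Om phi).
Local Notation total1 := (@total1 F r).
Local Notation total2 := (@total2 F r).
Local Notation dten := (@dten F r phi).
Local Notation jet_dom := (@jet_dom F r Om phi).
Local Notation jet_alg := (@jet_alg F r Om phi).

Let oOm : open Om. Proof. by case: pt. Qed.
Let sphi : smooth_on Om phi. Proof. by case: pt. Qed.
Let sT : smooth_on Om (tcomp phi). Proof. exact: smooth_tcomp. Qed.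
Let sX : smooth_on Om (xcomp phi). Proof. exact: smooth_xcomp. Qed.

(** For k >= 2 this is the coefficient of y_k in x~^(k). Since D_t D_t T contains T_x y_2, its total
    derivative contains -(k+1) [quad k] y_2, the source of the quadratic monomial. *)
Let lead (k : nat) (p : jet) : F := at_base (jac phi) p * (dten p)^-1 ^+ k.+1.
Let quad (k : nat) (p : jet) : F :=
  at_base (jac phi) p * at_base (dx (tcomp phi)) p * (dten p)^-1 ^+ k.+2.

Let alg_lead k : jet_alg 1 (lead k).
Proof.
apply: JetMul; last by apply: jet_alg_exp; exact: JetInv.
by apply: JetBase; exact: smooth_jac.
Qed.

Let alg_quad k : jet_alg 1 (quad k).
Proof.
apply: JetMul; last by apply: jet_alg_exp; exact: JetInv.
by apply: JetMul; apply: JetBase; [exact: smooth_jac|exact: smooth_dx].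
Qed.

Let lead' (k : nat) (p : jet) : F := total1 (jac phi) p * (dten p)^-1 ^+ k.+1
  + (-1) * (k.+1%:R * (at_base (jac phi) p * ((dten p)^-1 ^+ k.+2 * total2 (tcomp phi) p))).

Let alg_lead' k : jet_alg 1 (lead' k).
Proof.
have sJ := smooth_jac pt.
have w n : jet_alg 1 (fun p => (dten p)^-1 ^+ n) by apply: jet_alg_exp; exact: JetInv.
apply: JetAdd; first by apply: JetMul => //; exact: jet_alg_total1.
apply: JetMul; first exact: jet_alg_cst.
apply: JetMul; first exact: jet_alg_cst.
apply: JetMul; first exact: JetBase.
by apply: JetMul => //; exact: jet_alg_total2.
Qed.

Let derive_lead k p : jet_dom p -> is_derive p (jet_dir p) (lead k)
  (lead' k p - k.+1%:R * quad k p * jcoord 2 p).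
Proof.
move=> hp; have h1 := is_derive_at_base mv hr pt (smooth_jac pt) (proj1 hp).
have h2 := is_deriveX k (is_derive_dinv mv hr pt hp).
have h3 : is_derive p (jet_dir p) (fun p => (dten p)^-1 ^+ k.+1) (- k.+1%:R *
    ((dten p)^-1 ^+ k.+2 * (total2 (tcomp phi) p + jcoord 2 p * at_base (dx (tcomp phi)) p))).
  have e : (fun p : jet => (dten p)^-1 ^+ k.+1) = (fun p : jet => (dten p)^-1) ^+ k.+1.
    by rewrite exprfctE.
  rewrite e; have h := is_deriveX k.+1 (is_derive_dinv mv hr pt hp).
  apply: (is_derive_eq h).
  have E (n w a b c : F) : (n * w ^+ k) *: (- w ^+ 2 * (a + b * c) : F^o) =
     - n * (w ^+ k.+2 * (a + b * c)).
    by rewrite /GRing.scale /= !exprS; ring.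
  exact: E.
apply: (is_derive_eq (is_deriveMf h1 h3)).
rewrite /lead' /quad.
have E (n j j1 w1 w2 a b c : F) : j * (- n * (w2 * (a + b * c))) + w1 * j1 =
   j1 * w1 + -1 * (n * (j * (w2 * a))) - n * (j * c * w2) * b by ring.
exact: E.
Qed.

(* The monomial y_2 y_(k-1) survives in x~^(k) unless T_x = 0. *)
Lemma prolong_quad k : (3 <= k <= r)%N -> exists (c : nat) (be R : jet -> F),
  [/\ (0 < c)%N, jet_alg 1 be, jet_alg (k - 2) R &
  forall p, jet_dom p -> prolong_coord phi k p = lead k p * jcoord k p
    - c%:R * quad k p * jcoord 2 p * jcoord k.-1 p + be p * jcoord k.-1 p + R p].
Proof.
case/andP; elim: k => // k IH; rewrite leq_eqVlt => /orP [/eqP <-|] kr.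
  have [K1 [K0 [a1 a0 hK]]] := jet_alg_derive1 mv hr pt (second_rest_alg r pt).
  have r2 : (2 < r)%N by [].
  have D p : jet_dom p -> is_derive p (jet_dir p)
      (fun p => lead 2 p * jcoord 2 p + second_rest phi p)
      (lead 2 p * jcoord 3 p + jcoord 2 p * (lead' 2 p - 3%:R * quad 2 p * jcoord 2 p)
       + (K1 p * jcoord 2 p + K0 p)).
    move=> hp; apply: is_deriveDf; last exact: hK.
    by apply: is_deriveMf; [exact: derive_lead|exact: is_derive_jcoord].
  exists 3%N, (fun p => (lead' 2 p + K1 p) * (dten p)^-1), (fun p => K0 p * (dten p)^-1).
  have aw : jet_alg 1 (fun p => (dten p)^-1) by exact: JetInv.
  split => //.
  - by apply: JetMul => //; apply: JetAdd.
  - exact: JetMul.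
  move=> p hp; rewrite (prolongS mv hr pt (prolong2E mv hr pt) D hp).
  rewrite /lead /quad /= -!/(lead' 2 p).
  have E (j tx w y2 y3 l k1 k0 : F) : (j * w ^+ 3 * y3 + y2 * (l - 3%:R * (j * tx * w ^+ 4) * y2)
     + (k1 * y2 + k0)) * w = j * w ^+ 4 * y3 - 3%:R * (j * tx * w ^+ 5) * y2 * y2 +
     (l + k1) * w * y2 + k0 * w by ring.
  exact: E.
move=> kr1; have [c [be [R [c0 abe aR hk]]]] := IH kr (ltnW kr1).
have aw : jet_alg 1 (fun p => (dten p)^-1) by exact: JetInv.
have k2 : (k - 2 < r)%N by apply: leq_ltn_trans kr1; rewrite leq_subr.
have r1 : (1 < r)%N by exact: hr.
have [gq agq hgq] := jet_alg_derive mv hr pt r1 (alg_quad k).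
have [gb agb hgb] := jet_alg_derive mv hr pt r1 abe.
have [gR agR hgR] := jet_alg_derive mv hr pt k2 aR.
have k3 : (3 <= k)%N := kr.
have kk : ((k - 2).+1 = k.-1)%N by lia.
have pk : (k.-1 < k)%N by lia.
have k0 : (0 < k)%N by lia.
have k2' : (2 <= k.-1)%N by lia.
have D p : jet_dom p -> is_derive p (jet_dir p)
   (fun p => lead k p * jcoord k p + (-1) * (c%:R * (quad k p * (jcoord 2 p * jcoord k.-1 p)))
      + be p * jcoord k.-1 p + R p)
   (lead k p * jcoord k.+1 p + jcoord k p * (lead' k p - k.+1%:R * quad k p * jcoord 2 p)
    + ((-1) * (c%:R * (quad k p * (jcoord 2 p * jcoord k p + jcoord k.-1 p * jcoord 3 p)
         + jcoord 2 p * jcoord k.-1 p * gq p)))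
    + (be p * jcoord k p + jcoord k.-1 p * gb p) + gR p).
  move=> hp; have kp : (k.-1 < r)%N by exact: ltn_trans pk kr1.
  have dy : is_derive p (jet_dir p) (jcoord k.-1) (jcoord k p).
    by have := is_derive_jcoord p kp; rewrite prednK.
  apply: is_deriveDf; last exact: hgR.
  apply: is_deriveDf; last by apply: is_deriveMf => //; exact: hgb.
  apply: is_deriveDf.
    by apply: is_deriveMf; [exact: derive_lead|exact: is_derive_jcoord].
  have dy2 : is_derive p (jet_dir p) (jcoord 2) (jcoord 3 p).
    by apply: is_derive_jcoord; lia.
  have hq := is_deriveMf (hgq p hp) (is_deriveMf dy2 dy).
  have h := is_deriveMf (is_derive_cst (-1 : F) p (jet_dir p))
    (is_deriveMf (is_derive_cst (c%:R : F) p (jet_dir p)) hq).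
  by apply: (is_derive_eq h); rewrite !mulr0 !addr0.
have hk' p : jet_dom p -> prolong_coord phi k p = lead k p * jcoord k p +
   (-1) * (c%:R * (quad k p * (jcoord 2 p * jcoord k.-1 p))) + be p * jcoord k.-1 p + R p.
  by move=> hp; rewrite hk // mulN1r !mulrA.
have algw m f : (1 <= m)%N -> jet_alg m f -> jet_alg m (fun p => f p * (dten p)^-1).
  by move=> m1 af; apply: JetMul => //; exact: jet_alg_mono aw.
have abe' : jet_alg 1 (fun p => (lead' k p + be p) * (dten p)^-1).
  by apply: algw => //; exact: JetAdd.
have k1 : (1 <= k.-1)%N by rewrite -kk.
(* The boolean records whether y_(k-1) y_3 goes into the remainder, whose order must not exceed k-1.
   For k = 3 it does not, as y_3 = y_k: it then joins the main monomial. *)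
have aRest (b : bool) : (b -> (3 <= k.-1)%N) -> jet_alg (k.+1 - 2) (fun p => ((-1) * (c%:R * (b%:R * (quad k p * (jcoord k.-1 p * jcoord 3 p))
         + jcoord 2 p * jcoord k.-1 p * gq p)) + jcoord k.-1 p * gb p + gR p) * (dten p)^-1).
  move=> hb; have -> : (k.+1 - 2 = k.-1)%N by rewrite subSS subn1.
  have yk : jet_alg k.-1 (jcoord k.-1) by exact: JetCoord.
  apply: algw => //; rewrite kk in agR.
  apply: JetAdd => //; apply: JetAdd; last first.
    by apply: JetMul => //; exact: jet_alg_mono agb.
  apply: JetMul; first exact: jet_alg_cst.
  apply: JetMul; first exact: jet_alg_cst.
  apply: JetAdd.
    case: b hb => hb.
      apply: JetMul; first exact: jet_alg_cst.
      apply: JetMul; first exact: jet_alg_mono (alg_quad k).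
      by apply: JetMul => //; apply: JetCoord; exact: hb.
    rewrite (_ : (fun p => _) = (fun=> 0)); first exact: jet_alg_cst.
    by apply/funext => p; rewrite mul0r.
  apply: JetMul; last exact: jet_alg_mono agq.
  by apply: JetMul => //; exact: JetCoord.
(* For k = 3 the monomial is y_2^2, and differentiating it counts twice, hence c + c + (k+1). All
   contributions have the same sign, so c remains a positive natural number and is nonzero in F. *)
have [k3'|k3'] := eqVneq k 3%N.
  exists (c + c + k.+1)%N, (fun p => (lead' k p + be p) * (dten p)^-1),
    (fun p => ((-1) * (c%:R * (false%:R * (quad k p * (jcoord k.-1 p * jcoord 3 p))
         + jcoord 2 p * jcoord k.-1 p * gq p)) + jcoord k.-1 p * gb p + gR p) * (dten p)^-1).
  split; [by rewrite addnS|exact: abe'|by apply: (aRest false)|].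
  move=> p hp; rewrite (prolongS mv hr pt hk' D hp) /=.
  rewrite !natrD [quad k.+1 p]/quad [lead k.+1 p]/lead [quad k p]/quad [lead k p]/lead.
  rewrite !(exprS _ k.+2) !(exprS _ k.+1).
  have e3 : jcoord 3 p = jcoord k p by rewrite k3'.
  rewrite e3 mul0r add0r; have e2 : jcoord k.-1 p = jcoord 2 p by rewrite k3'.
  rewrite e2.
  have E (j tx u w c' n y2 y3 yk l b gq' gb' gR' : F) :
    (j * u * y3 + yk * (l - n * (j * tx * (w * u)) * y2) +
    -1 * (c' * (j * tx * (w * u) * (y2 * yk + y2 * yk) + y2 * y2 * gq')) +
    (b * yk + y2 * gb') + gR') * w =
    j * (w * u) * y3 - (c' + c' + n) * (j * tx * (w * (w * u))) * y2 * yk + (l + b) * w * yk +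
    (-1 * (c' * (y2 * y2 * gq')) + y2 * gb' + gR') * w by ring.
  exact: E.
have hb : (3 <= k.-1)%N.
  by lia.
exists (c + k.+1)%N, (fun p => (lead' k p + be p) * (dten p)^-1),
    (fun p => ((-1) * (c%:R * (true%:R * (quad k p * (jcoord k.-1 p * jcoord 3 p))
         + jcoord 2 p * jcoord k.-1 p * gq p)) + jcoord k.-1 p * gb p + gR p) * (dten p)^-1).
split; [by rewrite addnS|exact: abe'|exact: (aRest true (fun _ => hb))|].
move=> p hp; rewrite (prolongS mv hr pt hk' D hp) /=.
rewrite !natrD [quad k.+1 p]/quad [lead k.+1 p]/lead [quad k p]/quad [lead k p]/lead.
rewrite !(exprS _ k.+2) !(exprS _ k.+1).
rewrite mul1r.
have E (j tx u w c' n y2 y3 yl yp yk l b gq' gb' gR' : F) :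
    (j * u * yl + yk * (l - n * (j * tx * (w * u)) * y2) +
    -1 * (c' * (j * tx * (w * u) * (y2 * yk + yp * y3) + y2 * yp * gq')) +
    (b * yk + yp * gb') + gR') * w =
    j * (w * u) * yl - (c' + n) * (j * tx * (w * (w * u))) * y2 * yk + (l + b) * w * yk +
    (-1 * (c' * (j * tx * (w * u) * (yp * y3) + y2 * yp * gq')) + yp * gb' + gR') * w by ring.
exact: E.
Qed.

End Straightening.

(** * Admissible transformations of order at least 3 satisfy T_x = 0 *)

Section FibrePreservation.
Context {F : numFieldType} (mv : mean_value_ineq F) (r : nat) (hr : (2 <= r)%N).
Local Opaque dt dx.
Local Notation jet := (F * 'rV[F]_r.+1)%type.
Local Notation jcoord := (@jcoord F r).
Local Notation at_base := (@at_base F r).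
Context (Om : set (F * F)) (phi : F * F -> F * F).
Context (pt : point_transformation Om phi).
Local Notation dten := (@dten F r phi).
Local Notation jet_dom := (@jet_dom F r Om phi).
Local Notation jet_alg := (@jet_alg F r Om phi).

Let oOm : open Om. Proof. by case: pt. Qed.
Let sphi : smooth_on Om phi. Proof. by case: pt. Qed.
Let sT : smooth_on Om (tcomp phi). Proof. exact: smooth_tcomp. Qed.
Let sX : smooth_on Om (xcomp phi). Proof. exact: smooth_xcomp. Qed.

Definition mkjet (t : F) (f : nat -> F) : jet := (t, \row_(i < r.+1) f i).

Lemma mkjetE t f i : (i <= r)%N -> jcoord i (mkjet t f) = f i.
Proof. by move=> ir; rewrite /Jet.jcoord mxE inordK. Qed.

Lemma jet_base_mkjet t f : jet_base (mkjet t f) = (t, f 0%N).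
Proof. by rewrite /jet_base mxE. Qed.

Lemma satisfies_jcoord (E : @lin_ode F r) (p : jet) : satisfies E p <->
  jcoord r p + \sum_(j < r.-1) coef E p.1 0 j * jcoord j p = rhs E p.1.
Proof.
rewrite /satisfies (_ : p.2 0 ord_max = jcoord r p) //.
by congr (p.2 0 _); apply: val_inj; rewrite /= inordK.
Qed.

Lemma satisfies_prolong (E : @lin_ode F r) (p : jet) : satisfies E (prolong phi p) <->
  prolong_coord phi r p +
    \sum_(j < r.-1) coef E (phi (jet_base p)).1 0 j * prolong_coord phi j p =
  rhs E (phi (jet_base p)).1.
Proof.
rewrite /satisfies /= mxE (eq_bigr (fun j : 'I_r.-1 =>
  coef E (phi (jet_base p)).1 0 j * prolong_coord phi j p)) // => j _.
by rewrite mxE inord_lt.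
Qed.

(** Both points satisfy E, which does not contain y_(r-1), so both images satisfy E'. For j <= r-2
    the order of x~^(j) is at most max(j, 1) <= r-2, so all lower terms of E' agree; this is where r
    >= 3 enters. *)
Lemma prolong_pred_indep (E E' : @lin_ode F r) (p q : jet) : (3 <= r)%N ->
  maps_ode Om phi E E' -> jet_dom p -> p.1 = q.1 ->
  (forall i, (i <= r - 2)%N -> jcoord i p = jcoord i q) ->
  jcoord r p = jcoord r q -> satisfies E p ->
  prolong_coord phi r p = prolong_coord phi r q.
Proof.
move=> r3 hm hp e1 e2 e3 sp.
have r21 : (1 <= r - 2)%N by lia.
have eb : jet_base p = jet_base q by apply: jet_baseE => //; exact: e2.
have ed : dten p = dten q.
  by apply: (@jet_alg_dep _ r Om phi 1) => //;
    [exact: jet_alg_total1|move=> i i1; apply: e2; exact: leq_trans r21].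
have hq : jet_dom q by case: hp => h1 h2; split; rewrite -?eb -?ed.
have sq : satisfies E q.
  move: sp; rewrite !satisfies_jcoord -e1 -e3 => <-; congr (_ + _).
  by apply: eq_bigr => j _; rewrite e2 //; have := ltn_ord j; lia.
have Ep : satisfies E' (prolong phi p).
  by apply/(hm.2 p hp.1) => //; rewrite (DT_dten mv hr pt) ?hp.2 //; case: hp.
have Eq : satisfies E' (prolong phi q).
  by apply/(hm.2 q hq.1) => //; rewrite (DT_dten mv hr pt) ?hq.2 //; case: hq.
move: Ep Eq; rewrite !satisfies_prolong -eb => <-.
rewrite (eq_bigr (fun j : 'I_r.-1 => coef E' (phi (jet_base p)).1 0 j * prolong_coord phi j p)).
  by move/addIr.
move=> j _; congr (_ * _).
have jr : (j <= r)%N by have := ltn_ord j; lia.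
have [g ag hg] := prolong_alg mv hr pt jr.
rewrite !hg //; symmetry; apply: jet_alg_dep ag _ _ => // i im; apply: e2.
by have := ltn_ord j; move: im; rewrite maxnE; lia.
Qed.

(** The value c of y_r is determined by t and y_0, ..., y_(r-2) alone, so y_(r-1) can still be
    varied afterwards. *)
Lemma exists_jet (E : @lin_ode F r) (t : F) (f : nat -> F) : exists c : F,
  forall g : nat -> F, (forall i, (i < r.-1)%N -> g i = f i) -> g r = c ->
    satisfies E (mkjet t g).
Proof.
exists (rhs E t - \sum_(j < r.-1) coef E t 0 j * f j) => g gf gr.
apply/satisfies_jcoord; rewrite mkjetE // gr.
rewrite [X in _ + X](eq_bigr (fun j : 'I_r.-1 => coef E t 0 j * f j)) ?subrK // => j _.
by rewrite mkjetE ?gf //; have := ltn_ord j; lia.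
Qed.

Lemma dten_slope (z : F * F) : Om z -> exists y1 : F,
  dt (tcomp phi) z + y1 * dx (tcomp phi) z != 0.
Proof.
move=> Oz; have [T0|T0] := eqVneq (dt (tcomp phi) z) 0.
  exists 1; rewrite T0 add0r mul1r; have := jac_neq0 pt Oz.
  by rewrite /jac T0 mul0r sub0r oppr_eq0 mulf_eq0 negb_or => /andP [].
by exists 0; rewrite mul0r addr0.
Qed.

Lemma dtenE (p : jet) z : jet_base p = z ->
  dten p = dt (tcomp phi) z + jcoord 1 p * dx (tcomp phi) z.
Proof. by move=> <-. Qed.

(** With y_(r-1) = s varying on E, the component x~^(r) is constant. Its part in s is -c Q y_2 s +
    be s with Q = J T_x (D_t T)^(-r-2); varying y_2, or s itself if r = 3, isolates Q. *)
Lemma maps_dx_tcomp (E E' : @lin_ode F r) : (3 <= r)%N -> maps_ode Om phi E E' ->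
  forall z, Om z -> dx (tcomp phi) z = 0.
Proof.
move=> r3 hm z Oz; have [y1 hy1] := dten_slope Oz.
pose f0 (u : F) (i : nat) : F := if i == 0%N then z.2 else if i == 1%N then y1 else
  if i == 2%N then u else 0.
(* The slot r-1 is tested before [f0], so for r = 3 the coordinate y_2 = y_(r-1) takes the value
   s. *)
pose f u (s c : F) i := if i == r then c else if i == r.-1 then s else f0 u i.
have fdom u s c : jet_dom (mkjet z.1 (f u s c)).
  have b : jet_base (mkjet z.1 (f u s c)) = z.
    rewrite jet_base_mkjet /f (_ : (0%N == r) = false); last by apply/eqP; lia.
    by rewrite (_ : (0%N == r.-1) = false); [rewrite /f0 /= -surjective_pairing|apply/eqP; lia].
  split; first by rewrite b.
  rewrite (dtenE b) mkjetE; last by lia.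
  rewrite /f (_ : (1%N == r) = false); last by apply/eqP; lia.
  by rewrite (_ : (1%N == r.-1) = false) //; apply/eqP; lia.
have rr : (3 <= r <= r)%N by rewrite r3 leqnn.
have [c [be [R [c0 abe aR hk]]]] := prolong_quad mv hr pt rr.
have key u s s' : exists d,
    prolong_coord phi r (mkjet z.1 (f u s d)) = prolong_coord phi r (mkjet z.1 (f u s' d)).
  have [d hd] := exists_jet E z.1 (f0 u); exists d.
  have jc s0 i : (i <= r - 2)%N -> jcoord i (mkjet z.1 (f u s0 d)) = f0 u i.
    move=> ir; rewrite mkjetE; last by lia.
    rewrite /f (_ : (i == r) = false); last by apply/eqP; lia.
    by rewrite (_ : (i == r.-1) = false) //; apply/eqP; lia.
  apply: (prolong_pred_indep r3 hm) => //.
  - by move=> i ir; rewrite !jc.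
  - by rewrite !mkjetE // /f eqxx.
  apply: hd; last by rewrite /f eqxx.
  move=> i ir; rewrite /f (_ : (i == r) = false); last by apply/eqP; lia.
  by rewrite (_ : (i == r.-1) = false) //; apply/eqP; lia.
pose q0 := mkjet z.1 (f 0 0 0).
pose w := (dten q0)^-1.
have q0b : jet_base q0 = z.
  rewrite jet_base_mkjet /f (_ : (0%N == r) = false); last by apply/eqP; lia.
  by rewrite (_ : (0%N == r.-1) = false); [rewrite /f0 /= -surjective_pairing|apply/eqP; lia].
pose Q := jac phi z * dx (tcomp phi) z * w ^+ r.+2.
have w0 : w != 0 by rewrite invr_neq0 //; case: (fdom 0 0 0).
have cF : c%:R != 0 :> F by rewrite pnatr_eq0 -lt0n.
suff Q0 : c%:R * Q = 0.
  move/eqP: Q0; rewrite mulf_eq0 (negbTE cF) /= mulf_eq0 expf_eq0 (negbTE w0) andbF orbF.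
  by rewrite mulf_eq0 (negbTE (jac_neq0 pt Oz)) => /eqP.
have low1 g u s d : jet_alg 1 g -> g (mkjet z.1 (f u s d)) = g q0.
  move=> ag; apply: (jet_alg_dep ag) => // i im; rewrite !mkjetE; try lia.
  rewrite /f (_ : (i == r) = false); last by apply/eqP; lia.
  rewrite (_ : (i == r.-1) = false); last by apply/eqP; lia.
  by rewrite /f0; case: eqP => // i0; case: eqP => // i1; exfalso; lia.
have Rs u s s' d : R (mkjet z.1 (f u s d)) = R (mkjet z.1 (f u s' d)).
  apply: (jet_alg_dep aR) => // i im; rewrite !mkjetE; try lia.
  by rewrite /f; case: eqP => // _; case: eqP => // i1; exfalso; lia.
have E1 u s d : prolong_coord phi r (mkjet z.1 (f u s d)) =
   jac phi z * w ^+ r.+1 * d - c%:R * Q * (if r == 3%N then s else u) * s +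
    be q0 * s + R (mkjet z.1 (f u s d)).
  rewrite hk //.
  have b : jet_base (mkjet z.1 (f u s d)) = z.
    rewrite jet_base_mkjet /f (_ : (0%N == r) = false); last by apply/eqP; lia.
    by rewrite (_ : (0%N == r.-1) = false); [rewrite /f0 /= -surjective_pairing|apply/eqP; lia].
  rewrite /Jet.at_base b (low1 be) //.
  rewrite (low1 (fun p => (dten p)^-1)); last exact: JetInv.
  rewrite !mkjetE //; try lia.
  have -> : f u s d r = d by rewrite /f eqxx.
  have -> : f u s d r.-1 = s.
    by rewrite /f eqxx (_ : (r.-1 == r) = false) //; apply/eqP; lia.
  have -> // : f u s d 2 = if r == 3%N then s else u.
  rewrite /f (_ : (2%N == r) = false); last by apply/eqP; lia.
  by case: (eqVneq r 3%N) => [-> //|r3']; rewrite (_ : (2%N == r.-1) = false) //; apply/eqP; lia.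
have E2 u s : - c%:R * Q * (if r == 3%N then s else u) * s + be q0 * s = 0.
  have [d] := key u s 0; rewrite !E1 (Rs u 0 s) => /addIr.
  rewrite !mulr0 subr0 addr0 -addrA -[RHS]addr0 => /addrI <-.
  by rewrite !mulNr.
(* For r = 3 the relation is quadratic in s and tested at s = 1 and -1; otherwise it is tested at
   y_2 = 0 and 1. *)
case: (eqVneq r 3%N) E2 => r3' E2.
  have h1 := E2 0 1; have h2 := E2 0 (-1).
  have : 2%:R * (c%:R * Q) = 0.
    apply/eqP; rewrite -oppr_eq0 -[X in _ == X](addr0 0) -{1}h1 -h2; apply/eqP; ring.
  by move/eqP; rewrite mulf_eq0 pnatr_eq0 /= => /eqP.
have h1 := E2 0 1; have h2 := E2 1 1.
apply/eqP; rewrite -oppr_eq0 -[X in _ == X](subr0 0) -{1}h2 -h1; apply/eqP; ring.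
Qed.

End FibrePreservation.

(** * The condition X_xx = 0 *)

Section FibreAffinity.
Context {F : numFieldType} (mv : mean_value_ineq F) (r : nat) (hr : (2 <= r)%N).
Local Opaque dt dx.
Local Notation jet := (F * 'rV[F]_r.+1)%type.
Local Notation jcoord := (@jcoord F r).
Local Notation at_base := (@at_base F r).
Context (Om : set (F * F)) (phi : F * F -> F * F).
Context (pt : point_transformation Om phi).
Local Notation dten := (@dten F r phi).
Local Notation jet_dom := (@jet_dom F r Om phi).
Local Notation jet_alg := (@jet_alg F r Om phi).
Context (Tx0 : forall z, Om z -> dx (tcomp phi) z = 0).

Let oOm : open Om. Proof. by case: pt. Qed.
Let sphi : smooth_on Om phi. Proof. by case: pt. Qed.
Let sT : smooth_on Om (tcomp phi). Proof. exact: smooth_tcomp. Qed.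
Let sX : smooth_on Om (xcomp phi). Proof. exact: smooth_xcomp. Qed.

Lemma fibre_jac z : Om z -> dt (tcomp phi) z != 0 /\ dx (xcomp phi) z != 0.
Proof.
move=> Oz; have := jac_neq0 pt Oz.
by rewrite /jac Tx0 // mul0r subr0 mulf_eq0 negb_or => /andP.
Qed.

Lemma fibre_jet_dom p : Om (jet_base p) -> jet_dom p.
Proof.
move=> Op; split=> //; rewrite /Jet.dten /total1 /Jet.at_base Tx0 // mulr0 addr0.
by case: (fibre_jac Op).
Qed.

Let wz (z : F * F) : F := (dt (tcomp phi) z)^-1.

Let twz : time_fun Om wz.
Proof.
apply: time_fun_inv => //; first by move=> z /fibre_jac [].
by apply: time_fun_dt => //; split.
Qed.

Let twzk k : time_fun Om (fun z => wz z ^+ k).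
Proof.
elim: k => [|k IH]; first exact: time_fun_cst.
rewrite (_ : (fun z => _) = (fun z => wz z * wz z ^+ k)); first exact: time_fun_mul.
by apply/funext => z; rewrite exprS.
Qed.

Let dinvE p : jet_dom p -> (dten p)^-1 = at_base wz p.
Proof.
by move=> [Op _]; rewrite /Jet.dten /total1 /Jet.at_base Tx0 // mulr0 addr0.
Qed.

(** Since T_x = 0, the powers of 1 / T_t do not depend on x. The x-derivative of the leading
    coefficient [fk k] is therefore [gk k], and D_t of [fk k] times y_k contributes y_1 y_k with
    coefficient [gk k]. *)
Let fk (k : nat) (z : F * F) : F := dx (xcomp phi) z * wz z ^+ k.
Let gk (k : nat) (z : F * F) : F := dx (dx (xcomp phi)) z * wz z ^+ k.

Let sfk k : smooth_on Om (fk k).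
Proof. by apply: smooth_mul => //; [exact: smooth_dx|case: (twzk k)]. Qed.

Let sgk k : smooth_on Om (gk k).
Proof. by apply: smooth_mul => //; [exact: smooth_dx (smooth_dx sX)|case: (twzk k)]. Qed.

Let dx_fk k z : Om z -> dx (fk k) z = gk k z.
Proof.
move=> Oz; have h := is_deriveMf (is_derive_dx (smooth_dx sX) Oz) (time_fun_dx (twzk k) Oz).
have h' := is_derive_dx (sfk k) Oz.
by rewrite (is_derive_unique h' h) mulr0 add0r mulrC.
Qed.

Let derive_fk k p : jet_dom p -> is_derive p (jet_dir p) (at_base (fk k))
  (at_base (dt (fk k)) p + jcoord 1 p * at_base (gk k) p).
Proof.
move=> [Op _]; apply: (is_derive_eq (is_derive_at_base mv hr pt (sfk k) Op)).
by rewrite /Jet.at_base dx_fk.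
Qed.

Let prolongS' k f (g : jet -> F) :
  (forall p, jet_dom p -> prolong_coord phi k p = f p) ->
  (forall p, jet_dom p -> is_derive p (jet_dir p) f (g p)) ->
  forall p, jet_dom p -> prolong_coord phi k.+1 p = g p * at_base wz p.
Proof.
by move=> h1 h2 p hp; rewrite (prolongS mv hr pt h1 h2 hp) dinvE.
Qed.

(* The monomial y_1 y_(k-1) survives in x~^(k) unless X_xx = 0. *)
Lemma prolong_fibre_quad k : (2 <= k <= r)%N -> exists (c : nat) (be : F * F -> F) (R : jet -> F),
  [/\ (0 < c)%N, smooth_on Om be, jet_alg (k - 2) R &
  forall p, jet_dom p -> prolong_coord phi k p = at_base (fk k) p * jcoord k p
    + (c%:R * (at_base (gk k) p * jcoord 1 p) + at_base be p) * jcoord k.-1 p + R p].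
Proof.
case/andP; elim: k => // k IH; rewrite leq_eqVlt => /orP [/eqP <-|] kr.
  pose h0 z := dt (xcomp phi) z * wz z.
  have sw : smooth_on Om wz by case: twz.
  have sh0 : smooth_on Om h0 by apply: smooth_mul => //; exact: smooth_dt.
  have P1 p : jet_dom p -> prolong_coord phi 1 p = at_base h0 p + at_base (fk 1) p * jcoord 1 p.
    move=> hp; rewrite (prolong1E mv hr pt) // dinvE // /total1 /Jet.at_base /h0 /fk expr1.
    have E (a b y w : F) : (a + y * b) * w = a * w + b * w * y by ring.
    exact: E.
  have D p : jet_dom p -> is_derive p (jet_dir p) (fun p => at_base h0 p + at_base (fk 1) p * jcoord 1 p)
     ((at_base (dt h0) p + jcoord 1 p * at_base (dx h0) p) +
      (at_base (fk 1) p * jcoord 2 p + jcoord 1 p * (at_base (dt (fk 1)) p + jcoord 1 p * at_base (gk 1) p))).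
    move=> hp; apply: is_deriveDf; first by apply: (is_derive_at_base mv hr pt sh0); case: hp.
    by apply: is_deriveMf; [exact: derive_fk|exact: is_derive_jcoord].
  exists 1%N, (fun z => (dx h0 z + dt (fk 1) z) * wz z), (at_base (fun z => dt h0 z * wz z)).
  split => //.
  - apply: smooth_mul => //; apply: smooth_add => //; first exact: smooth_dx.
    exact: smooth_dt (sfk 1).
  - by apply: JetBase; apply: smooth_mul => //; exact: smooth_dt.
  move=> p hp; rewrite (prolongS' P1 D hp) /Jet.at_base /fk /gk.
  have E (a b x xx e y1 y2 w : F) : (a + y1 * b + (x * w ^+ 1 * y2 + y1 * (e + y1 * (xx * w ^+ 1)))) * w =
    x * w ^+ 2 * y2 + (1 * (xx * w ^+ 2 * y1) + (b + e) * w) * y1 + a * w by ring.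
  exact: E.
move=> kr1; have [c [be [R [c0 sbe aR hk]]]] := IH kr (ltnW kr1).
have k2 : (k - 2 < r)%N by lia.
have [gR agR hgR] := jet_alg_derive mv hr pt k2 aR.
have k2' : (2 <= k)%N := kr.
have kk : ((k - 2).+1 = k.-1)%N by lia.
have D p : jet_dom p -> is_derive p (jet_dir p)
   (fun p => at_base (fk k) p * jcoord k p
    + (c%:R * (at_base (gk k) p * jcoord 1 p) + at_base be p) * jcoord k.-1 p + R p)
   (at_base (fk k) p * jcoord k.+1 p + jcoord k p * (at_base (dt (fk k)) p + jcoord 1 p * at_base (gk k) p)
    + ((c%:R * (at_base (gk k) p * jcoord 1 p) + at_base be p) * jcoord k p +
       jcoord k.-1 p * (c%:R * (at_base (gk k) p * jcoord 2 p + jcoord 1 p *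
           (at_base (dt (gk k)) p + jcoord 1 p * at_base (dx (gk k)) p))
        + (at_base (dt be) p + jcoord 1 p * at_base (dx be) p)))
    + gR p).
  move=> hp; have Op := hp.1.
  have dy : is_derive p (jet_dir p) (jcoord k.-1) (jcoord k p).
    by have := @is_derive_jcoord F r k.-1 p; rewrite prednK; [apply; lia|lia].
  have dy1 : is_derive p (jet_dir p) (jcoord 1) (jcoord 2 p) by exact: is_derive_jcoord.
  apply: is_deriveDf; last exact: hgR.
  apply: is_deriveDf.
    by apply: is_deriveMf; [exact: derive_fk|exact: is_derive_jcoord].
  apply: is_deriveMf => //; apply: is_deriveDf; last exact: (is_derive_at_base mv hr pt).
  have hq := is_deriveMf (is_derive_at_base mv hr pt (sgk k) Op) dy1.
  have h := is_deriveMf (is_derive_cst (c%:R : F) p (jet_dir p)) hq.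
  by apply: (is_derive_eq h); rewrite mulr0 addr0.
have sbe' : smooth_on Om (fun z => (dt (fk k) z + be z) * wz z).
  apply: smooth_mul => //; last by case: twz.
  by apply: smooth_add => //; exact: smooth_dt (sfk k).
have k21 : (k.+1 - 2 = k.-1)%N by lia.
have k1 : (1 <= k.-1)%N by lia.
have ab c' m : smooth_on Om c' -> jet_alg m (at_base c') by exact: JetBase.
have aRest (b : bool) : (b -> (2 <= k.-1)%N) -> jet_alg (k.+1 - 2) (fun p =>
  (jcoord k.-1 p * (c%:R * (b%:R * (at_base (gk k) p * jcoord 2 p) + jcoord 1 p *
           (at_base (dt (gk k)) p + jcoord 1 p * at_base (dx (gk k)) p))
        + (at_base (dt be) p + jcoord 1 p * at_base (dx be) p)) + gR p) * at_base wz p).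
  move=> hb; rewrite k21; rewrite kk in agR.
  have y1 : jet_alg k.-1 (jcoord 1) by exact: JetCoord.
  apply: JetMul; last by apply: ab; case: twz.
  apply: JetAdd => //; apply: JetMul; first exact: JetCoord.
  apply: JetAdd; last first.
    apply: JetAdd; first by apply: ab; exact: smooth_dt.
    by apply: JetMul => //; apply: ab; exact: smooth_dx.
  apply: JetMul; first exact: jet_alg_cst.
  apply: JetAdd; last first.
    apply: JetMul => //; apply: JetAdd; first by apply: ab; exact: smooth_dt (sgk k).
    by apply: JetMul => //; apply: ab; exact: smooth_dx (sgk k).
  case: b hb => hb.
    apply: JetMul; first exact: jet_alg_cst.
    by apply: JetMul; [exact: ab|apply: JetCoord; exact: hb].
  rewrite (_ : (fun p => _) = (fun=> 0)); first exact: jet_alg_cst.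
  by apply/funext => p; rewrite mul0r.
have ek p : at_base (fk k.+1) p = at_base (fk k) p * at_base wz p.
  by rewrite /Jet.at_base /fk exprSr mulrA.
have eg p : at_base (gk k.+1) p = at_base (gk k) p * at_base wz p.
  by rewrite /Jet.at_base /gk exprSr mulrA.
have eb p : at_base (fun z => (dt (fk k) z + be z) * wz z) p =
   (at_base (dt (fk k)) p + at_base be p) * at_base wz p by [].
(* For k = 2 the monomial y_1 y_(k-1) is y_1^2 and differentiates to twice y_1 y_2; for larger k the
   product y_2 y_(k-1) belongs to the remainder. *)
have [k3'|k3'] := eqVneq k 2%N.
  exists (c + c + 1)%N, (fun z => (dt (fk k) z + be z) * wz z),
    (fun p => (jcoord k.-1 p * (c%:R * (false%:R * (at_base (gk k) p * jcoord 2 p) + jcoord 1 p *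
           (at_base (dt (gk k)) p + jcoord 1 p * at_base (dx (gk k)) p))
        + (at_base (dt be) p + jcoord 1 p * at_base (dx be) p)) + gR p) * at_base wz p).
  split; [by rewrite addn1|exact: sbe'|by apply: (aRest false)|].
  move=> p hp; rewrite (prolongS' hk D hp) ek eg eb !natrD mul0r add0r.
  have e2 : jcoord 2 p = jcoord k p by rewrite k3'.
  have e1 : jcoord k.-1 p = jcoord 1 p by rewrite k3'.
  rewrite e2 e1 [k.+1.-1]/=.
  have E (f' fd g gt gx w n y1 yk yl b bt bx gR' : F) :
    (f' * yl + yk * (fd + y1 * g) + ((n * (g * y1) + b) * yk + y1 * (n * (g * yk + y1 * (gt + y1 * gx))
      + (bt + y1 * bx))) + gR') * w =
    f' * w * yl + ((n + n + 1) * (g * w * y1) + (fd + b) * w) * yk +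
    (y1 * (n * (y1 * (gt + y1 * gx)) + (bt + y1 * bx)) + gR') * w by ring.
  exact: E.
have hb : (2 <= k.-1)%N by lia.
exists (c + 1)%N, (fun z => (dt (fk k) z + be z) * wz z),
    (fun p => (jcoord k.-1 p * (c%:R * (true%:R * (at_base (gk k) p * jcoord 2 p) + jcoord 1 p *
           (at_base (dt (gk k)) p + jcoord 1 p * at_base (dx (gk k)) p))
        + (at_base (dt be) p + jcoord 1 p * at_base (dx be) p)) + gR p) * at_base wz p).
split; [by rewrite addn1|exact: sbe'|exact: (aRest true (fun _ => hb))|].
move=> p hp; rewrite (prolongS' hk D hp) ek eg eb !natrD mul1r [k.+1.-1]/=.
have E (f' fd g gt gx w n y1 y2 yp yk yl b bt bx gR' : F) :
    (f' * yl + yk * (fd + y1 * g) + ((n * (g * y1) + b) * yk + yp * (n * (g * y2 + y1 * (gt + y1 * gx))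
      + (bt + y1 * bx))) + gR') * w =
    f' * w * yl + ((n + 1) * (g * w * y1) + (fd + b) * w) * yk +
    (yp * (n * (g * y2 + y1 * (gt + y1 * gx)) + (bt + y1 * bx)) + gR') * w by ring.
exact: E.
Qed.

Lemma fibre_dtt_neq0 k z : Om z -> wz z ^+ k != 0.
Proof. by move=> /fibre_jac [h _]; rewrite expf_neq0 // invr_neq0. Qed.

(** x~^(r) is affine in y_(r-1), so the coefficient of y_(r-1) has to vanish for every value u of
    y_1, a slot distinct from y_(r-1) as r >= 3. Two values of u suffice. *)
Lemma maps_dxx_xcomp (E E' : @lin_ode F r) : (3 <= r)%N -> maps_ode Om phi E E' ->
  forall z, Om z -> dx (dx (xcomp phi)) z = 0.
Proof.
move=> r3 hm z Oz.
pose f0 (u : F) (i : nat) : F := if i == 0%N then z.2 else if i == 1%N then u else 0.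
pose f u (s c : F) i := if i == r then c else if i == r.-1 then s else f0 u i.
have b u s d : jet_base (mkjet r z.1 (f u s d)) = z.
  rewrite jet_base_mkjet /f (_ : (0%N == r) = false); last by apply/eqP; lia.
  by rewrite (_ : (0%N == r.-1) = false); [rewrite /f0 /= -surjective_pairing|apply/eqP; lia].
have fdom u s c : jet_dom (mkjet r z.1 (f u s c)) by apply: fibre_jet_dom; rewrite b.
have rr : (2 <= r <= r)%N by rewrite hr leqnn.
have [c [be [R [c0 sbe aR hk]]]] := prolong_fibre_quad rr.
have E2 u : (c%:R * (gk r z * u) + be z) * 1 = 0.
  have [d hd] := exists_jet hr E z.1 (f0 u).
  have jc s0 i : (i <= r - 2)%N -> jcoord i (mkjet r z.1 (f u s0 d)) = f0 u i.
    move=> ir; rewrite mkjetE; last by lia.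
    rewrite /f (_ : (i == r) = false); last by apply/eqP; lia.
    by rewrite (_ : (i == r.-1) = false) //; apply/eqP; lia.
  have key s s' : prolong_coord phi r (mkjet r z.1 (f u s d)) = prolong_coord phi r (mkjet r z.1 (f u s' d)).
    apply: (prolong_pred_indep mv hr pt r3 hm) => //.
    - by move=> i ir; rewrite !jc.
    - by rewrite !mkjetE // /f eqxx.
    apply: hd; last by rewrite /f eqxx.
    move=> i ir; rewrite /f (_ : (i == r) = false); last by apply/eqP; lia.
    by rewrite (_ : (i == r.-1) = false) //; apply/eqP; lia.
  have Rs s s' : R (mkjet r z.1 (f u s d)) = R (mkjet r z.1 (f u s' d)).
    by apply: (jet_alg_dep aR) => // i im; rewrite !jc.
  have E1 s : prolong_coord phi r (mkjet r z.1 (f u s d)) =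
     fk r z * d + (c%:R * (gk r z * u) + be z) * s + R (mkjet r z.1 (f u s d)).
    rewrite hk // /Jet.at_base b !mkjetE; try lia.
    have -> : f u s d 1%N = u.
      rewrite /f (_ : (1%N == r) = false); last by apply/eqP; lia.
      by rewrite (_ : (1%N == r.-1) = false) //; apply/eqP; lia.
    have -> : f u s d r = d by rewrite /f eqxx.
    have -> // : f u s d r.-1 = s.
    by rewrite /f eqxx (_ : (r.-1 == r) = false) //; apply/eqP; lia.
  have := key 1 0; rewrite !E1 (Rs 0 1) => /addIr.
  by rewrite mulr0 => /addrI.
have h0 := E2 0; have h1 := E2 1.
have : c%:R * gk r z = 0.
  apply/eqP; rewrite -[X in _ == X](subr0 0) -{1}h1 -h0; apply/eqP; ring.
move/eqP; rewrite mulf_eq0 pnatr_eq0 -[c == 0%N]negbK -lt0n c0 /= mulf_eq0.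
by rewrite (negbTE (fibre_dtt_neq0 r Oz)) orbF => /eqP.
Qed.

End FibreAffinity.

(** * Transformations that generate or are admissible have normal form *)

Section Necessity.
Context {F : numFieldType} (mv : mean_value_ineq F) (r : nat) (hr : (2 <= r)%N).
Local Opaque dt dx.
Local Notation jet := (F * 'rV[F]_r.+1)%type.
Local Notation joint := (jet * ('rV[F]_(r.-1) * F))%type.

Lemma point_transformation_sub (Om U : set (F * F)) phi : open U -> U `<=` Om ->
  point_transformation Om phi -> point_transformation U phi.
Proof.
by move=> oU UO [oO sO jO]; split=> //; [exact: smooth_subset sO|move=> z /UO/jO].
Qed.

Lemma maps_normal_form (Om : set (F * F)) phi (E E' : @lin_ode F r) :
  point_transformation Om phi -> fibre_affine Om phi -> maps_ode Om phi E E' ->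
  normal_form r Om phi.
Proof.
move=> pt fa hm; split => // z Oz.
have oOm : open Om by case: pt.
have [d d0 hd] := open_box oOm Oz.
have C : pmx r phi z *m eq_col (coef E' (phi z).1) = plead r phi z *: eq_col (coef E z.1).
  apply: (compare_coef mv hr pt fa d0 hd) => q q1 q2.
  have Oq : Om (jet_base q) by apply: hd => //; rewrite /= q1 subrr normr0.
  apply hm => //; rewrite (DT_fibre mv pt fa) //.
  by have [] := fibre_jacobian pt fa Oq.
have := pmx_row_pred hr pt (eq_col (coef E' (phi z).1)) Oz.
by rewrite C mxE !eq_col_pred // eq_col_last // !mulr0 add0r mulr1.
Qed.

Lemma admissible_normal_form (Om : set (F * F)) phi (E E' : @lin_ode F r) : (3 <= r)%N ->
  admissible E E' Om phi -> normal_form r Om phi.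
Proof.
move=> r3 [pt hm]; have Tx0 := maps_dx_tcomp mv hr pt r3 hm.
apply: (maps_normal_form pt _ hm) => z Oz; split; first exact: Tx0.
exact: (maps_dxx_xcomp mv hr pt Tx0 r3 hm).
Qed.

(** Test equations defined for all t, so that every point of Om lies over their domain. *)
Definition cst_ode (b : F) : @lin_ode F r :=
  @LinODE F r setT (fun=> 0) (fun=> b) openT (@smooth_cst _ _ _ _ _) (@smooth_cst _ _ _ _ _).

(** For r >= 3 one test equation near each point suffices. For r = 2 a single equation would let
    projective maps pass; x'' = 0 and x'' = 1 are compared under the same transformation at equal t,
    x and y_1. *)
Lemma equivalence_normal_form (Om : set (F * F)) phi (Psi : joint -> joint) :
  equivalence_transformation Om phi Psi -> normal_form r Om phi.
Proof.
move=> [pt _ _ _ H]; have oOm : open Om by case: pt.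
have [r2|r3] : r = 2%N \/ (3 <= r)%N by lia.
  have loc b z : Om z -> exists (E' : @lin_ode F r), forall p : jet, jet_base p = z ->
      DT phi p != 0 -> satisfies (cst_ode b) p -> satisfies E' (prolong phi p).
    move=> Oz; have [U [E' [oU Uz UO [hm _]]]] := H (cst_ode b) z Oz I.
    by exists E' => p pz Dp; apply hm.2 => //; rewrite pz.
  have jet2 b (E' : @lin_ode F r) z y1 : Om z ->
    (forall p : jet, jet_base p = z -> DT phi p != 0 -> satisfies (cst_ode b) p -> satisfies E' (prolong phi p)) ->
    dt (tcomp phi) z + y1 * dx (tcomp phi) z != 0 ->
    prolong_coord phi 2 (mkjet r z.1 (fun i => if i == 0%N then z.2 else if i == 1%N then y1 else b)) =
     rhs E' (phi z).1 - \sum_(j < r.-1) coef E' (phi z).1 0 j * (phi z).2.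
    move=> Oz h Dz; set p := mkjet _ _ _.
    have pz : jet_base p = z by rewrite jet_base_mkjet /= -surjective_pairing.
    have p1 : jcoord 1 p = y1 by rewrite mkjetE // r2.
    have Dp : DT phi p != 0 by rewrite (DT_dten mv hr pt) ?pz // (dtenE _ pz) p1.
    have sp : satisfies (cst_ode b) p.
      have rf : (if r == 0%N then z.2 else if r == 1%N then y1 else b) = b by rewrite r2.
      apply/satisfies_jcoord; rewrite mkjetE // rf big1 ?addr0 // => j _.
      by rewrite mxE mul0r.
    have e2 : prolong_coord phi r p = prolong_coord phi 2 p by congr (prolong_coord phi _ p).
    have := h p pz Dp sp; rewrite satisfies_prolong e2 pz => <-.
    rewrite (eq_bigr (fun j : 'I_r.-1 => coef E' (phi z).1 0 j * (phi z).2)) ?addrK // => j _.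
    by rewrite (_ : nat_of_ord j = 0%N) /= ?pz //; have := ltn_ord j; lia.
  have Tx0 z : Om z -> dx (tcomp phi) z = 0.
    move=> Oz; apply/eqP; apply: contrapT => /negP Tx.
    have [E0 h0] := loc 0 z Oz; have [E1 h1] := loc 1 z Oz.
    (* The values of x~'' at y_2 = 1 and y_2 = 0 differ by J w^3 with w = 1 / D_t T, while the
       equations E1 and E0 fix this difference independently of y_1. If T_x is nonzero, y_1 can be
       chosen to give w any nonzero value. *)
    have key (w : F) : w != 0 -> jac phi z * w ^+ 3 =
       (rhs E1 (phi z).1 - \sum_(j < r.-1) coef E1 (phi z).1 0 j * (phi z).2) -
       (rhs E0 (phi z).1 - \sum_(j < r.-1) coef E0 (phi z).1 0 j * (phi z).2).
      move=> w0; pose y1 := (w^-1 - dt (tcomp phi) z) / dx (tcomp phi) z.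
      have De : dt (tcomp phi) z + y1 * dx (tcomp phi) z = w^-1.
        by rewrite /y1 divfK // addrC subrK.
      have D0 : dt (tcomp phi) z + y1 * dx (tcomp phi) z != 0 by rewrite De invr_neq0.
      rewrite -(jet2 _ _ _ _ Oz h0 D0) -(jet2 _ _ _ _ Oz h1 D0).
      set p1 := mkjet _ _ _; set p0 := mkjet _ _ _.
      have b1 : jet_base p1 = z by rewrite jet_base_mkjet /= -surjective_pairing.
      have b0 : jet_base p0 = z by rewrite jet_base_mkjet /= -surjective_pairing.
      have d1 : dten phi p1 = w^-1 by rewrite (dtenE _ b1) mkjetE ?r2.
      have d0 : dten phi p0 = w^-1 by rewrite (dtenE _ b0) mkjetE ?r2.
      rewrite !(prolong2E mv hr pt); first last.
      - by split; rewrite ?b1 // d1 invr_neq0.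
      - by split; rewrite ?b0 // d0 invr_neq0.
      rewrite /Jet.at_base b1 b0 d1 d0 invrK !mkjetE ?r2 //= mulr1 mulr0 add0r.
      have -> : second_rest phi p1 = second_rest phi p0.
        apply: (jet_alg_dep (second_rest_alg r pt)) => // i i1.
        rewrite !mkjetE ?r2; try lia.
        by case: i i1 => [|[|]].
      by rewrite addrK.
    have n2 : 2%:R != 0 :> F by rewrite pnatr_eq0.
    (* The choices w = 1 and w = 2 give J = 8 J, hence 7 J = 0. *)
    have e : jac phi z * 1 ^+ 3 = jac phi z * 2%:R ^+ 3.
      by rewrite (key 1 (oner_neq0 _)) (key 2%:R n2).
    have : 7%:R * jac phi z = 0.
      have -> : 7%:R * jac phi z = jac phi z * 2%:R ^+ 3 - jac phi z * 1 ^+ 3 by ring.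
      by rewrite e subrr.
    by apply/eqP; rewrite mulf_neq0 ?pnatr_eq0 // (jac_neq0 pt).
  have fa : fibre_affine Om phi.
    move=> z Oz; split; first exact: Tx0.
    have rr : (2 <= 2 <= r)%N by rewrite r2.
    have [c [be [R [c0 sbe aR hk]]]] := prolong_fibre_quad mv hr pt Tx0 rr.
    have [E0 h0] := loc 0 z Oz.
    have [T0 _] := fibre_jac pt Tx0 Oz.
    have D0 y1 : dt (tcomp phi) z + y1 * dx (tcomp phi) z != 0 by rewrite Tx0 // mulr0 addr0.
    pose C := rhs E0 (phi z).1 - \sum_(j < r.-1) coef E0 (phi z).1 0 j * (phi z).2.
    have key y1 : _ = C := jet2 _ _ _ _ Oz h0 (D0 y1).
    have key2 y1 : (c%:R * (dx (dx (xcomp phi)) z * (dt (tcomp phi) z)^-1 ^+ 2 * y1) + be z) * y1 +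
       R (mkjet r z.1 (fun i => if i == 0%N then z.2 else 0)) = C.
      rewrite -(key y1); set p := mkjet r z.1 (fun i => if i == 0%N then z.2 else if i == 1%N then y1 else 0).
      have b : jet_base p = z by rewrite jet_base_mkjet /= -surjective_pairing.
      have dp : jet_dom Om phi p by apply: (fibre_jet_dom pt Tx0); rewrite b.
      rewrite (hk _ dp).
      rewrite /Jet.at_base b !mkjetE ?r2 //= mulr0 add0r; congr (_ + _).
      by apply: (jet_alg_dep aR) => // i i1; rewrite !mkjetE ?r2; try lia; case: i i1.
    have k0 := key2 0; have k1 := key2 1; have k2 := key2 (-1).
    set g := dx (dx (xcomp phi)) z * (dt (tcomp phi) z)^-1 ^+ 2 in k0 k1 k2.
    set R0 := R _ in k0 k1 k2.
    (* Second difference of a quadratic polynomial in y_1 that takes the same value at 0, 1 and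
       -1. *)
    have : 2%:R * (c%:R * g) = 0.
      have -> : 2%:R * (c%:R * g) = ((c%:R * (g * 1) + be z) * 1 + R0) +
          ((c%:R * (g * (-1)) + be z) * (-1) + R0) - 2%:R * ((c%:R * (g * 0) + be z) * 0 + R0) by ring.
      rewrite k0 k1 k2; ring.
    move/eqP; rewrite mulf_eq0 mulf_eq0 !pnatr_eq0 -[c == 0%N]negbK -lt0n c0 /= mulf_eq0.
    by rewrite expf_eq0 invr_eq0 (negbTE T0) andbF orbF => /eqP.
  split=> // z Oz; have [U [E' [oU Uz UO [hm _]]]] := H (cst_ode 0) z Oz I.
  have [_] := maps_normal_form (point_transformation_sub oU UO pt) (fun w Uw => fa w (UO w Uw)) hm.
  exact.
have loc z : Om z -> exists2 U, U z & normal_form r U phi.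
  move=> Oz; have [U [E' [oU Uz UO [hm _]]]] := H (cst_ode 0) z Oz I.
  exists U => //; apply: (admissible_normal_form r3 (E := cst_ode 0) (E' := E')).
  by split => //; exact: point_transformation_sub pt.
by split=> z /loc [U Uz [h1 h2]]; [exact: h1|exact: h2].
Qed.

End Necessity.

(** * The explicit form of the transformations *)

Section AffineMaps.
Context {F : numFieldType} (mv : mean_value_ineq F).

Lemma is_derive_comp_fst (g : F -> F) (z v : F * F) d :
  is_derive z.1 v.1 g d -> is_derive z v (fun w : F * F => g w.1) d.
Proof.
move=> h; apply: (@is_derive_prelin F (F * F)%type F F (@fst F F) g) => //.
Qed.

Lemma smooth_comp_fst (I : set F) (B : set (F * F)) (g : F -> F) :
  open B -> (forall w, B w -> I w.1) ->
  smooth_on I g -> smooth_on B (fun w : F * F => g w.1).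
Proof.
move=> oB BI; apply: (@smooth_prelin F (F * F)%type F F I B (@fst F F)) => //.
exact: fst_cont.
Qed.

Context (I J : set F) (oI : open I) (oJ : open J) (T a b : F -> F) (phi : F * F -> F * F).
Context (sT : smooth_on I T) (sa : smooth_on I a) (sb : smooth_on I b).
Context (phiE : forall t x, I t -> J x -> phi (t, x) = (T t, a t * x + b t)).

Let B := I `*` J.
Let oB : open B. Proof. exact: open_rect. Qed.
Let BI w : B w -> I w.1. Proof. by case. Qed.

Let TE w : B w -> T w.1 = tcomp phi w.
Proof. by case: w => t x [It Jx]; rewrite /tcomp phiE. Qed.

Let XE w : B w -> a w.1 * w.2 + b w.1 = xcomp phi w.
Proof. by case: w => t x [It Jx]; rewrite /xcomp phiE. Qed.

Lemma affine_smooth : smooth_on B phi.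
Proof.
have s2 : smooth_on B (fun w : F * F => w.2) by apply: smooth_lin => //; exact: snd_cont.
apply: (@smooth_eq _ _ _ _ (fun w => (T w.1, a w.1 * w.2 + b w.1))) => //.
  by move=> [t x] [It Jx]; rewrite phiE.
apply: smooth_pair => //; first exact: smooth_comp_fst sT.
apply: smooth_add => //; last exact: smooth_comp_fst sb.
by apply: smooth_mul => //; exact: smooth_comp_fst sa.
Qed.

Let dfst (g : F -> F) (z : F * F) : smooth_on I g -> B z ->
  is_derive z (1, 0) (fun w : F * F => g w.1) ('D_1 g z.1).
Proof. by move=> sg /BI Iz; apply: is_derive_comp_fst; exact: smooth_is_derive Iz. Qed.

Let dfst0 (g : F -> F) (z : F * F) : is_derive z (0, 1) (fun w : F * F => g w.1) 0.
Proof. by apply: is_derive_comp_fst; exact: is_derive0. Qed.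

Lemma affine_dt_tcomp z : B z -> dt (tcomp phi) z = 'D_1 T z.1.
Proof.
by move=> Bz; have [_ <-] := is_derive_near oB Bz TE (dfst sT Bz).
Qed.

Lemma affine_dx_tcomp z : B z -> dx (tcomp phi) z = 0.
Proof. by move=> Bz; have [_ <-] := is_derive_near oB Bz TE (dfst0 T z). Qed.

Lemma affine_dx_xcomp z : B z -> dx (xcomp phi) z = a z.1.
Proof.
move=> Bz.
have h2 : is_derive z (0, 1) (fun w : F * F => w.2) 1 by exact: is_derive_snd2.
have h := is_deriveDf (is_deriveMf (dfst0 a z) h2) (dfst0 b z).
have [_] := is_derive_near oB Bz XE h.
by rewrite mulr1 mulr0 !addr0.
Qed.

Lemma affine_dx_dx_xcomp z : B z -> dx (dx (xcomp phi)) z = 0.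
Proof.
move=> Bz; have e w : B w -> a w.1 = dx (xcomp phi) w by move/affine_dx_xcomp.
by have [_ <-] := is_derive_near oB Bz e (dfst0 a z).
Qed.

Lemma affine_dt_dx_xcomp z : B z -> dt (dx (xcomp phi)) z = 'D_1 a z.1.
Proof.
move=> Bz; have e w : B w -> a w.1 = dx (xcomp phi) w by move/affine_dx_xcomp.
by have [_ <-] := is_derive_near oB Bz e (dfst sa Bz).
Qed.

Lemma affine_dt_dt_tcomp z : B z -> dt (dt (tcomp phi)) z = 'D_1 ('D_1 T) z.1.
Proof.
move=> Bz; have e w : B w -> 'D_1 T w.1 = dt (tcomp phi) w by move/affine_dt_tcomp.
by have [_ <-] := is_derive_near oB Bz e (dfst (smoothD_v (1 : F) sT) Bz).
Qed.

Lemma affine_jacobian z : B z -> jacobian_tx phi z = 'D_1 T z.1 * a z.1.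
Proof.
move=> Bz; rewrite jacobianE affine_dt_tcomp // affine_dx_xcomp // affine_dx_tcomp //.
by rewrite mul0r subr0.
Qed.

End AffineMaps.

(** * The normal form as a differential equation for X_x and its integration *)

Section NormalForm.
Local Opaque dt dx.
Context {F : numFieldType} (mv : mean_value_ineq F) (r : nat) (hr : (2 <= r)%N).

(** This is [pcoef_subdiag] for k = r-1, doubled: as 2 C(r,2) = r (r-1), a factor r splits off. *)
Lemma normal_formP (Om : set (F * F)) phi : point_transformation Om phi ->
  fibre_affine Om phi ->
  (forall z, Om z -> 2%:R * dt (dx (xcomp phi)) z * dt (tcomp phi) z =
     r.-1%:R * dx (xcomp phi) z * dt (dt (tcomp phi)) z) <->
  normal_form r Om phi.
Proof.
move=> pt fa.
have key z : Om z -> 2%:R * (pcoef phi r r.-1 z * dt (tcomp phi) z ^+ r.+1) =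
   r%:R * (2%:R * dt (dx (xcomp phi)) z * dt (tcomp phi) z -
     r.-1%:R * dx (xcomp phi) z * dt (dt (tcomp phi)) z).
  move=> Oz; have := pcoef_subdiag pt fa r.-1 Oz.
  rewrite prednK; last by lia.
  move=> ->; have b2 : r%:R * r.-1%:R = 2%:R * 'C(r, 2)%:R :> F.
    by rewrite -!natrM -mul_bin_diag bin1 mulnC.
  rewrite mulrBr mulrBr; congr (_ - _); first by ring.
  by rewrite !mulrA b2.
have r0 : r%:R != 0 :> F by rewrite pnatr_eq0; lia.
split=> [h|[_ h] z Oz].
  split=> // z Oz; have := key z Oz; rewrite h // subrr mulr0 => /eqP.
  rewrite mulf_eq0 pnatr_eq0 /= mulf_eq0 expf_eq0.
  by have [/negbTE -> _] := fibre_jacobian pt fa Oz; rewrite andbF orbF => /eqP.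
have := key z Oz; rewrite h // mul0r mulr0 => /esym/eqP.
by rewrite mulf_eq0 (negbTE r0) /= subr_eq0 => /eqP.
Qed.

Lemma affine_normal_form (Om : set (F * F)) phi : open Om ->
  (forall z, Om z -> exists (I J : set F) (T a b : F -> F),
    [/\ [/\ open I, open J, I z.1 & J z.2],
        [/\ smooth_on I T, smooth_on I a & smooth_on I b],
        forall t, I t -> 'D_1 T t != 0 /\ a t != 0,
        forall t, I t -> 2%:R * 'D_1 a t * 'D_1 T t = r.-1%:R * a t * 'D_1 ('D_1 T) t &
        forall t x, I t -> J x -> phi (t, x) = (T t, a t * x + b t)]) ->
  point_transformation Om phi /\ normal_form r Om phi.
Proof.
move=> oOm H.
have pt : point_transformation Om phi.
  split=> //.
    apply: smooth_local => z /H [I [J [T [a [b [[oI oJ Iz Jz] [sT sa sb] _ _ phiE]]]]]].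
    exists (I `*` J) => //; exact: affine_smooth sT sa sb phiE.
  move=> z /H [I [J [T [a [b [[oI oJ Iz Jz] [sT sa sb] nz _ phiE]]]]]].
  rewrite (affine_jacobian oI oJ sT phiE) //.
  by have [h1 h2] := nz _ Iz; rewrite mulf_neq0.
have fa : fibre_affine Om phi.
  move=> z /H [I [J [T [a [b [[oI oJ Iz Jz] [sT sa sb] _ _ phiE]]]]]]; split.
    exact: (affine_dx_tcomp oI oJ phiE).
  exact: (affine_dx_dx_xcomp oI oJ phiE).
split=> //; apply/(normal_formP pt fa) => z.
move=> /H [I [J [T [a [b [[oI oJ Iz Jz] [sT sa sb] _ e phiE]]]]]].
have Bz : (I `*` J) z by [].
rewrite (affine_dt_dx_xcomp oI oJ sa phiE Bz) (affine_dt_tcomp oI oJ sT phiE Bz).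
by rewrite (affine_dx_xcomp oI oJ phiE Bz) (affine_dt_dt_tcomp oI oJ sT phiE Bz) e.
Qed.

(** What a notion of square root must provide. A branch s of the root of g satisfies 2 s' g = s g'.
    Conversely a branch is obtained from a solution A of 2 A' g = (2m+1) A g': on a domain that is
    not simply connected g may have no root, and the existence of A supplies one. *)
Definition sqrt_branch_spec (branch : set F -> (F -> F) -> (F -> F) -> Prop) :=
  (forall (I : set F) (g s : F -> F), open I -> smooth_on I g -> (forall t, I t -> g t != 0) ->
     branch I g s -> smooth_on I s /\ forall t, I t -> s t != 0 /\
       2%:R * 'D_1 s t * g t = s t * 'D_1 g t) /\
  (forall (I : set F) (g A : F -> F) m, is_domain I -> smooth_on I g -> smooth_on I A ->
     (forall t, I t -> g t != 0 /\ A t != 0) ->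
     (forall t, I t -> 2%:R * 'D_1 A t * g t = m.*2.+1%:R * A t * 'D_1 g t) ->
     exists (s : F -> F) (C : F), [/\ branch I g s, C != 0 &
       forall t, I t -> A t = C * s t ^+ m.*2.+1]).

Lemma derive1D (f : F -> F) : derive1 f = 'D_1 f.
Proof. by apply/funext => t; rewrite derive1E. Qed.

Lemma is_derive_exp (f : F -> F) (t d : F) k : is_derive t 1 f d ->
  is_derive t 1 (fun t => f t ^+ k) (k%:R * f t ^+ k.-1 * d).
Proof.
move=> h; have h' := is_deriveX k h.
have e : (fun t => f t ^+ k) = f ^+ k by rewrite exprfctE.
by rewrite e.
Qed.

(** The logarithmic derivative, 2 tau' / tau = (r-1) g' / g, treats integer and half-integer powers
    alike. *)
Lemma power_branch_smooth branch (I : set F) (g tau : F -> F) :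
  sqrt_branch_spec branch -> open I -> smooth_on I g -> (forall t, I t -> g t != 0) ->
  power_branch r branch I g tau ->
  smooth_on I tau /\ forall t, I t -> tau t != 0 /\
     2%:R * 'D_1 tau t * g t = r.-1%:R * tau t * 'D_1 g t.
Proof.
move=> [spec _] oI sg g0.
have dpow (f : F -> F) k t : smooth_on I f -> I t -> (forall t, I t -> tau t = f t ^+ k) ->
    'D_1 tau t = k%:R * f t ^+ k.-1 * 'D_1 f t.
  move=> sf It te; have h := is_derive_exp k (smooth_is_derive (1 : F) sf It).
  have te' u : I u -> f u ^+ k = tau u by move/te.
  by have [_ <-] := is_derive_near oI It te' h.
rewrite /power_branch; case: ifP => ro.
  move=> te; split.
    by apply: (smooth_eq oI (f := fun t => g t ^+ r.-1./2)) => [t /te //|]; exact: smooth_exp.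
  move=> t It; rewrite te // expf_neq0 ?g0 //; split => //.
  rewrite (dpow _ _ _ sg It te).
  have -> : r.-1%:R = 2%:R * (r.-1./2)%:R :> F by rewrite -natrM; congr _%:R; lia.
  case: (r.-1./2) => [|k]; first by rewrite !(mulr0, mul0r).
  by rewrite exprS [k.+1.-1]/=; ring.
move=> [s [bs te]]; have [ss s1] := spec I g s oI sg g0 bs.
split; first by apply: (smooth_eq oI (f := fun t => s t ^+ r.-1)) => [t /te //|]; exact: smooth_exp.
move=> t It; have [s0 e] := s1 t It; rewrite te // expf_neq0 //; split => //.
rewrite (dpow _ _ _ ss It te); case: (r.-1) => [|k]; first by rewrite !(mulr0, mul0r).
rewrite [k.+1.-1]/= exprS.
have E (n x y z w : F) : 2%:R * z * w = x * y ->
    2%:R * (n * (x ^+ k) * z) * w = n * (x * x ^+ k) * y.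
  move=> h; have -> : 2%:R * (n * (x ^+ k) * z) * w = n * x ^+ k * (2%:R * z * w) by ring.
  by rewrite h; ring.
exact: E.
Qed.

(** For odd r the exponent m = (r-1)/2 is an integer, and A / g^m has derivative 0 on the connected
    set I. Even r is left to the specification of the branch. *)
Lemma exists_power_branch branch (I : set F) (g A : F -> F) :
  sqrt_branch_spec branch -> is_domain I -> smooth_on I g -> smooth_on I A ->
  (forall t, I t -> g t != 0 /\ A t != 0) ->
  (forall t, I t -> 2%:R * 'D_1 A t * g t = r.-1%:R * A t * 'D_1 g t) ->
  exists (tau : F -> F) (C : F), [/\ power_branch r branch I g tau, C != 0 &
    forall t, I t -> A t = C * tau t].
Proof.
move=> [_ spec] dI sg sA nz e; rewrite /power_branch; case ro : (odd r); last first.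
  have rE : r.-1 = (r.-1./2).*2.+1 by lia.
  have e' t : I t -> 2%:R * 'D_1 A t * g t = (r.-1./2).*2.+1%:R * A t * 'D_1 g t.
    by rewrite -rE; exact: e.
  have [s [C [bs C0 AE]]] := spec I g A _ dI sg sA nz e'.
  exists (fun t => s t ^+ r.-1), C; split => //; first by exists s.
  by move=> t It; rewrite AE // -rE.
have [oI [t0 It0] cI] := dI; set m := r.-1./2.
have rE : r.-1%:R = 2%:R * m%:R :> F by rewrite -natrM /m; congr _%:R; lia.
exists (fun t => g t ^+ m), (A t0 / g t0 ^+ m); split => //.
  by have [g0 A0] := nz _ It0; rewrite mulf_neq0 // invr_neq0 // expf_neq0.
move=> t It; have [g0 A0] := nz t It.
suff <- : A t / g t ^+ m = A t0 / g t0 ^+ m by rewrite divfK // expf_neq0.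
apply: (derive0_const mv oI cI (f := fun t => A t / g t ^+ m)) => // u Iu.
have [gu Au] := nz u Iu.
have h1 := smooth_is_derive (1 : F) sA Iu; have h2 := smooth_is_derive (1 : F) sg Iu.
have gm : (fun u => g u ^+ m) u != 0 by rewrite expf_neq0.
have h := is_deriveMf h1 (@is_derive_inv F _ (fun u => g u ^+ m) _ _ _ gm (is_derive_exp m h2)).
apply: (is_derive_eq h) => /=.
have eu := e u Iu; rewrite rE in eu.
case: m rE gm h eu {e} => [|k] rE gm h eu.
  rewrite !mul0r !mulr0 add0r expr0 invr1 mul1r.
  by move/eqP: eu; rewrite !mulr0 !mul0r mulf_eq0 (negbTE gu) orbF mulf_eq0 pnatr_eq0 /= => /eqP.
have : 'D_1 A u * g u = k.+1%:R * A u * 'D_1 g u.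
  apply: (mulfI (x := 2%:R)); first by rewrite pnatr_eq0.
  by rewrite !mulrA eu.
rewrite [k.+1.-1]/= => eu'.
have E (x y z w n : F) : x != 0 -> z * x = n * w * y ->
   w * (- (x ^+ k.+1) ^- 2 * (n * x ^+ k * y)) + (x ^+ k.+1)^-1 * z = 0.
  move=> x0 h'; rewrite !(exprS x k).
  have -> : w * (- (x * x ^+ k) ^- 2 * (n * x ^+ k * y)) + (x * x ^+ k)^-1 * z =
    (z * x - n * w * y) / (x * (x * x ^+ k)).
    by field; rewrite x0 expf_neq0.
  by rewrite h' subrr mul0r.
exact: E.
Qed.

(** T, X_x and X - X_x x are constant in x along the connected set J, so they can be read off on the
    line x = x0. *)
Lemma form_of_normal branch (Om : set (F * F)) phi : sqrt_branch_spec branch ->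
  point_transformation Om phi -> normal_form r Om phi ->
  forall I J : set F, is_domain I -> is_domain J -> I `*` J `<=` Om ->
    G1_form r branch I J phi.
Proof.
move=> spec pt nf I J dI [oJ [x0 Jx0] cJ] IJ; have [fa _] := nf.
have [oI _ _] := dI.
have oOm : open Om by case: pt.
have sphi : smooth_on Om phi by case: pt.
have IO t x : I t -> J x -> Om (t, x) by move=> It Jx; exact: IJ.
have sline (f : F * F -> F) : smooth_on Om f -> smooth_on I (fun t => f (t, x0)).
  move=> sf; pose line (t : F) : F * F := (t, 0) + (0, x0).
  have lineE t : line t = (t, x0) by rewrite /line /GRing.add /= /add_pair /= addr0 add0r.
  apply: (@smooth_eq _ _ _ _ (fun t => f (line t))) => //.
    by move=> t _; rewrite lineE.
  apply: (smooth_preaff (A := Om) (l := fun t : F => (t, 0 : F)) oI (@inl_lin _ _ _) (@inl_cont _ _ _) _ sf).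
  by move=> t It; rewrite -/(line t) lineE; exact: IO.
have dline (f : F * F -> F) t : smooth_on Om f -> I t -> 'D_1 (fun t => f (t, x0)) t = dt f (t, x0).
  by move=> sf It; have [] := is_derive_fix2 (is_derive_dt sf (IO _ _ It Jx0)).
have tf (f : F * F -> F) t x : time_fun Om f -> I t -> J x -> f (t, x) = f (t, x0).
  move=> hf It Jx; apply: (time_fun_const mv hf oJ cJ) => // w Jw; exact: IO.
pose T t := tcomp phi (t, x0); pose A t := dx (xcomp phi) (t, x0).
pose X0 t := pshift phi 0 (t, x0).
have sT : smooth_on I T by apply: sline; exact: smooth_tcomp.
have sA : smooth_on I A by apply: sline; apply: smooth_dx; exact: smooth_xcomp.
have TE t : I t -> 'D_1 T t = dt (tcomp phi) (t, x0).
  by move=> It; apply: dline => //; exact: smooth_tcomp.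
have nz t : I t -> 'D_1 T t != 0 /\ A t != 0.
  by move=> It; rewrite TE //; apply: (fibre_jacobian pt fa); exact: IO.
have e t : I t -> 2%:R * 'D_1 A t * 'D_1 T t = r.-1%:R * A t * 'D_1 ('D_1 T) t.
  move=> It; have E := (normal_formP pt fa).2 nf (t, x0) (IO _ _ It Jx0).
  have h1 : 'D_1 A t = _ := dline _ t (smooth_dx (smooth_xcomp oOm sphi)) It.
  have h2 : 'D_1 (fun u => dt (tcomp phi) (u, x0)) t = _ :=
    dline _ t (smooth_dt (smooth_tcomp oOm sphi)) It.
  have h3 : 'D_1 ('D_1 T) t = 'D_1 (fun u => dt (tcomp phi) (u, x0)) t.
    by apply: (derive_near _ oI It) => u Iu; exact: TE.
  have G (a1 t1 a t2 a1' t1' t2' : F) : a1 = a1' -> t1 = t1' -> t2 = t2' ->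
    2%:R * a1' * t1' = r.-1%:R * a * t2' -> 2%:R * a1 * t1 = r.-1%:R * a * t2.
    by move=> -> -> ->.
  exact: (G _ _ _ _ _ _ _ h1 (TE t It) (etrans h3 h2) E).
have [tau [C [pb C0 AE]]] := exists_power_branch spec dI (smoothD_v (1 : F) sT) sA nz e.
exists T, X0, tau, C; rewrite !derive1D; split => //.
- by split => // t /nz [].
- by apply: sline; case: (time_fun_pshift mv pt fa 0).
move=> t x It Jx; rewrite [LHS]surjective_pairing; congr (_, _).
  exact: (tf _ _ _ (time_fun_tcomp pt fa)).
rewrite -AE // /X0 -(tf _ _ _ (time_fun_pshift mv pt fa 0) It Jx).
rewrite /A -(tf _ _ _ (time_fun_dxx pt fa) It Jx) /=.
by rewrite addrC subrK.
Qed.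

(** The conclusion is local, so the form on a product of two disks around each point is enough. *)
Lemma normal_of_form branch (Om : set (F * F)) phi : sqrt_branch_spec branch -> open Om ->
  (forall I J : set F, is_domain I -> is_domain J -> I `*` J `<=` Om ->
    G1_form r branch I J phi) ->
  point_transformation Om phi /\ normal_form r Om phi.
Proof.
move=> spec oOm H; apply: affine_normal_form => // z Oz.
have [d d0 hd] := open_box oOm Oz.
pose I := [set t | `|z.1 - t| < d]; pose J := [set t | `|z.2 - t| < d].
have dI : is_domain I by exact: is_domain_disk.
have dJ : is_domain J by exact: is_domain_disk.
have [oI _ _] := dI; have [oJ _ _] := dJ.
have IJ : I `*` J `<=` Om by move=> w [h1 h2]; exact: hd.
have [T [X0 [tau [C [[sT nT] sX0 C0 pb phiE]]]]] := H I J dI dJ IJ.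
rewrite !derive1D in nT pb.
have [stau ht] := power_branch_smooth spec oI (smoothD_v (1 : F) sT) nT pb.
exists I, J, T, (fun t => C * tau t), X0; split => //.
- by split => //; rewrite /I /J /= subrr normr0.
- by split => //; apply: smooth_mul => //; exact: smooth_cst.
- by move=> t It; split; [exact: nT|rewrite mulf_neq0 //; case: (ht t It)].
move=> t It; have [_ e] := ht t It.
have h := is_deriveMf (is_derive_cst C t (1 : F)) (smooth_is_derive (1 : F) stau It).
have [_ ->] := h; rewrite mulr0 addr0.
have -> : 2%:R * (C * 'D_1 tau t) * 'D_1 T t = C * (2%:R * 'D_1 tau t * 'D_1 T t) by ring.
by rewrite e; ring.
Qed.

End NormalForm.

(** * The ground fields *)

Section RealInstances.
Context {R : realType}.

Lemma real_half_pow_small : half_pow_small R.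
Proof.
move=> C e C0 e0; have Ce : 0 <= C / e by rewrite divr_ge0 // ltW.
exists (Num.bound (C / e)); rewrite ltr_pdivrMr ?exprn_gt0 // mulrC -ltr_pdivrMr //.
apply: lt_le_trans (archi_boundP Ce) _.
by rewrite -natrX ler_nat ltnW // ltn_expl.
Qed.

(* l = sup (u_n - 2 C / 2^n): these numbers increase, and u_n + 2 C / 2^n decrease *)
Lemma real_geometric_complete : geometric_complete R.
Proof.
move=> u C hu; pose a n := u n - 2%:R * C / 2%:R ^+ n; pose b n := u n + 2%:R * C / 2%:R ^+ n.
have e n : 2%:R * C / 2%:R ^+ n = 2%:R * C / 2%:R ^+ n.+1 + C / 2%:R ^+ n.
  by rewrite exprS; field; rewrite expf_neq0.
have C0 : 0 <= C by have := hu 0%N; rewrite expr0 divr1; exact: le_trans.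
have p0 n : 0 <= 2%:R * C / 2%:R ^+ n.
  by rewrite divr_ge0 ?mulr_ge0 // exprn_ge0.
have a1 n : a n <= a n.+1.
  have := hu n; rewrite ler_norml => /andP [h _].
  by rewrite /a e; move: (2%:R * C / _) (C / _) h => x y; lra.
have b1 n : b n.+1 <= b n.
  have := hu n; rewrite ler_norml => /andP [_ h].
  by rewrite /b [in X in _ <= X]e; move: (2%:R * C / _) (C / _) h => x y; lra.
have am n k : a n <= a (n + k)%N.
  by elim: k => [|k IH]; rewrite ?addn0 // addnS; exact: le_trans IH (a1 _).
have bm n k : b (n + k)%N <= b n.
  by elim: k => [|k IH]; rewrite ?addn0 // addnS; exact: le_trans (b1 _) IH.
have ab n m : a n <= b m.
  apply: le_trans (am n m) _; rewrite addnC; apply: le_trans (bm m n).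
  by rewrite /a /b lerBlDr -addrA lerDl addr_ge0.
pose S := [set a n | n in setT].
have S0 : S !=set0 by exists (a 0%N), 0%N.
have ub m : ubound S (b m) by move=> _ [n _ <-].
have hs : has_sup S by split => //; exists (b 0%N).
exists (sup S) => n; rewrite ler_norml; apply/andP; split.
  have : sup S <= b n by exact: ge_sup.
  by rewrite /b; move: (2%:R * C / _) => x; lra.
have : a n <= sup S by apply: sup_upper_bound => //; exists n.
by rewrite /a; move: (2%:R * C / _) => x; lra.
Qed.

Lemma real_mean_value_segment : mean_value_segment R.
Proof.
move=> f x y M H.
have main : forall x y : R, x < y -> (forall z : R, x <= z -> z <= y ->
    exists2 d, is_derive z 1 f d & `|d| <= M) -> `|f y - f x| <= M * `|y - x|.
  move=> {H} {}x {}y xy hz.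
  pose df (z : R) : R := xget 0 [set d : R | is_derive z 1 f d /\ `|d| <= M].
  have hdf (z : R) : x <= z -> z <= y -> is_derive z 1 f (df z) /\ `|df z| <= M.
    move=> xz zy; have [d h1 h2] := hz z xz zy.
    by apply: (@xgetPex _ 0 [set d : R | is_derive z 1 f d /\ `|d| <= M]); exists d.
  have [z zi ->] : exists2 z, z \in `]x, y[ & f y - f x = df z * (y - x).
    apply: MVT => //.
      move=> z; rewrite in_itv /= => /andP [h1 h2].
      by case: (hdf z (ltW h1) (ltW h2)).
    apply: derivable_within_continuous => z; rewrite in_itv /= => /andP [h1 h2].
    by case: (hdf z h1 h2) => -[].
  rewrite normrM ler_wpM2r //.
  by move: zi; rewrite in_itv /= => /andP [h1 h2]; case: (hdf z (ltW h1) (ltW h2)).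
have [xy|yx|->] := ltgtP x y; last by rewrite !subrr normr0 mulr0.
- rewrite distrC [`|x - y|]distrC; apply: main => // z h1 h2.
  have p : 0 < y - x by rewrite subr_gt0.
  have -> : z = (z - x) / (y - x) * (y - x) + x by rewrite divfK ?gt_eqF // subrK.
  by apply: H; [rewrite divr_ge0 ?subr_ge0 // (ltW xy)|rewrite ler_pdivrMr // mul1r lerD2r].
apply: main => // z h1 h2.
have p : 0 < x - y by rewrite subr_gt0.
have -> : z = (x - z) / (x - y) * (y - x) + x.
  by rewrite -[y - x]opprB mulrN divfK ?gt_eqF // opprB subrK.
apply: H; first by rewrite divr_ge0 ?subr_ge0 // (ltW yx).
by rewrite ler_pdivrMr // mul1r lerD2l lerN2.
Qed.

Lemma real_mean_value_ineq : mean_value_ineq R.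
Proof. exact: mean_value_disk_ineq real_mean_value_segment. Qed.

End RealInstances.

(** * Square roots of T_t *)

Section SquareRoots.
Context {F : numFieldType} (mv : mean_value_ineq F).

(** A and s^(m+1) have the same logarithmic derivative (m+1) g' / (2 g), so their quotient is
    constant on I. *)
Lemma sqrt_factor (I : set F) (g A s : F -> F) m : is_domain I ->
  smooth_on I g -> smooth_on I A -> smooth_on I s ->
  (forall t, I t -> g t != 0 /\ A t != 0) ->
  (forall t, I t -> s t != 0 /\ 2%:R * 'D_1 s t * g t = s t * 'D_1 g t) ->
  (forall t, I t -> 2%:R * 'D_1 A t * g t = m.+1%:R * A t * 'D_1 g t) ->
  exists C : F, C != 0 /\ forall t, I t -> A t = C * s t ^+ m.+1.
Proof.
move=> [oI [t0 It0] cI] sg sA ss nz hs e.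
exists (A t0 / s t0 ^+ m.+1); split.
  have [_ A0] := nz _ It0; have [s0 _] := hs _ It0.
  by rewrite mulf_neq0 // invr_neq0 // expf_neq0.
move=> t It; have [s0 _] := hs t It.
suff <- : A t / s t ^+ m.+1 = A t0 / s t0 ^+ m.+1 by rewrite divfK // expf_neq0.
apply: (derive0_const mv oI cI (f := fun t => A t / s t ^+ m.+1)) => // u Iu.
have [gu Au] := nz u Iu; have [su hu] := hs u Iu; have eu := e u Iu.
have h1 := smooth_is_derive (1 : F) sA Iu; have h2 := smooth_is_derive (1 : F) ss Iu.
have sm : (fun u => s u ^+ m.+1) u != 0 by rewrite expf_neq0.
have h := is_deriveMf h1 (@is_derive_inv F _ (fun u => s u ^+ m.+1) _ _ _ sm (is_derive_exp m.+1 h2)).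
apply: (is_derive_eq h) => /=.
have E (x y z w n v g1 : F) : x != 0 -> v != 0 -> 2%:R * z * v = n * w * g1 ->
   2%:R * y * v = x * g1 ->
   w * (- (x ^+ m.+1) ^- 2 * (n * x ^+ m * y)) + (x ^+ m.+1)^-1 * z = 0.
  move=> x0 v0 e1 e2; rewrite !(exprS x m).
  have -> : w * (- (x * x ^+ m) ^- 2 * (n * x ^+ m * y)) + (x * x ^+ m)^-1 * z =
    (x * (2%:R * z * v) - n * w * (2%:R * y * v)) / (2%:R * v * x * (x * x ^+ m)).
    by field; rewrite x0 v0 expf_neq0.
  by rewrite e1 e2 (_ : _ - _ = 0) ?mul0r //; ring.
exact: (E _ _ _ _ _ _ _ su gu eu hu).
Qed.

End SquareRoots.

Section RealSquareRoot.
Context {R : realType}.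

(** Near a point the sign e of g is constant, so the root of |g| is the root of e g > 0, where the
    square root is differentiable. *)
Lemma real_sqrt_branch_spec : sqrt_branch_spec (@real_sqrt_branch R).
Proof.
have part1 (I : set R) (g s : R -> R) : open I -> smooth_on I g ->
   (forall t, I t -> g t != 0) -> real_sqrt_branch I g s ->
   smooth_on I s /\ forall t, I t -> s t != 0 /\ 2%:R * 'D_1 s t * g t = s t * 'D_1 g t.
  move=> oI sg g0 sE.
  have s0 t : I t -> s t != 0.
    by move=> It; rewrite sE // gt_eqF // sqrtr_gt0 normr_gt0 g0.
  have ds t : I t -> is_derive t 1 s (s t * (2%:R * g t)^-1 * 'D_1 g t).
    move=> It; have gt0 := g0 t It.
    have cg : {for t, continuous g} := smooth_continuous sg It.
    pose e : R := Num.sg (g t).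
    have e2 : e * e = 1 by rewrite /e -expr2 sqr_sg gt0.
    have e1 : e * g t = `|g t| by rewrite /e -normrEsg.
    have near_e : nbhs t (I `&` [set u | 0 < e * g u]).
      have h1 := open_nbhs_nbhs (conj oI It).
      have h2 : (fun u => e * g u) @ nbhs t --> nbhs (e * g t).
        by apply: cvgM; [exact: cvg_cst|exact: cg].
      have p : 0 < e * g t by rewrite e1 normr_gt0.
      have h3 : nbhs t [set u | 0 < e * g u] := cvgr_gt (e * g t) h2 0 p.
      exact: filterI h1 (h3 _).
    have dg := smooth_is_derive (1 : R) sg It.
    have h1 := is_deriveMf (is_derive_cst e t (1 : R)) dg.
    have p : 0 < cst e t * g t by rewrite /cst e1 normr_gt0.
    have h2 := @is_derive_comp1 R R Num.sqrt (fun u => cst e u * g u) t 1 _ _ (is_derive1_sqrt p) h1.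
    have h3 : is_derive t 1 s ((2%:R * Num.sqrt (cst e t * g t))^-1 * (cst e t * 'D_1 g t + g t * 0)).
      apply: near_eq_is_derive h2; apply: filterS near_e => u [Iu pu].
      rewrite sE //; congr Num.sqrt; rewrite /cst.
      by rewrite -(ger0_norm (ltW pu)) normrM /e normr_sg gt0 mul1r.
    apply: (is_derive_eq h3); rewrite /cst mulr0 addr0 e1 -sE //.
    have s2 : s t * s t = e * g t by rewrite sE // -expr2 sqr_sqrtr // e1.
    have st := s0 t It.
    have E (x y v w : R) : x != 0 -> w != 0 -> e * e = 1 -> x * x = e * w ->
       (2%:R * x)^-1 * (e * v) = x * (2%:R * w)^-1 * v.
      move=> x0 w0 h4 h5.
      have -> : x * (2%:R * w)^-1 * v = (x * x) * v / (2%:R * w * x) by field; rewrite x0 w0.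
      by rewrite h5; field; rewrite x0 w0.
    exact: (E _ 0).
  split; last first.
    move=> t It; split; first exact: s0.
    by have [_ ->] := ds t It; field; exact: g0.
  have cs t : I t -> {for t, continuous s} by move=> It; exact: is_derive_continuous1 (ds t It).
  have sgi : smooth_on I (fun t => (2%:R * g t)^-1 * 'D_1 g t).
    apply: smooth_mul => //; last exact: smoothD_v.
    apply: smooth_inv => //; first by move=> t It; rewrite mulf_neq0 ?pnatr_eq0 ?g0.
    by apply: smooth_mul => //; exact: smooth_cst.
  (* Bootstrap through s' = s g' / (2 g). *)
  elim=> [|n IH]; first by split.
  apply: (@CkS _ _ _ _ _ _ (fun (v : R) t => v * (s t * ((2%:R * g t)^-1 * 'D_1 g t)))) => //.
    move=> v x Ix; have := is_deriveZdir v (ds x Ix).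
    by rewrite /GRing.scale /= mulr1 -!mulrA.
  move=> v; apply: Ck_mul => //; first exact: Ck_cst.
  by apply: Ck_mul => //; exact: sgi.
split=> [//|I g A m dI sg sA nz e]; pose s t := Num.sqrt `|g t|.
have [oI _ _] := dI.
have [ss hs] := part1 I g s oI sg (fun t It => (nz t It).1) (fun _ _ => erefl).
have [C [C0 hC]] := sqrt_factor real_mean_value_ineq dI sg sA ss nz hs e.
by exists s, C.
Qed.

End RealSquareRoot.

Section DerivativeEps.
Context {F : numFieldType}.

(** A form without division, valid at h = 0 too, which passes to real parts of complex functions and
    to uniform limits. *)
Lemma is_derive_eps (f : F -> F) (x d : F) : is_derive x 1 f d <->
  forall e : F, 0 < e -> exists2 del : F, 0 < del &
    forall h, `|h| < del -> `|f (h + x) - f x - d * h| <= e * `|h|.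
Proof.
have E h : h != 0 -> d - h^-1 *: (f (h *: 1 + x) - f x) =
    - h^-1 * (f (h + x) - f x - d * h).
  by move=> h0; rewrite [h *: 1]mulr1 /GRing.scale /=; field; exact: h0.
split=> [[dd <-] e e0|H].
  have : (fun h : F => h^-1 *: (f (h *: 1 + x) - f x)) @ 0^' --> 'D_1 f x.
    by move: dd; rewrite /derivable /derive.
  move=> /cvgrPdist_le /(_ e e0) hn.
  have nb : nbhs (0 : F) [set h | h != 0 -> `|'D_1 f x - h^-1 *: (f (h *: 1 + x) - f x)| <= e].
    exact: hn.
  have /nbhs_ballP [del /= d0 hd] := nb; exists del => // h hh.
  have [->|h0] := eqVneq h 0; first by rewrite add0r subrr mulr0 subr0 normr0 mulr0.
  have hb : ball (0 : F) del h by rewrite -ball_normE /= sub0r normrN.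
  have := hd h hb h0.
  have -> : 'D_1 f x - h^-1 *: (f (h *: 1 + x) - f x) =
    - h^-1 * (f (h + x) - f x - 'D_1 f x * h).
    by rewrite [h *: 1]mulr1 /GRing.scale /=; field; exact: h0.
  by rewrite normrM normrN normfV ler_pdivrMl ?normr_gt0 // [e * _]mulrC.
suff lim : (fun h : F => h^-1 *: (f (h *: 1 + x) - f x)) @ 0^' --> d.
  by apply: DeriveDef; [apply/cvg_ex; exists d | exact: cvg_lim].
apply/cvgrPdist_le => e e0; have [del d0 hd] := H e e0.
have nb : nbhs (0 : F) [set h | h != 0 -> `|d - h^-1 *: (f (h *: 1 + x) - f x)| <= e].
  apply/nbhs_ballP; exists del => //= h; rewrite -ball_normE /= sub0r normrN => hh h0.
  by rewrite E // normrM normrN normfV ler_pdivrMl ?normr_gt0 // [`|h| * _]mulrC; exact: hd.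
exact: nb.
Qed.

End DerivativeEps.

(** * The complex field *)

Section ComplexInstances.
Context {R : realType}.
Local Open Scope complex_scope.
Local Notation C := R[i].
Local Notation CF := (R[i] : numFieldType).

Let ReB (x y : C) : complex.Re (x - y) = complex.Re x - complex.Re y.
Proof. by case: x y => [a b] [c d]. Qed.

Let ImB (x y : C) : complex.Im (x - y) = complex.Im x - complex.Im y.
Proof. by case: x y => [a b] [c d]. Qed.

Let ReZ (t : R) (z : C) : complex.Re (t%:C * z) = t * complex.Re z.
Proof. by case: z => [a b]; rewrite /= mul0r subr0. Qed.

Let pos_real (e : C) : 0 <= e -> e = (complex.Re e)%:C.
Proof. by move=> e0; rewrite RRe_real // ger0_real. Qed.

Let natC n : n%:R = (n%:R)%:C :> C.
Proof. by rewrite rmorph_nat. Qed.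

Let halfC (c : R) n : c%:C / 2%:R ^+ n = (c / 2%:R ^+ n)%:C.
Proof. by rewrite natC -rmorphXn -fmorphV -rmorphM. Qed.

Let normR (t : R) : `|t%:C| = `|t|%:C.
Proof. by rewrite normc_def /= expr0n /= addr0 sqrtr_sqr. Qed.

Let Re_le (z : C) (c : R) : `|z| <= c%:C -> `|complex.Re z| <= c.
Proof. by move=> h; rewrite -lecR; exact: le_trans (normc_ge_Re z) h. Qed.

Let Im_le (z : C) (c : R) : `|z| <= c%:C -> `|complex.Im z| <= c.
Proof.
move=> h; have : `|- z * 'i%C| <= c%:C.
  rewrite normrM normrN (_ : `|'i%C| = 1) ?mulr1 // normc_def /=.
  by rewrite expr0n /= add0r expr1n sqrtr1.
by move/Re_le; rewrite ReiNIm; case: (z) => a b /=; rewrite opprK.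
Qed.

Lemma complex_half_pow_small : half_pow_small C.
Proof.
move=> c e c0 e0; rewrite (pos_real c0) (pos_real (ltW e0)).
have c0' : 0 <= complex.Re c by have := c0; rewrite {1}(pos_real c0) ler0c.
have e0' : 0 < complex.Re e.
  by have := e0; rewrite {1}(pos_real (ltW e0)) -(rmorph0 (real_complex R)) ltcR.
have [n hn] := real_half_pow_small c0' e0'.
by exists n; rewrite halfC ltcR.
Qed.

(** Real and imaginary parts converge separately, but their bounds add up to 4 C / 2^n. The constant
    2 C is recovered by comparing u_n with u_(n+k) and letting k grow. *)
Lemma complex_geometric_complete : geometric_complete C.
Proof.
move=> u C' hu.
have C0 : 0 <= C' by have := hu 0%N; rewrite expr0 divr1; exact: le_trans.
move: hu; rewrite (pos_real C0); set c := complex.Re C' => hu.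
have c0 : 0 <= c by have := C0; rewrite {1}(pos_real C0) ler0c.
have hR n : `|complex.Re (u n.+1) - complex.Re (u n)| <= c / 2%:R ^+ n.
  by rewrite -ReB; apply: Re_le; rewrite -halfC.
have hI n : `|complex.Im (u n.+1) - complex.Im (u n)| <= c / 2%:R ^+ n.
  by rewrite -ImB; apply: Im_le; rewrite -halfC.
have [l1 h1] := real_geometric_complete hR.
have [l2 h2] := real_geometric_complete hI.
pose l : C := l1 +i* l2.
have crude n : `|u n - l| <= (4%:R * c / 2%:R ^+ n)%:C.
  rewrite [u n - l]complexE; apply: le_trans (ler_normD _ _) _.
  have -> : (4%:R * c / 2%:R ^+ n)%:C = (2%:R * c / 2%:R ^+ n)%:C + (2%:R * c / 2%:R ^+ n)%:C.
    by rewrite -rmorphD /=; congr (_%:C); field; rewrite expf_neq0.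
  have hi : `|'i%C : C| = 1.
    by rewrite normc_def /= expr0n /= add0r expr1n sqrtr1.
  apply: lerD; first by rewrite normR lecR ReB.
  by rewrite normrM hi mul1r normR lecR ImB.
exists l => n.
have tail k : `|u n - u (n + k)%N| <= (2%:R * c / 2%:R ^+ n - 2%:R * c / 2%:R ^+ (n + k))%:C.
  elim: k => [|k IH]; first by rewrite addn0 !subrr normr0.
  apply: le_trans (ler_distD (u (n + k)%N) _ _) _.
  apply: le_trans (lerD IH (_ : _ <= (c / 2%:R ^+ (n + k))%:C)) _.
    by rewrite distrC addnS -halfC.
  rewrite -rmorphD /= lecR addnS le_eqVlt; apply/orP; left; apply/eqP.
  by rewrite exprS; field; rewrite !expf_neq0.
have key k : `|u n - l| <= (2%:R * c / 2%:R ^+ n + 4%:R * c / 2%:R ^+ k)%:C.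
  apply: le_trans (ler_distD (u (n + k)%N) _ _) _.
  apply: le_trans (lerD (tail k) (crude _)) _; rewrite -rmorphD /= lecR.
  rewrite exprD !invfM.
  have p1 : 0 < (2%:R ^+ n : R)^-1 by rewrite invr_gt0 exprn_gt0.
  have p2 : 0 < (2%:R ^+ k : R)^-1 by rewrite invr_gt0 exprn_gt0.
  have p3 : (2%:R ^+ n : R)^-1 <= 1.
    by rewrite invf_le1 ?exprn_gt0 // exprn_ege1 // ler1n.
  rewrite -addrA lerD2l -[X in _ <= X]add0r.
  have : c * (2%:R ^+ n)^-1 * (2%:R ^+ k)^-1 <= c * (2%:R ^+ k)^-1.
    by rewrite mulrAC ler_piMr // mulr_ge0 // ltW.
  have : 0 <= c * (2%:R ^+ n)^-1 * (2%:R ^+ k)^-1 by rewrite !mulr_ge0 // ltW.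
  set X := c * _ * _; have -> : 2%:R * c * ((2%:R ^+ n)^-1 * (2%:R ^+ k)^-1) = 2%:R * X.
    by rewrite /X; ring.
  have -> : 4%:R * c * ((2%:R ^+ n)^-1 * (2%:R ^+ k)^-1) = 4%:R * X by rewrite /X; ring.
  rewrite -[4%:R * c * _]mulrA; set Y := c * _; lra.
have e2 : 2%:R * c%:C = (2%:R * c)%:C by rewrite rmorphM rmorph_nat.
rewrite e2 halfC.
have : `|u n - l| \is Num.real by exact: normr_real.
move=> /complex_realP [x xE]; move: key; rewrite xE => key.
rewrite lecR leNgt; apply/negP => lt.
have c4 : 0 <= 4%:R * c by rewrite mulr_ge0.
have d0 : 0 < x - 2%:R * c / 2%:R ^+ n by rewrite subr_gt0.
have [k hk] := real_half_pow_small c4 d0.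
have := key k; rewrite lecR => hx.
by have := le_lt_trans hx (_ : _ < x); rewrite ltxx => h; suff : false by []; apply: h; rewrite -ltrBrDl.
Qed.

(** The real mean value theorem is applied to the real part of conj(d) f along the segment, where d
    = f y - f x. Projecting on the direction of d loses nothing: the increment of this function is
    |d|^2. *)
Lemma complex_mean_value_segment : mean_value_segment C.
Proof.
move=> f x y M H.
have [->|xy] := eqVneq x y; first by rewrite !subrr !normr0 mulr0.
pose h := y - x; have h0 : h != 0 by rewrite subr_eq0 eq_sym.
have hp : 0 < `|h| by rewrite normr_gt0.
pose d := f y - f x.
have [d0|d0] := eqVneq d 0.
  have [D _ DM] := H 0 (lexx 0) ler01.
  rewrite distrC -/d d0 normr0 mulr_ge0 //; exact: le_trans DM.
have dp : 0 < `|d| by rewrite normr_gt0.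
pose pt (s : R) : C := s%:C * h + x.
pose D (w : CF) : CF := xget 0 [set d : CF | is_derive w 1 f d /\ `|d| <= M].
have hD (s : R) : 0 <= s -> s <= 1 ->
    is_derive (pt s : CF) 1 f (D (pt s)) /\ `|D (pt s)| <= M.
  move=> s0 s1; have s0' : 0 <= s%:C by rewrite ler0c.
  have s1' : s%:C <= 1 by rewrite -(rmorph1 (real_complex R)) lecR.
  have [e h1 h2] := H _ s0' s1'.
  by apply: (@xgetPex _ 0 [set d : CF | is_derive (pt s : CF) 1 f d /\ `|d| <= M]); exists e.
pose phi (s : R) : R := complex.Re (d^* * f (pt s)).
pose dphi (s : R) : R := complex.Re (d^* * (D (pt s) * h)).
have dP (s : R) : 0 <= s -> s <= 1 -> is_derive s 1 phi (dphi s).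
  move=> s0 s1; have [/is_derive_eps hd _] := hD s s0 s1.
  apply/is_derive_eps => e e0.
  have e'0 : 0 < e%:C / (`|d| * `|h|) by rewrite divr_gt0 ?mulr_gt0 // -(rmorph0 (real_complex R)) ltcR.
  have [del del0 hdel] := hd _ e'0.
  have delh : 0 < del / `|h| by rewrite divr_gt0.
  exists (complex.Re (del / `|h|)).
    by have := delh; rewrite {1}(pos_real (ltW delh)) -(rmorph0 (real_complex R)) ltcR.
  move=> k hk.
  have kh : `|k%:C * h| < del.
    by rewrite normrM normR -ltr_pdivlMr // (pos_real (ltW delh)) ltcR.
  have := hdel _ kh.
  have -> : k%:C * h + pt s = pt (k + s) by rewrite /pt rmorphD; ring.
  set X := _ - _ - _ => hX.
  have -> : phi (k + s) - phi s - dphi s * k = complex.Re (d^* * X).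
    rewrite /phi /dphi -ReB [_ * k]mulrC -ReZ -ReB; congr complex.Re.
    by rewrite /X; ring.
  apply: Re_le; rewrite normrM normcJ.
  apply: le_trans (ler_wpM2l (ltW dp) hX) _.
  rewrite normrM normR rmorphM le_eqVlt; apply/orP; left; apply/eqP.
  by field; rewrite !gt_eqF.
have [s si] : exists2 s, s \in `]0, 1[%R & phi 1 - phi 0 = dphi s * (1 - 0).
  apply: MVT; first exact: ltr01.
    by move=> s; rewrite in_itv /= => /andP [h1 h2]; apply: dP; exact: ltW.
  apply: derivable_within_continuous => s; rewrite in_itv /= => /andP [h1 h2].
  by case: (dP s h1 h2).
rewrite subr0 mulr1 => e.
have p1 : pt 1 = y by rewrite /pt rmorph1 mul1r subrK.
have p0 : pt 0 = x by rewrite /pt rmorph0 mul0r add0r.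
have e2 : `|d| ^+ 2 = (dphi s)%:C.
  by rewrite -e /phi p1 p0 -ReB -mulrBr -/d mulrC -sqr_normc RRe_real //.
have [s0 s1] : 0 <= s /\ s <= 1.
  by move: si; rewrite in_itv /= => /andP [h1 h2]; split; exact: ltW.
have [_ DM] := hD s s0 s1.
have b : `|d| * `|d| <= `|d| * (M * `|h|).
  rewrite -expr2 e2; apply: (@le_trans _ _ `|d^* * (D (pt s) * h)|).
    apply: le_trans (normc_ge_Re _); rewrite lecR; exact: ler_norm.
  rewrite !normrM normcJ ler_wpM2l // ler_wpM2r //.
move: b; rewrite ler_pM2l // => b.
by rewrite distrC -/d [`|x - y|]distrC.
Qed.

Lemma complex_mean_value_ineq : mean_value_ineq C.
Proof. exact: mean_value_disk_ineq complex_mean_value_segment. Qed.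

(** The quotient A^2 / g^(2m+1) is a constant Q. For q with q^2 = Q, the function s = A / (q g^m) is
    smooth, s^2 = g and A = q s^(2m+1). *)
Lemma complex_sqrt_branch_spec : sqrt_branch_spec (@smooth_sqrt_branch CF).
Proof.
have part1 (I : set CF) (g s : CF -> CF) : open I -> smooth_on I g ->
   (forall t, I t -> g t != 0) -> smooth_sqrt_branch I g s ->
   smooth_on I s /\ forall t, I t -> s t != 0 /\ 2%:R * 'D_1 s t * g t = s t * 'D_1 g t.
  move=> oI sg g0 [ss sE]; split => // t It.
  have s0 : s t != 0 by have := g0 t It; rewrite -sE // expf_eq0.
  split => //; have h := is_derive_exp 2 (smooth_is_derive (1 : CF) ss It).
  have [_ ->] := is_derive_near oI It sE h.
  by rewrite -sE //= expr1; ring.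
split=> // I g A m dI sg sA nz e; have [oI [t0 It0] cI] := dI.
pose Q (t : CF) : CF := A t ^+ 2 / g t ^+ m.*2.+1.
have Qc t : I t -> Q t = Q t0.
  move=> It; apply: (derive0_const complex_mean_value_ineq oI cI) => // u Iu.
  have [gu Au] := nz u Iu; have eu := e u Iu.
  have h1 := is_derive_exp 2 (smooth_is_derive (1 : CF) sA Iu).
  have h2 := smooth_is_derive (1 : CF) sg Iu.
  have gm : (fun u => g u ^+ m.*2.+1) u != 0 by rewrite expf_neq0.
  have h := is_deriveMf h1 (@is_derive_inv CF _ (fun u => g u ^+ m.*2.+1) _ _ _ gm (is_derive_exp m.*2.+1 h2)).
  apply: (is_derive_eq h) => /=.
  have E (x y z w n : C) k : x != 0 -> 2%:R * z * x = n * w * y ->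
   w ^+ 2 * (- (x ^+ k.+1) ^- 2 * (n * x ^+ k * y)) + (x ^+ k.+1)^-1 * (2%:R * w ^+ 1 * z) = 0.
    move=> x0 h'; rewrite !(exprS x k).
    have -> : w ^+ 2 * (- (x * x ^+ k) ^- 2 * (n * x ^+ k * y)) + (x * x ^+ k)^-1 * (2%:R * w ^+ 1 * z) =
      w * (2%:R * z * x - n * w * y) / (x * (x * x ^+ k)).
      by field; rewrite x0 expf_neq0.
    by rewrite h' subrr mulr0 mul0r.
  exact: (E _ _ _ _ _ _ gu eu).
have [g0 A0] := nz _ It0.
have Q0 : Q t0 != 0 by rewrite mulf_neq0 ?invr_neq0 ?expf_neq0.
pose sg' := sqrtc (Q t0); have sgE : sg' ^+ 2 = Q t0 by exact: sqr_sqrtc.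
have sg0 : sg' != 0 by move: Q0; rewrite -sgE expf_eq0.
pose s (t : CF) : CF := A t / (sg' * g t ^+ m).
have sE t : I t -> s t ^+ 2 = g t.
  move=> It; have [gt At] := nz t It.
  have := Qc t It; rewrite -sgE /Q => q.
  have q' : A t ^+ 2 = sg' ^+ 2 * g t ^+ m.*2.+1 by rewrite -q divfK // expf_neq0.
  rewrite /s expr_div_n q' exprMn -exprM muln2 [g t ^+ _.+1]exprS.
  have G0 : g t ^+ m.*2 != 0 by rewrite expf_neq0.
  by field; rewrite G0 sg0.
have ss : smooth_on I s.
  apply: smooth_div => //.
    by move=> t It; have [gt _] := nz t It; rewrite mulf_neq0 ?expf_neq0.
  by apply: smooth_mul => //; [exact: smooth_cst|exact: smooth_exp].
exists s, sg'; split => // t It; have [gt _] := nz t It.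
rewrite exprS -mul2n exprM sE // /s; field.
by rewrite sg0 expf_neq0.
Qed.

End ComplexInstances.

(** * Linear equations of order two *)

Section LinearSolutions.
Context {F : numFieldType} (ms : mean_value_segment F)
  (gc : geometric_complete F) (hp : half_pow_small F).

Let mv : mean_value_ineq F. Proof. exact: mean_value_disk_ineq. Qed.

Lemma half_pow_limit (x y C : F) : 0 <= y -> (forall n, `|x| <= y + C / 2%:R ^+ n) -> `|x| <= y.
Proof.
move=> y0 h; have C0 : C \is Num.real.
  have := h 0%N; rewrite expr0 divr1 => h0; have := le_trans (normr_ge0 x) h0 => /ger0_real yC.
  by rewrite -[C](addKr y) rpredD // rpredN ger0_real.
have := real_leNgt (normr_real x) (ger0_real y0).
case: (boolP (y < `|x|)) => [lt _|_ -> //].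
have d0 : 0 < `|x| - y by rewrite subr_gt0.
have [n hn] := hp (normr_ge0 C) d0.
have : `|x| < `|x|; last by rewrite ltxx.
apply: le_lt_trans (h n) _; rewrite -ltrBrDl; apply: le_lt_trans hn.
by rewrite ler_pM2r ?invr_gt0 ?exprn_gt0 // real_ler_norm.
Qed.

Lemma near_le (f : F -> F) (t e : F) : {for t, continuous f} -> 0 < e ->
  nbhs t [set s | `|f t - f s| <= e].
Proof. by move=> cf e0; move: cf => /cvgrPdist_le /(_ e e0). Qed.

Lemma limit_continuous (D : set F) (S' : nat -> F -> F) (f : F -> F) (C t : F) : open D ->
  (forall n, {for t, continuous (S' n)}) -> 0 <= C ->
  (forall n t, D t -> `|S' n t - f t| <= C / 2%:R ^+ n) -> D t -> {for t, continuous f}.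
Proof.
move=> oD cS C0 Sf Dt; apply/(@cvgrPdist_le F F F (nbhs t) (nbhs_filter t)) => e e0.
have e4 : 0 < e / 3%:R by rewrite divr_gt0.
have [n0 hn0] := hp C0 e4.
have cn := near_le (cS n0) e4.
have nb : nbhs t (D `&` [set s | `|S' n0 t - S' n0 s| <= e / 3%:R]).
  by apply: (@filterI _ (nbhs t) (nbhs_filter t)); [exact: open_nbhs_nbhs|exact: cn].
apply: filterS nb => s [Ds /= h1].
have -> : f t - f s = (f t - S' n0 t) + (S' n0 t - S' n0 s) + (S' n0 s - f s) by ring.
have -> : e = e / 3%:R + e / 3%:R + e / 3%:R by field.
apply: le_trans (ler_normD _ _) _; apply: lerD; last exact: le_trans (Sf n0 s Ds) (ltW hn0).
apply: le_trans (ler_normD _ _) _; apply: lerD => //.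
by rewrite distrC; exact: le_trans (Sf n0 t Dt) (ltW hn0).
Qed.

(** The mean value inequality for S_n(s) - s f(t) bounds the first-order error of S_n by (C / 2^n +
    e) |h|; the limit in n is then taken at fixed h. *)
Lemma limit_derive (D : set F) (S S' : nat -> F -> F) (P f : F -> F) (C : F) : open D ->
  (forall n t, D t -> is_derive t 1 (S n) (S' n t)) ->
  (forall t, D t -> {for t, continuous f}) ->
  (forall n t, D t -> `|S n t - P t| <= C / 2%:R ^+ n) ->
  (forall n t, D t -> `|S' n t - f t| <= C / 2%:R ^+ n) ->
  forall t, D t -> is_derive t 1 P (f t).
Proof.
move=> oD dS cf SP Sf t Dt; apply/is_derive_eps => e e0.
have cn := near_le (cf t Dt) e0.
have nb : nbhs t (D `&` [set s | `|f t - f s| <= e]).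
  by apply: (@filterI _ (nbhs t) (nbhs_filter t)); [exact: open_nbhs_nbhs|exact: cn].
have /nbhs_ballP [del /= d0 hd] := nb.
have near s : `|t - s| < del -> D s /\ `|f s - f t| <= e.
  move=> hs; have [Ds h1] : D s /\ `|f t - f s| <= e by apply: hd; rewrite -ball_normE.
  by split=> //; rewrite distrC.
exists del => // h hh.
have ht : `|t - t| < del by rewrite subrr normr0.
have hth : `|t - (h + t)| < del by rewrite opprD addrCA subrr addr0 normrN.
have [Dh _] := near _ hth.
have key n : `|S n (h + t) - S n t - f t * h| <= (C / 2%:R ^+ n + e) * `|h|.
  have H s : `|t - s| < del -> exists2 d, is_derive s 1 (fun s => S n s - s * f t) d &
      `|d| <= C / 2%:R ^+ n + e.
    move=> /near [Ds h1]; exists (S' n s - f t).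
      have h2 := is_deriveMf (is_derive_id s (1 : F)) (is_derive_cst (f t) s (1 : F)).
      have h3 := is_deriveB (dS n s Ds) h2.
      by apply: (is_derive_eq h3); rewrite mulr0 add0r mulr1.
    have -> : S' n s - f t = (S' n s - f s) + (f s - f t) by ring.
    by apply: le_trans (ler_normD _ _) _; apply: lerD => //; exact: Sf.
  have := mv H hth ht.
  have -> : S n (h + t) - (h + t) * f t - (S n t - t * f t) = S n (h + t) - S n t - f t * h by ring.
  by rewrite addrK.
have p0 : 0 <= e * `|h| by rewrite mulr_ge0 // ltW.
apply: (@half_pow_limit _ _ (C * `|h| + 2%:R * C)) => // n.
have -> : P (h + t) - P t - f t * h = (S n (h + t) - S n t - f t * h) +
  ((S n t - P t) - (S n (h + t) - P (h + t))) by ring.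
apply: le_trans (ler_normD _ _) _.
have -> : e * `|h| + (C * `|h| + 2%:R * C) / 2%:R ^+ n =
  (C / 2%:R ^+ n + e) * `|h| + (C / 2%:R ^+ n + C / 2%:R ^+ n) by ring.
by apply: lerD => //; apply: le_trans (ler_normB _ _) _; apply: lerD; exact: SP.
Qed.

Section Disk.
Context (t0 rho : F) (rho0 : 0 < rho).
Let D : set F := [set t | `|t0 - t| < rho].
Let oD : open D. Proof. exact: open_disk. Qed.
Let Dt0 : D t0. Proof. by rewrite /D /= subrr normr0. Qed.

Definition bounded_on (f : F -> F) := exists M : F, forall t, D t -> `|f t| <= M.

(** Bounds on derivatives over a whole disk stand in for compactness and uniform continuity. The
    derivatives are witnesses rather than ['D_1 f], so values off the disk do not matter. *)
Fixpoint bounded_diff (k : nat) (f : F -> F) : Prop :=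
  bounded_on f /\
  if k is k'.+1 then exists2 f1, (forall t, D t -> is_derive t 1 f (f1 t)) & bounded_diff k' f1
  else True.

Lemma bounded_on_add f g : bounded_on f -> bounded_on g -> bounded_on (fun t => f t + g t).
Proof.
move=> [M hM] [N hN]; exists (M + N) => t Dt.
by apply: le_trans (ler_normD _ _) _; apply: lerD; [exact: hM|exact: hN].
Qed.

Lemma bounded_on_mul f g : bounded_on f -> bounded_on g -> bounded_on (fun t => f t * g t).
Proof.
move=> [M hM] [N hN]; exists (M * N) => t Dt.
by rewrite normrM ler_pM //; [exact: hM|exact: hN].
Qed.

Lemma bounded_diff_on k f : bounded_diff k f -> bounded_on f.
Proof. by case: k => [|k] []. Qed.

Lemma bounded_diff_pred k f : bounded_diff k.+1 f -> bounded_diff k f.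
Proof.
elim: k f => [|k IH] f [bf [f1 d1 b1]]; first by split.
by split=> //; exists f1 => //; exact: IH.
Qed.

Lemma bounded_diff_add k f g : bounded_diff k f -> bounded_diff k g ->
  bounded_diff k (fun t => f t + g t).
Proof.
elim: k f g => [|k IH] f g [bf hf] [bg hg]; first by split=> //; exact: bounded_on_add.
split; first exact: bounded_on_add.
have [f1 df bf1] := hf; have [g1 dg bg1] := hg.
exists (fun t => f1 t + g1 t); last exact: IH.
by move=> t Dt; apply: is_deriveDf; [exact: df|exact: dg].
Qed.

Lemma bounded_diff_mul k f g : bounded_diff k f -> bounded_diff k g ->
  bounded_diff k (fun t => f t * g t).
Proof.
elim: k f g => [|k IH] f g hf hg.
  by split=> //; apply: bounded_on_mul; [case: hf|case: hg].
have hf' := bounded_diff_pred hf; have hg' := bounded_diff_pred hg.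
have [bf [f1 df bf1]] := hf; have [bg [g1 dg bg1]] := hg.
split; first exact: bounded_on_mul.
exists (fun t => f t * g1 t + g t * f1 t).
  by move=> t Dt; apply: is_deriveMf; [exact: df|exact: dg].
by apply: bounded_diff_add; exact: IH.
Qed.

Lemma bounded_diff_cst k c : bounded_diff k (fun=> c).
Proof.
elim: k c => [|k IH] c; (split; first by exists `|c|) => //.
by exists (fun=> 0) => // t _; exact: is_derive_cst.
Qed.

Let Dseg s t x : D s -> D t -> 0 <= x -> x <= 1 -> D (x * (t - s) + s).
Proof. exact: disk_convex. Qed.

Lemma mean_value_disk (f f1 : F -> F) (M s t : F) : (forall t, D t -> is_derive t 1 f (f1 t)) ->
  (forall t, D t -> `|f1 t| <= M) -> D s -> D t -> `|f t - f s| <= M * `|t - s|.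
Proof.
move=> df fM Ds Dt; apply: (mv (c := t0) (rho := rho)) => // x Dx.
by exists (f1 x); [exact: df|exact: fM].
Qed.

(** On the segment from s to t the derivative of f(z) - z f1(s) is at most M |z - s| <= M |t - s|. A
    bound over the whole disk would not be small with |t - s|. *)
Lemma taylor_disk (f f1 f2 : F -> F) (M s t : F) : (forall t, D t -> is_derive t 1 f (f1 t)) ->
  (forall t, D t -> is_derive t 1 f1 (f2 t)) ->
  (forall t, D t -> `|f2 t| <= M) -> D s -> D t ->
  `|f t - f s - f1 s * (t - s)| <= M * `|t - s| ^+ 2.
Proof.
move=> df df1 fM Ds Dt.
have M0 : 0 <= M by exact: le_trans (fM _ Ds).
pose g z := f z - z * f1 s.
have : `|g s - g t| <= (M * `|t - s|) * `|s - t|.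
  apply: ms => x x0 x1; set z := _ + _; have Dz : D z by exact: Dseg.
  exists (f1 z - f1 s).
    have h2 := is_deriveMf (is_derive_id z (1 : F)) (is_derive_cst (f1 s) z (1 : F)).
    have h3 := is_deriveB (df z Dz) h2.
    by apply: (is_derive_eq h3); rewrite mulr0 add0r mulr1.
  apply: le_trans (mean_value_disk df1 fM Ds Dz) _; apply: ler_wpM2l => //.
  by rewrite /z addrK normrM (ger0_norm x0) ler_piMl.
rewrite distrC [`|s - t|]distrC -mulrA -expr2.
by have -> : g t - g s = f t - f s - f1 s * (t - s) by rewrite /g; ring.
Qed.

Section Primitive.
Context (f f1 f2 : F -> F) (M : F).
Context (df : forall t, D t -> is_derive t 1 f (f1 t))
  (df1 : forall t, D t -> is_derive t 1 f1 (f2 t))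
  (M1 : forall t, D t -> `|f1 t| <= M) (M2 : forall t, D t -> `|f2 t| <= M).

Let M0 : 0 <= M. Proof. exact: le_trans (M1 Dt0). Qed.
Let P2 n : 2%:R ^+ n != 0 :> F. Proof. by rewrite expf_neq0. Qed.
Let P2pos n : 0 < 2%:R ^+ n :> F. Proof. exact: exprn_gt0. Qed.

(** Riemann sums over 2^n equal pieces of the segment from t0 to t. Since the nodes move with t,
    [RS'] discretizes the t-derivative of the integral of f(t0 + x (t - t0)) (t - t0) over 0 <= x <=
    1, so path independence is not invoked over the complex numbers. *)
Let node (n k : nat) (t : F) : F := t0 + (k%:R / 2%:R ^+ n) * (t - t0).
Let RS (n : nat) (t : F) : F := \sum_(k < 2 ^ n) f (node n k t) * ((t - t0) / 2%:R ^+ n).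
Let RS' (n : nat) (t : F) : F := \sum_(k < 2 ^ n) (f (node n k t) * (2%:R ^+ n)^-1 +
  ((t - t0) / 2%:R ^+ n) * (f1 (node n k t) * (k%:R / 2%:R ^+ n))).

Let frac_le1 n k : (k <= 2 ^ n)%N -> k%:R / 2%:R ^+ n <= 1 :> F.
Proof. by move=> kn; rewrite ler_pdivrMr // mul1r -natrX ler_nat. Qed.

Let frac_ge0 n k : 0 <= k%:R / 2%:R ^+ n :> F.
Proof. by rewrite divr_ge0 // ltW. Qed.

Let node_in n k t : (k <= 2 ^ n)%N -> D t -> D (node n k t).
Proof.
move=> kn Dt; rewrite /node addrC; apply: Dseg => //; exact: frac_le1.
Qed.

Let dist_le t : D t -> `|t - t0| <= rho.
Proof. by move=> Dt; rewrite distrC ltW. Qed.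

Let node_step n k t : node n k.+1 t - node n k t = (t - t0) / 2%:R ^+ n.
Proof. by rewrite /node -natr1; field. Qed.

Let dRS n t : D t -> is_derive t 1 (RS n) (RS' n t).
Proof.
move=> Dt; have dn k : is_derive t 1 (node n k) (k%:R / 2%:R ^+ n).
  have h1 := is_deriveB (is_derive_id t (1 : F)) (is_derive_cst t0 t (1 : F)).
  have h2 := is_deriveMf (is_derive_cst (k%:R / 2%:R ^+ n : F) t (1 : F)) h1.
  have h3 := is_deriveDf (is_derive_cst t0 t (1 : F)) h2.
  by apply: (is_derive_eq h3); rewrite add0r subr0 mulr0 addr0 mulr1.
have dh : is_derive t 1 (fun t : F => (t - t0) / 2%:R ^+ n) (2%:R ^+ n)^-1.
  have h1 := is_deriveB (is_derive_id t (1 : F)) (is_derive_cst t0 t (1 : F)).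
  have h2 := is_deriveMf h1 (is_derive_cst ((2%:R ^+ n)^-1 : F) t (1 : F)).
  by apply: (is_derive_eq h2); rewrite subr0 mulr0 add0r mulr1.
apply: is_derive_sumf => k.
have Dn : D (node n k t) by apply: node_in => //; exact: ltnW.
exact: is_deriveMf (is_derive_comp1 (df Dn) (dn k)) dh.
Qed.

Let sum_bound (N : nat) (g : nat -> F) (c : F) : (forall k, (k < N)%N -> `|g k| <= c) ->
  `|\sum_(k < N) g k| <= N%:R * c.
Proof.
move=> h; apply: le_trans (ler_norm_sum _ _ _) _.
apply: le_trans (ler_sum _ (fun (i : 'I_N) _ => h i (ltn_ord i))) _.
by rewrite sumr_const card_ord mulr_natl.
Qed.

Let sum_double (N : nat) (g : nat -> F) :
  \sum_(k < N.*2) g k = \sum_(k < N) (g k.*2 + g k.*2.+1).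
Proof.
elim: N => [|N IH]; first by rewrite !big_ord0.
by rewrite doubleS !big_ord_recr /= IH addrA.
Qed.

Let node_half n k t : node n.+1 k.*2 t = node n k t.
Proof. by rewrite /node exprS -mul2n natrM; congr (_ + _ * _); field. Qed.

(** After halving, the even nodes are the old ones and each odd node is one step away: 2^n
    differences of size at most M (rho / 2^n)^2. *)
Let RS_cauchy n t : D t -> `|RS n.+1 t - RS n t| <= (M * rho ^+ 2) / 2%:R ^+ n.
Proof.
move=> Dt; rewrite /RS expnS mul2n (sum_double _ (fun k => f (node n.+1 k t) * ((t - t0) / 2%:R ^+ n.+1))).
rewrite -sumrB.
rewrite (eq_bigr (fun k : 'I_(2 ^ n) => (f (node n.+1 k.*2.+1 t) - f (node n.+1 k.*2 t)) *
   ((t - t0) / 2%:R ^+ n.+1))); last first.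
  by move=> k _; rewrite node_half exprS; field.
have h := dist_le Dt; have r0 := ltW rho0.
have nn : 0 <= (2%:R ^+ n.+1)^-1 :> F by rewrite invr_ge0 ltW.
apply: le_trans (@sum_bound _ (fun k => (f (node n.+1 k.*2.+1 t) - f (node n.+1 k.*2 t)) *
   ((t - t0) / 2%:R ^+ n.+1)) (M * rho ^+ 2 / (2%:R ^+ n * 2%:R ^+ n)) _) _; last first.
  by rewrite natrX le_eqVlt; apply/orP; left; apply/eqP; field.
move=> k kn; rewrite normrM.
have k1 : (k.*2.+1 <= 2 ^ n.+1)%N by rewrite expnS mul2n; lia.
have b1 := mean_value_disk df M1 (node_in (ltnW k1) Dt) (node_in k1 Dt).
rewrite node_step in b1.
have b2 : `|(t - t0) / 2%:R ^+ n.+1| <= rho / 2%:R ^+ n.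
  rewrite normrM (ger0_norm nn); apply: ler_pM => //.
  by rewrite lef_pV2 ?posrE // exprS ler_peMl ?ler1n // ltW.
apply: (@le_trans _ _ ((M * (rho / 2%:R ^+ n)) * (rho / 2%:R ^+ n))); last first.
  by rewrite le_eqVlt; apply/orP; left; apply/eqP; field.
apply: ler_pM => //; apply: le_trans b1 _; exact: ler_wpM2l.
Qed.

(** f(t) is the telescoping sum of the increments of x f(t0 + x (t - t0)), and [RS'] replaces each
    increment by its first-order part. The error per piece, a Taylor remainder and a product of two
    steps, is of order 4^-n. *)
Let RS'_lim n t : D t -> `|RS' n t - f t| <= (M * (rho ^+ 2 + rho)) / 2%:R ^+ n.
Proof.
move=> Dt; pose N := (2 ^ n)%N.
have fE : f t = \sum_(k < N) (k.+1%:R / 2%:R ^+ n * f (node n k.+1 t) - k%:R / 2%:R ^+ n * f (node n k t)).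
  rewrite -(big_mkord xpredT (fun k => k.+1%:R / 2%:R ^+ n * f (node n k.+1 t) - k%:R / 2%:R ^+ n * f (node n k t))).
  rewrite (telescope_sumr (fun k => k%:R / 2%:R ^+ n * f (node n k t))) // mul0r mul0r subr0.
  by rewrite /N natrX divff // mul1r /node natrX divff // mul1r addrC subrK.
rewrite fE /RS' -sumrB.
have h := dist_le Dt; have r0 := ltW rho0.
apply: le_trans (@sum_bound _ (fun k => f (node n k t) * (2%:R ^+ n)^-1 +
  ((t - t0) / 2%:R ^+ n) * (f1 (node n k t) * (k%:R / 2%:R ^+ n)) -
  (k.+1%:R / 2%:R ^+ n * f (node n k.+1 t) - k%:R / 2%:R ^+ n * f (node n k t)))
  (M * (rho ^+ 2 + rho) / (2%:R ^+ n * 2%:R ^+ n)) _) _; last first.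
  by rewrite natrX le_eqVlt; apply/orP; left; apply/eqP; field.
move=> k kn; have Dk := node_in (ltnW kn) Dt; have Dk1 := node_in kn Dt.
have tay := taylor_disk df df1 M2 Dk Dk1; rewrite node_step in tay.
set X := f (node n k.+1 t) - f (node n k t) - f1 (node n k t) * ((t - t0) / 2%:R ^+ n) in tay.
have -> : f (node n k t) * (2%:R ^+ n)^-1 +
  ((t - t0) / 2%:R ^+ n) * (f1 (node n k t) * (k%:R / 2%:R ^+ n)) -
  (k.+1%:R / 2%:R ^+ n * f (node n k.+1 t) - k%:R / 2%:R ^+ n * f (node n k t)) =
  - (k.+1%:R / 2%:R ^+ n * X + (t - t0) / (2%:R ^+ n * 2%:R ^+ n) * f1 (node n k t)).
  by rewrite /X -natr1; field.
rewrite normrN; apply: le_trans (ler_normD _ _) _.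
have nn : 0 <= (2%:R ^+ n * 2%:R ^+ n)^-1 :> F by rewrite invr_ge0 mulr_ge0 ?ltW.
have -> : M * (rho ^+ 2 + rho) / (2%:R ^+ n * 2%:R ^+ n) =
   M * (rho / 2%:R ^+ n) ^+ 2 + rho / (2%:R ^+ n * 2%:R ^+ n) * M by field.
apply: lerD.
  rewrite normrM (ger0_norm (frac_ge0 _ _)).
  apply: (@le_trans _ _ (1 * `|X|)); first by rewrite ler_wpM2r // frac_le1.
  rewrite mul1r; apply: le_trans tay _; apply: ler_wpM2l => //.
  have rn : 0 <= (2%:R ^+ n)^-1 :> F by rewrite invr_ge0 ltW.
  have b2 : `|(t - t0) / 2%:R ^+ n| <= rho / 2%:R ^+ n.
    by rewrite normrM (ger0_norm rn); exact: ler_wpM2r.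
  by apply: lerXn2r => //; rewrite nnegrE ?normr_ge0 ?mulr_ge0.
rewrite normrM; apply: ler_pM => //; last exact: M1.
by rewrite normrM (ger0_norm nn) ler_wpM2r.
Qed.

Lemma exists_primitive : exists P : F -> F, P t0 = 0 /\
  forall t, D t -> is_derive t 1 P (f t).
Proof.
have ex t : exists l, D t -> forall n, `|RS n t - l| <= 2%:R * (M * rho ^+ 2) / 2%:R ^+ n.
  have [Dt|nD] := pselect (D t); last by exists 0.
  by have [l hl] := gc (fun n => RS_cauchy n Dt); exists l.
pose P t := projT1 (cid (ex t)).
have PE t n : D t -> `|RS n t - P t| <= 2%:R * (M * rho ^+ 2) / 2%:R ^+ n.
  by move=> Dt; exact: (projT2 (cid (ex t)) Dt).
have r0 := ltW rho0.
have dP : forall t, D t -> is_derive t 1 P (f t).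
  apply: (@limit_derive D RS RS' P f (2%:R * (M * rho ^+ 2) + M * (rho ^+ 2 + rho))) => //.
  - by move=> t Dt; exact: is_derive_continuous1 (df Dt).
  - move=> n t Dt; apply: le_trans (PE t n Dt) _; apply: ler_wpM2r; first by rewrite invr_ge0 ltW.
    by rewrite lerDl mulr_ge0 // addr_ge0 // exprn_ge0.
  move=> n t Dt; apply: le_trans (RS'_lim n Dt) _; apply: ler_wpM2r; first by rewrite invr_ge0 ltW.
  by rewrite lerDr !mulr_ge0 // exprn_ge0.
exists (fun t => P t - P t0); split; first by rewrite subrr.
move=> t Dt; have h := is_deriveB (dP t Dt) (is_derive_cst (P t0) t (1 : F)).
by apply: (is_derive_eq h); rewrite subr0.
Qed.

End Primitive.

(** The primitive is again in the class of order 2, so integration can be iterated. *)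
Lemma bounded_diff_primitive f : bounded_diff 2 f -> exists P : F -> F,
  [/\ P t0 = 0, forall t, D t -> is_derive t 1 P (f t) & bounded_diff 2 P].
Proof.
move=> bf; have [[Mf hMf] [f1 df [[Ma hMa] [f2 df1 [[Mb hMb] _]]]]] := bf.
have a0 : 0 <= Ma by exact: le_trans (hMa _ Dt0).
have b0 : 0 <= Mb by exact: le_trans (hMb _ Dt0).
have aM t : D t -> `|f1 t| <= Ma + Mb by move=> Dt; apply: le_trans (hMa t Dt) _; rewrite lerDl.
have bM t : D t -> `|f2 t| <= Ma + Mb by move=> Dt; apply: le_trans (hMb t Dt) _; rewrite lerDr.
have [P [P0 dP]] := exists_primitive df df1 aM bM.
exists P; split => //; split; last by exists f => //; exact: bounded_diff_pred.
exists (Mf * rho) => t Dt; have := mean_value_disk dP hMf Dt0 Dt; rewrite P0 subr0 => h.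
apply: le_trans h _; apply: ler_wpM2l; first exact: le_trans (hMf _ Dt0).
by rewrite distrC ltW.
Qed.

End Disk.
End LinearSolutions.

(** * Local solutions of u'' = b - a u *)

Section LinearSecondOrder.
Context {F : numFieldType} (ms : mean_value_segment F)
  (gc : geometric_complete F) (hp : half_pow_small F).

Let disk (t0 rho : F) : set F := [set t | `|t0 - t| < rho].

Lemma bounded_diff_sub (t0 rho rho' : F) k f : rho' <= rho ->
  bounded_diff t0 rho k f -> bounded_diff t0 rho' k f.
Proof.
move=> le; elim: k f => [|k IH] f [[M bf] hf].
  by split=> //; exists M => t Dt; apply: bf; exact: lt_le_trans Dt le.
split; first by exists M => t Dt; apply: bf; exact: lt_le_trans Dt le.
have [f1 df b1] := hf; exists f1; last exact: IH.
by move=> t Dt; apply: df; exact: lt_le_trans Dt le.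
Qed.

Lemma smooth_bounded_diff (I : set F) (t0 : F) k (f : F -> F) : open I -> I t0 ->
  smooth_on I f -> exists rho : F, [/\ 0 < rho, disk t0 rho `<=` I & bounded_diff t0 rho k f].
Proof.
move=> oI It0; elim: k f => [|k IH] f sf.
  have nb : nbhs t0 (I `&` [set s | `|f t0 - f s| <= 1]).
    apply: (@filterI _ (nbhs t0) (nbhs_filter t0)); first exact: open_nbhs_nbhs.
    exact: near_le (smooth_continuous sf It0) ltr01.
  have /nbhs_ballP [d /= d0 hd] := nb; exists d; split=> //.
    by move=> s hs; have [] : (I `&` [set s | `|f t0 - f s| <= 1]) s by apply: hd; rewrite -ball_normE.
  split=> //; exists (`|f t0| + 1) => s hs.
  have [_ /= h1] : (I `&` [set s | `|f t0 - f s| <= 1]) s by apply: hd; rewrite -ball_normE.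
  have -> : f s = f t0 - (f t0 - f s) by ring.
  by apply: le_trans (ler_normB _ _) _; rewrite lerD2l.
have [r1 [r10 s1 b1]] := IH _ (smoothD_v (1 : F) sf).
have [r2 [r20 s2 b2]] := IH _ sf.
have [m [m0 mr1 mr2]] := pos_min r10 r20.
exists m; split=> //; first by move=> t Dt; apply: s1; exact: lt_le_trans Dt mr1.
split; first by have := bounded_diff_sub mr2 b2; case: (k) => [|?] [].
exists (fun t : F => 'D_1 f t); last exact: bounded_diff_sub b1.
by move=> t Dt; apply: smooth_is_derive sf _; apply: s1; exact: lt_le_trans Dt mr1.
Qed.

Lemma smooth_primitive (I : set F) (t0 : F) (f : F -> F) : open I -> I t0 ->
  smooth_on I f -> exists (rho : F) (P : F -> F),
  [/\ 0 < rho, disk t0 rho `<=` I, smooth_on (disk t0 rho) P, P t0 = 0 &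
      forall t, disk t0 rho t -> is_derive t 1 P (f t)].
Proof.
move=> oI It0 sf; have [rho [rho0 sub bf]] := smooth_bounded_diff 2 oI It0 sf.
have [P [P0 dP _]] := bounded_diff_primitive ms gc hp rho0 bf.
exists rho, P; split=> //; apply: (smooth_intro1 (df := f)) => //; first exact: open_disk.
exact: smooth_subset sf.
Qed.

Section Picard.
Context (t0 rho A c : F) (a b : F -> F).
Context (rho0 : 0 < rho) (Arho : A * rho <= 2%:R^-1) (rho2 : rho <= 2%:R^-1).
Context (ha : forall t, disk t0 rho t -> `|a t| <= A).
Context (ba : bounded_diff t0 rho 2 a) (bb : bounded_diff t0 rho 2 b).
Let D := disk t0 rho.
Let Dt0 : D t0. Proof. by rewrite /D /disk /= subrr normr0. Qed.
Let A0 : 0 <= A. Proof. exact: le_trans (ha Dt0). Qed.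
Let mv : mean_value_ineq F. Proof. exact: mean_value_disk_ineq. Qed.

Let prim_ex (f : F -> F) : exists P : F -> F, bounded_diff t0 rho 2 f ->
  [/\ P t0 = 0, forall t, D t -> is_derive t 1 P (f t) & bounded_diff t0 rho 2 P].
Proof.
have [bf|nbf] := pselect (bounded_diff t0 rho 2 f); last by exists f.
by have [P hP] := bounded_diff_primitive ms gc hp rho0 bf; exists P.
Qed.

(** A total operator, arbitrary outside the bounded class, as iteration requires. *)
Let prim f := projT1 (cid (prim_ex f)).
Let primP f : bounded_diff t0 rho 2 f ->
  [/\ prim f t0 = 0, forall t, D t -> is_derive t 1 (prim f) (f t) & bounded_diff t0 rho 2 (prim f)].
Proof. exact: projT2 (cid (prim_ex f)). Qed.

Let acc (u : F -> F) (t : F) := b t + (- 1) * (a t * u t).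
(** Picard iteration for u'' = b - a u, u(t0) = c, u'(t0) = 0, where [V n] is the derivative of
    [U n.+1]. The conditions A rho <= 1/2 and rho <= 1/2 make each of the two integrations halve the
    distance of successive iterates. *)
Let U n := iter n (fun u t => c + prim (prim (acc u)) t) (fun=> c).
Let V n := prim (acc (U n)).

Let bacc u : bounded_diff t0 rho 2 u -> bounded_diff t0 rho 2 (acc u).
Proof.
move=> bu; apply: bounded_diff_add => //; apply: bounded_diff_mul; first exact: bounded_diff_cst.
exact: bounded_diff_mul.
Qed.

Let bU n : bounded_diff t0 rho 2 (U n).
Proof.
elim: n => [|n IH]; first exact: bounded_diff_cst.
have [_ _ b1] := primP (bacc IH); have [_ _ b2] := primP b1.
by apply: bounded_diff_add => //; exact: bounded_diff_cst.
Qed.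

Let bV n : bounded_diff t0 rho 2 (V n).
Proof. by have [] := primP (bacc (bU n)). Qed.

Let dV n t : D t -> is_derive t 1 (V n) (acc (U n) t).
Proof. by have [_ h _] := primP (bacc (bU n)); exact: h. Qed.

Let dU n t : D t -> is_derive t 1 (U n.+1) (V n t).
Proof.
move=> Dt; have [_ h _] := primP (bV n).
have h1 := is_deriveDf (is_derive_cst c t (1 : F)) (h t Dt).
by apply: (is_derive_eq h1); rewrite add0r.
Qed.

Let U0 n : U n t0 = c.
Proof. by case: n => [//|n] /=; have [h _ _] := primP (bV n); rewrite [prim _ _]h addr0. Qed.

Let V0 n : V n t0 = 0.
Proof. by have [] := primP (bacc (bU n)). Qed.

Let dist_le t : D t -> `|t - t0| <= rho.
Proof. by move=> Dt; rewrite distrC ltW. Qed.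

Let increment (f g f1 g1 : F -> F) (m e : F) :
  (forall t, D t -> is_derive t 1 f (f1 t)) -> (forall t, D t -> is_derive t 1 g (g1 t)) ->
  (forall t, D t -> `|f1 t - g1 t| <= m) -> f t0 = g t0 -> m * rho <= e ->
  forall t, D t -> `|f t - g t| <= e.
Proof.
move=> df dg h e0 me t Dt.
have dfg s : D s -> is_derive s 1 (fun t => f t - g t) (f1 s - g1 s).
  by move=> Ds; exact: is_deriveB (df s Ds) (dg s Ds).
have := mean_value_disk ms dfg h Dt0 Dt; rewrite e0 subrr subr0 => h1.
apply: le_trans h1 _; apply: le_trans me; apply: ler_wpM2l; last exact: dist_le.
exact: le_trans (h _ Dt0).
Qed.

Let V_step n m : (forall t, D t -> `|U n.+1 t - U n t| <= m) ->
  forall t, D t -> `|V n.+1 t - V n t| <= m / 2%:R.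
Proof.
move=> h; have m0 : 0 <= m by exact: le_trans (h _ Dt0).
apply: (increment (f1 := acc (U n.+1)) (g1 := acc (U n)) (m := A * m)).
- by move=> t Dt; exact: dV.
- by move=> t Dt; exact: dV.
- move=> t Dt; have -> : acc (U n.+1) t - acc (U n) t = - (a t * (U n.+1 t - U n t)) by rewrite /acc; ring.
  by rewrite normrN normrM ler_pM //; [exact: ha|exact: h].
- by rewrite !V0.
by rewrite mulrAC [m / _]mulrC; exact: ler_wpM2r.
Qed.

Let U_step n m : (forall t, D t -> `|V n.+1 t - V n t| <= m) ->
  forall t, D t -> `|U n.+2 t - U n.+1 t| <= m / 2%:R.
Proof.
move=> h; have m0 : 0 <= m by exact: le_trans (h _ Dt0).
apply: (increment (f1 := V n.+1) (g1 := V n) (m := m)) => //.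
- by move=> t Dt; exact: dU.
- by move=> t Dt; exact: dU.
- by rewrite !U0.
exact: ler_wpM2l.
Qed.

Let U_cauchy : exists2 M : F, 0 <= M & forall n t, D t -> `|U n.+1 t - U n t| <= M / 2%:R ^+ n.
Proof.
have [M hM] : bounded_on t0 rho (fun t => U 1%N t + (- 1) * U 0%N t).
  apply: (@bounded_diff_on F t0 rho 2); apply: bounded_diff_add; first exact: bU.
  by apply: bounded_diff_mul; [exact: bounded_diff_cst|exact: bU].
have M0 : 0 <= M by exact: le_trans (hM _ Dt0).
exists M => //; elim=> [|n IH] t Dt.
  by rewrite expr0 divr1; have := hM t Dt; rewrite mulN1r.
have h1 := U_step (V_step IH) Dt; apply: le_trans h1 _.
have -> : M / 2%:R ^+ n.+1 = M / 2%:R ^+ n / 2%:R by rewrite exprS; field; rewrite expf_neq0.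
have n0 : 0 <= M / 2%:R ^+ n by rewrite divr_ge0 // exprn_ge0.
apply: ler_wpM2r; first by rewrite invr_ge0.
by rewrite ler_pdivrMr // ler_peMr // ler1n.
Qed.

Lemma picard : exists u v : F -> F, [/\ u t0 = c,
  forall t, D t -> is_derive t 1 u (v t) &
  forall t, D t -> is_derive t 1 v (b t - a t * u t)].
Proof.
have [M M0 hU] := U_cauchy.
have pw n : 0 < 2%:R ^+ n :> F by exact: exprn_gt0.
have hV n t : D t -> `|V n.+1 t - V n t| <= M / 2%:R ^+ n.
  move=> Dt; apply: le_trans (V_step (hU n) Dt) _.
  have n0 : 0 <= M / 2%:R ^+ n by rewrite divr_ge0 // exprn_ge0.
  by rewrite ler_pdivrMr // ler_peMr // ler1n.
have exl (W : nat -> F -> F) : (forall n t, D t -> `|W n.+1 t - W n t| <= M / 2%:R ^+ n) ->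
    exists w : F -> F, forall n t, D t -> `|W n t - w t| <= 2%:R * M / 2%:R ^+ n.
  move=> hW; have ex t : exists l, D t -> forall n, `|W n t - l| <= 2%:R * M / 2%:R ^+ n.
    have [Dt|nD] := pselect (D t); last by exists 0.
    by have [l hl] := gc (fun n => hW n t Dt); exists l.
  by exists (fun t => projT1 (cid (ex t))) => n t Dt; exact: (projT2 (cid (ex t)) Dt).
have [u hu] := exl U hU; have [v hv] := exl V hV.
have oD : open D by exact: open_disk.
pose K := 2%:R * M + A * (2%:R * M).
have K1 : 2%:R * M <= K by rewrite lerDl !mulr_ge0.
have K2 : A * (2%:R * M) <= K by rewrite lerDr !mulr_ge0.
have K0 : 0 <= K by apply: le_trans K1; rewrite mulr_ge0.
have scale n (x y z : F) : x <= y / 2%:R ^+ n -> y <= z -> x <= z / 2%:R ^+ n.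
  by move=> h1 h2; apply: le_trans h1 _; apply: ler_wpM2r => //; rewrite invr_ge0 ltW.
have hacc n t : D t -> `|acc (U n) t - (b t - a t * u t)| <= K / 2%:R ^+ n.
  move=> Dt; have -> : acc (U n) t - (b t - a t * u t) = - (a t * (U n t - u t)) by rewrite /acc; ring.
  rewrite normrN normrM; apply: (scale _ _ (A * (2%:R * M))) => //.
  have h1 := ha Dt; have h2 := hu n t Dt; rewrite -mulrA; exact: ler_pM.
have cacc n t : D t -> {for t, continuous (acc (U n))}.
  move=> Dt; have [_ [f1 df _]] := bacc (bU n); exact: is_derive_continuous1 (df t Dt).
have cf t : D t -> {for t, continuous (fun t => b t - a t * u t)}.
  by move=> Dt; apply: (@limit_continuous F hp D (fun n => acc (U n)) _ K) => // n; exact: cacc.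
have dv t : D t -> is_derive t 1 v (b t - a t * u t).
  apply: (@limit_derive F ms hp D V (fun n => acc (U n)) v (fun t => b t - a t * u t) K) => //.
  by move=> n s Ds; exact: scale (hv n s Ds) K1.
have du t : D t -> is_derive t 1 u (v t).
  apply: (@limit_derive F ms hp D (fun n => U n.+1) V u v K) => //.
  - by move=> s Ds; exact: is_derive_continuous1 (dv s Ds).
  - move=> n s Ds; apply: (scale _ _ (2%:R * M)) => //; apply: le_trans (hu n.+1 s Ds) _.
    apply: ler_wpM2l; first by rewrite mulr_ge0.
    by rewrite lef_pV2 ?posrE // exprS ler_peMl ?ler1n // ltW.
  by move=> n s Ds; exact: scale (hv n s Ds) K1.
exists u, v; split=> //; apply/eqP; rewrite -subr_eq0 -normr_le0.
apply: (@half_pow_limit F hp _ _ (2%:R * M)) => // n.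
by have := hu n t0 Dt0; rewrite U0 add0r distrC.
Qed.

End Picard.

Lemma linear_second_order (I : set F) (t0 c : F) (a b : F -> F) : open I -> I t0 ->
  smooth_on I a -> smooth_on I b -> exists (rho : F) (u : F -> F),
  [/\ 0 < rho, disk t0 rho `<=` I, smooth_on (disk t0 rho) u, u t0 = c &
      forall t, disk t0 rho t -> 'D_1 ('D_1 u) t = b t - a t * u t].
Proof.
move=> oI It0 sa sb.
have [ra [ra0 sua ba]] := smooth_bounded_diff 2 oI It0 sa.
have [rb [rb0 sub bb]] := smooth_bounded_diff 2 oI It0 sb.
have [[A hA] _] := ba.
have A0 : 0 <= A by apply: le_trans (hA t0 _) => //=; rewrite subrr normr0.
have [r1 [r10 r1a r1b]] := pos_min ra0 rb0.
have A1 : 0 < A + 1 by rewrite ltr_wpDl.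
(* This radius gives (A + 1) rho <= 1/2, from which both smallness conditions follow. *)
have q0 : 0 < 2%:R^-1 / (A + 1) by rewrite divr_gt0 // invr_gt0.
have [rho [rho0 rr1 rq]] := pos_min r10 q0.
have rhoA : (A + 1) * rho <= 2%:R^-1 by rewrite mulrC -ler_pdivlMr.
have rho2 : rho <= 2%:R^-1.
  by apply: le_trans rhoA; apply: ler_peMl; [exact: ltW|rewrite lerDr].
have Arho : A * rho <= 2%:R^-1.
  by apply: le_trans rhoA; apply: ler_wpM2r; [exact: ltW|rewrite lerDl].
have sD : disk t0 rho `<=` I.
  by move=> t Dt; apply: sua; apply: lt_le_trans Dt (le_trans rr1 r1a).
have ha t : disk t0 rho t -> `|a t| <= A.
  by move=> Dt; apply: hA; exact: lt_le_trans Dt (le_trans rr1 r1a).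
have [u [v [u0 du dv]]] := picard c rho0 Arho rho2 ha
  (bounded_diff_sub (le_trans rr1 r1a) ba) (bounded_diff_sub (le_trans rr1 r1b) bb).
have oD : open (disk t0 rho) by exact: open_disk.
(* The orders of u and v are raised together through u' = v and v' = b - a u. *)
have Ckuv n : Ck_on n (disk t0 rho) u /\ Ck_on n (disk t0 rho) v.
  elim: n => [|n [Cu Cv]].
    by split; split=> // t Dt; [exact: is_derive_continuous1 (du t Dt)|exact: is_derive_continuous1 (dv t Dt)].
  split; first exact: Ck_intro1 du Cv.
  apply: (Ck_intro1 oD dv).
  apply: (@Ck_eq F F F n _ (fun t => b t + (- 1) * (a t * u t)) _ oD) => [t _|]; first by ring.
  apply: (Ck_add oD); first exact: Ck_sub sD (sb n).
  apply: (Ck_mul oD); first exact: Ck_cst.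
  by apply: (Ck_mul oD) => //; exact: Ck_sub sD (sa n).
exists rho, u; split=> //; first by move=> n; have [] := Ckuv n.
move=> t Dt; have [_ <-] := dv t Dt.
by apply: (@derive_near F F F _ _ _ t 1 oD Dt) => s Ds; have [_ ->] := du s Ds.
Qed.

End LinearSecondOrder.

(** * Semi-normalization for r = 2 *)

Lemma open_preimage {F : numFieldType} {V W : normedModType F} (A : set V) (B : set W)
  (f : V -> W) : open A -> open B -> (forall x, A x -> {for x, continuous f}) ->
  open [set x | A x /\ B (f x)].
Proof.
move=> oA oB cf; rewrite openE => x [Ax Bx].
have n1 : nbhs x A by exact: open_nbhs_nbhs.
have n2 : nbhs x [set y | B (f y)].
  by apply: (cf x Ax); exact: open_nbhs_nbhs.
by apply: filterS (filterI n1 n2) => y [].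
Qed.

(** * Straightening a second-order equation to x'' = 0 *)

Section Straightening.
Local Opaque dt dx.
Context {F : numFieldType}.
Implicit Types (E : @lin_ode F 2) (I : set F) (u p T : F -> F).

Definition ode_a E (t : F) : F := coef E t 0 (ord0 : 'I_1).

Lemma smooth_ode_a E : smooth_on (dom E) (ode_a E).
Proof.
exact: (@smooth_coord F F 1 _ _ (ord0 : 'I_1) (@dom_open F 2 E) (@coef_smooth F 2 E)).
Qed.

Lemma satisfies2 E (q : F * 'rV[F]_3) :
  satisfies E q <-> q.2 0 ord_max + ode_a E q.1 * q.2 0 ord0 = rhs E q.1.
Proof.
rewrite /satisfies big_ord_recl big_ord0 addr0 /ode_a.
by rewrite (_ : inord _ = ord0 :> 'I_3) //; apply: val_inj; rewrite /= inordK.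
Qed.

Definition straightening E I u p T :=
  [/\ open I, I `<=` dom E, [/\ smooth_on I u, smooth_on I p & smooth_on I T],
    forall t, I t -> u t != 0 /\ 'D_1 T t = (u t)^-1 ^+ 2 &
    forall t, I t -> 'D_1 ('D_1 u) t = - (ode_a E t * u t) /\
      'D_1 ('D_1 p) t = rhs E t - ode_a E t * p t].

Definition straight u p T (w : F * F) : F * F := (T w.1, (w.2 - p w.1) * (u w.1)^-1).

(** The value u(t0) = 1 keeps u nonzero near t0. The normalization T(t0) = 0 gives the base points
    of two equations the same parameter, so that their straightenings overlap. *)
Lemma exists_straightening E (t0 : F) : mean_value_segment F -> geometric_complete F ->
  half_pow_small F -> dom E t0 -> exists I u p T,
  [/\ straightening E I u p T, I t0 & T t0 = 0].
Proof.
move=> ms gc hp Et0; have oE := @dom_open F 2 E.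
have [r1 [u [r10 s1 su u0 du]]] := linear_second_order ms gc hp (1 : F) oE Et0 (@smooth_ode_a E)
  (smooth_cst (dom E) (0 : F)).
have [r2 [p [r20 s2 sp _ dp]]] := linear_second_order ms gc hp (0 : F) oE Et0 (@smooth_ode_a E)
  (@rhs_smooth F 2 E).
pose I1 : set F := [set t | `|t0 - t| < r1].
pose I2 : set F := [set t | `|t0 - t| < r2].
have oI1 : open I1 by exact: open_disk.
have oI2 : open I2 by exact: open_disk.
pose I0 : set F := [set t | (I1 `&` I2) t /\ [set x : F | `|1 - x| < 1] (u t)].
have oI0 : open I0.
  apply: open_preimage; [exact: openI|exact: open_disk|].
  by move=> t [I1t _]; exact: smooth_continuous su I1t.
have I0t0 : I0 t0.
  by split; [split; rewrite /I1 /I2 /= subrr normr0|rewrite /= u0 subrr normr0 ltr01].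
have un t : I0 t -> u t != 0.
  by move=> [_ /= h]; apply: contraTneq h => ->; rewrite subr0 normr1 ltxx.
have sub1 : I0 `<=` I1 by move=> t [[]].
have sub2 : I0 `<=` I2 by move=> t [[]].
have sw : smooth_on I0 (fun t => (u t)^-1 ^+ 2).
  apply: smooth_exp => //; apply: smooth_inv => //; exact: smooth_subset sub1 su.
have [rho [T [rho0 sI sT T0 dT]]] := smooth_primitive ms gc hp oI0 I0t0 sw.
exists [set t | `|t0 - t| < rho], u, p, T; split => //; last by rewrite /= subrr normr0.
split.
- exact: open_disk.
- by move=> t /sI /sub1; exact: s1.
- by split=> //; [apply: smooth_subset su|apply: smooth_subset sp] => t /sI; [exact: sub1|exact: sub2].
- by move=> t It; split; [apply: un; exact: sI|have [_ ->] := dT t It].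
move=> t /sI It; split; last by apply: dp; exact: sub2.
by rewrite du; [rewrite sub0r|exact: sub1].
Qed.

Section Outer.
Context E I u p T (st : straightening E I u p T).

(** The inner map f is general, on the plane or on the jet space, because the straightening is
    always differentiated after another map. *)
Lemma is_derive_straight {V : normedModType F} (x v : V) (f : V -> F * F) (d e : F) :
  I (f x).1 -> is_derive x v (fun y => (f y).1) d -> is_derive x v (fun y => (f y).2) e ->
  is_derive x v (fun y => (straight u p T (f y)).1) ((u (f x).1)^-1 ^+ 2 * d) /\
  is_derive x v (fun y => (straight u p T (f y)).2)
    (((f x).2 - p (f x).1) * (- (u (f x).1) ^- 2 * ('D_1 u (f x).1 * d)) +
     (u (f x).1)^-1 * (e - 'D_1 p (f x).1 * d)).
Proof.
have [oI _ [su sp sT] un _] := st; move=> Ix hd he.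
have [u0 <-] := un _ Ix; split.
  exact: (@is_derive_comp1 F V T (fun y => (f y).1) _ _ _ _ (smooth_is_derive (1 : F) sT Ix) hd).
have cmp (a : F -> F) : smooth_on I a ->
    is_derive x v (fun y => a (f y).1) ('D_1 a (f x).1 * d).
  by move=> sa; exact: (@is_derive_comp1 F V a (fun y => (f y).1) _ _ _ _ (smooth_is_derive (1 : F) sa Ix) hd).
have h1 := cmp p sp; have h2 := cmp u su.
exact: is_deriveMf (is_deriveB he h1) (@is_derive_inv F V (fun y => u (f y).1) _ _ _ u0 h2).
Qed.

(** The Jacobian of the straightening is T_t / u = u^(-3). *)
Lemma jacobian_straight (Om : set (F * F)) (f g : F * F -> F * F) z : open Om ->
  smooth_on Om f -> (forall w, Om w -> I (f w).1) ->
  (forall w, Om w -> straight u p T (f w) = g w) -> Om z ->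
  jacobian_tx g z = (u (f z).1)^-1 ^+ 3 * jacobian_tx f z.
Proof.
move=> oO sf fI fg Oz.
have g1 w : Om w -> (straight u p T (f w)).1 = (g w).1 by move/fg->.
have g2 w : Om w -> (straight u p T (f w)).2 = (g w).2 by move/fg->.
have K v : is_derive z v (fun y => (g y).1) ((u (f z).1)^-1 ^+ 2 * 'D_v (fun w => (f w).1) z) /\
  is_derive z v (fun y => (g y).2)
    (((f z).2 - p (f z).1) * (- (u (f z).1) ^- 2 * ('D_1 u (f z).1 * 'D_v (fun w => (f w).1) z)) +
     (u (f z).1)^-1 * ('D_v (fun w => (f w).2) z - 'D_1 p (f z).1 * 'D_v (fun w => (f w).1) z)).
  have h1 := smooth_is_derive v (smooth_fst oO sf) Oz.
  have h2 := smooth_is_derive v (smooth_snd oO sf) Oz.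
  have [k1 k2] := is_derive_straight (fI z Oz) h1 h2.
  by split; [exact: is_derive_near oO Oz g1 k1|exact: is_derive_near oO Oz g2 k2].
have [[_ a1] [_ a2]] := K (1, 0); have [[_ b1] [_ b2]] := K (0, 1).
have C (A B A' B' a b a' b' : F) : A = a -> B = b -> A' = a' -> B' = b' ->
  A * B' - A' * B = a * b' - a' * b by move=> -> -> -> ->.
apply: (etrans (C _ _ _ _ _ _ _ _ a1 a2 b1 b2)); rewrite /jacobian_tx.
have R (w u2 u1 p1 X tt tx xt xx : F) : u2 = w ^+ 2 ->
  w ^+ 2 * tt * (X * (- u2 * (u1 * tx)) + w * (xx - p1 * tx)) -
  w ^+ 2 * tx * (X * (- u2 * (u1 * tt)) + w * (xt - p1 * tt)) = w ^+ 3 * (tt * xx - tx * xt).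
  by move=> ->; ring.
by apply: R; rewrite exprVn.
Qed.

Context (mv : mean_value_ineq F).
Context (Om : set (F * F)) (f g : F * F -> F * F) (pt : point_transformation Om f).
Context (fI : forall w, Om w -> I (f w).1)
  (fg : forall w, Om w -> straight u p T (f w) = g w).
Local Notation jet := (F * 'rV[F]_3)%type.
Let hr : (2 <= 2)%N := isT.
Let oO : open Om. Proof. by case: pt. Qed.
Let sf : smooth_on Om f. Proof. by case: pt. Qed.
Let dom := @jet_dom F 2 Om f.
Let odom : open dom. Proof. exact: open_jet_dom. Qed.

Let derive_base (q : jet) : Om (jet_base q) ->
  is_derive q (jet_dir q) (fun q => (f (jet_base q)).1) (dten f q) /\
  is_derive q (jet_dir q) (fun q => (f (jet_base q)).2) (total1 (xcomp f) q).
Proof.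
move=> Oq; split.
  exact: (is_derive_at_base mv hr pt (smooth_tcomp oO sf) Oq).
exact: (is_derive_at_base mv hr pt (smooth_xcomp oO sf) Oq).
Qed.

Let derive_g (q : jet) : Om (jet_base q) ->
  is_derive q (jet_dir q) (fun q => (g (jet_base q)).1) ((u (f (jet_base q)).1)^-1 ^+ 2 * dten f q) /\
  is_derive q (jet_dir q) (fun q => (g (jet_base q)).2)
    (((f (jet_base q)).2 - p (f (jet_base q)).1) *
      (- (u (f (jet_base q)).1) ^- 2 * ('D_1 u (f (jet_base q)).1 * dten f q)) +
     (u (f (jet_base q)).1)^-1 * (total1 (xcomp f) q - 'D_1 p (f (jet_base q)).1 * dten f q)).
Proof.
move=> Oq; have [h1 h2] := derive_base Oq.
have [k1 k2] := is_derive_straight (f := fun q => f (jet_base q)) (fI Oq) h1 h2.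
have oq := open_over (r := 2) oO.
split; [apply: (is_derive_near oq Oq _ k1)|apply: (is_derive_near oq Oq _ k2)] => w Ow;
  by rewrite fg.
Qed.

Lemma DT_straight (q : jet) : Om (jet_base q) ->
  DT g q = (u (f (jet_base q)).1)^-1 ^+ 2 * DT f q.
Proof.
by move=> Oq; rewrite (DT_dten mv hr pt Oq); have [[_ <-] _] := derive_g Oq.
Qed.

Let prolong1 (q : jet) : dom q -> prolong_coord g 1 q =
  u (f (jet_base q)).1 * (prolong_coord f 1 q - 'D_1 p (f (jet_base q)).1) -
  'D_1 u (f (jet_base q)).1 * ((f (jet_base q)).2 - p (f (jet_base q)).1).
Proof.
move=> hq; have [Oq d0] := hq; have [_ [_ e]] := derive_g Oq.
have [_ _ _ un _] := st; have [u0 _] := un _ (fI Oq).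
rewrite (prolong1E mv hr pt hq).
have e1 := DT_straight Oq; rewrite (DT_dten mv hr pt Oq) in e1.
have C (A B a b : F) : A = a -> B = b -> A / B = a / b by move=> -> ->.
apply: (etrans (C _ _ _ _ e e1)).
have R (x X p0 p1 u1 v d : F) : v != 0 -> d != 0 ->
  ((X - p0) * (- v ^- 2 * (u1 * d)) + v^-1 * (x - p1 * d)) / (v^-1 ^+ 2 * d) =
  v * (x * d^-1 - p1) - u1 * (X - p0).
  by move=> v0 d0'; field; rewrite v0 d0'.
exact: R.
Qed.

Let derive_prolong1 (q : jet) : dom q ->
  is_derive q (jet_dir q) (prolong_coord f 1) (prolong_coord f 2 q * dten f q).
Proof.
move=> hq; have [Oq d0] := hq.
have h := is_deriveMf (is_derive_total1 mv hr pt (smooth_xcomp oO sf) Oq) (is_derive_dinv mv hr pt hq).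
have e w : dom w -> total1 (xcomp f) w * (dten f w)^-1 = prolong_coord f 1 w.
  by move=> hw; rewrite (prolong1E mv hr pt hw).
have k := is_derive_near odom hq e h; apply: (is_derive_eq k).
have [_ <-] := k; rewrite [prolong_coord f 2 q]/= (DT_dten mv hr pt Oq).
by rewrite divfK.
Qed.

(** The straightened first derivative is u (x' - p') - u' (x - p), a Wronskian. Its t-derivative is
    u (x'' + a x - b), and division by T_t = u^(-2) gives u^3. *)
Lemma prolong2_straight (q : jet) : Om (jet_base q) -> DT f q != 0 ->
  prolong_coord g 2 q = u (f (jet_base q)).1 ^+ 3 *
    (prolong_coord f 2 q + ode_a E (f (jet_base q)).1 * (f (jet_base q)).2 - rhs E (f (jet_base q)).1).
Proof.
move=> Oq; rewrite (DT_dten mv hr pt Oq) => d0; have hq : dom q by [].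
have [oI _ [su sp sT] un de] := st; have Iq := fI Oq; have [u0 _] := un _ Iq.
have [h1 h2] := derive_base Oq.
have cmp (a : F -> F) : smooth_on I a ->
    is_derive q (jet_dir q) (fun q => a (f (jet_base q)).1) ('D_1 a (f (jet_base q)).1 * dten f q).
  move=> sa; exact: (@is_derive_comp1 F _ a (fun q => (f (jet_base q)).1) _ _ _ _
    (smooth_is_derive (1 : F) sa Iq) h1).
have du := cmp _ su; have dp := cmp _ sp.
have du1 := cmp _ (smoothD_v (1 : F) su); have dp1 := cmp _ (smoothD_v (1 : F) sp).
have k := is_deriveB (is_deriveMf du (is_deriveB (derive_prolong1 hq) dp1))
   (is_deriveMf du1 (is_deriveB h2 dp)).
have e w : dom w -> u (f (jet_base w)).1 * (prolong_coord f 1 w - 'D_1 p (f (jet_base w)).1) -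
  'D_1 u (f (jet_base w)).1 * ((f (jet_base w)).2 - p (f (jet_base w)).1) = prolong_coord g 1 w.
  by move=> hw; rewrite (prolong1 hw).
have [_ e2] := is_derive_near odom hq e k.
have e1 := DT_straight Oq; rewrite (DT_dten mv hr pt Oq) in e1.
have C (A B a b : F) : A = a -> B = b -> A / B = a / b by move=> -> ->.
apply: (etrans (C _ _ _ _ e2 e1)).
have x1 : total1 (xcomp f) q = prolong_coord f 1 q * dten f q.
  by rewrite (prolong1E mv hr pt hq) divfK.
have [eu ep] := de _ Iq; rewrite x1 eu ep.
have R (a b v u1 p0 p1 y0 y1 y2 d : F) : v != 0 -> d != 0 ->
  (v * (y2 * d - (b - a * p0) * d) + (y1 - p1) * (u1 * d) -
   (u1 * (y1 * d - p1 * d) + (y0 - p0) * (- (a * v) * d))) / (v^-1 ^+ 2 * d) =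
  v ^+ 3 * (y2 + a * y0 - b).
  by move=> v0 d0'; field; rewrite v0 d0'.
exact: R.
Qed.

(** The condition E on the prolongation of f is expressed through g alone. For two maps with the
    same g this is a comparison that never composes prolongations. *)
Lemma satisfies_straight (q : jet) : Om (jet_base q) -> DT f q != 0 ->
  satisfies E (prolong f q) <-> prolong_coord g 2 q = 0.
Proof.
move=> Oq d0; rewrite (prolong2_straight Oq d0).
have [_ _ _ un _] := st; have [u0 _] := un _ (fI Oq).
apply: (iff_trans (satisfies2 _ _)).
rewrite [X in X + _]mxE [X in _ * X]mxE; split => [->|/eqP]; first by rewrite subrr mulr0.
by rewrite mulf_eq0 expf_eq0 (negbTE u0) /= subr_eq0 => /eqP.
Qed.

End Outer.
End Straightening.

(** * Factorization of admissible transformations of second-order equations *)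

Section SemiNormalized.
Local Opaque dt dx.
Context {F : numFieldType} (ms : mean_value_segment F) (gc : geometric_complete F)
  (hp : half_pow_small F).
Let mv : mean_value_ineq F. Proof. exact: mean_value_disk_ineq. Qed.
Let hr : (2 <= 2)%N := isT.

(* The reparametrization tau = T'^(-1) o T satisfies tau_t = (u'(tau)/u)^2. *)
Lemma transition_normal_form E E' (I I' K : set F) (u p T u' p' T' S : F -> F) :
  straightening E I u p T -> straightening E' I' u' p' T' ->
  open K -> smooth_on K S -> (forall w, K w -> I' (S w) /\ T' (S w) = w) ->
  let Om := [set t | I t /\ K (T t)] `*` setT in
  let phi := fun w : F * F => (S (T w.1),
    u' (S (T w.1)) * ((w.2 - p w.1) * (u w.1)^-1) + p' (S (T w.1))) in
  point_transformation Om phi /\ normal_form 2 Om phi.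
Proof.
move=> [oI _ [su sp sT] un _] [oI' _ [su' sp' sT'] un' _] oK sS hS Om phi.
pose J : set F := [set t | I t /\ K (T t)].
have oJ : open J.
  by apply: open_preimage => // t; exact: smooth_continuous sT.
have JI : J `<=` I by move=> t [].
have sTJ : smooth_on J T by exact: smooth_subset JI sT.
pose tau t := S (T t).
have stau : smooth_on J tau by apply: (smooth_comp1 (B := K) oJ _ sS sTJ) => t [].
have Jtau t : J t -> I' (tau t) by move=> [_ /hS []].
have sc (f : F -> F) : smooth_on I' f -> smooth_on J (fun t => f (tau t)).
  by move=> sf; apply: (smooth_comp1 (B := I') oJ _ sf stau).
have su1 : smooth_on J (fun t => (u t)^-1).
  apply: smooth_inv => //; last exact: smooth_subset JI su.
  by move=> t /JI /un [].
pose a t := u' (tau t) * (u t)^-1.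
have sa : smooth_on J a by apply: smooth_mul => //; exact: sc.
pose b t := p' (tau t) - a t * p t.
have sb : smooth_on J b.
  apply: smooth_sub => //; first exact: sc.
  by apply: smooth_mul => //; exact: smooth_subset JI sp.
have a0 t : J t -> a t != 0.
  move=> Jt; have [h1 _] := un _ (JI _ Jt); have [h2 _] := un' _ (Jtau _ Jt).
  by rewrite mulf_neq0 ?invr_neq0.
have dtau t : J t -> 'D_1 tau t = a t ^+ 2.
  move=> Jt; have [u0 e1] := un _ (JI _ Jt); have [u0' e2] := un' _ (Jtau _ Jt).
  have h := is_derive_comp1 (smooth_is_derive (1 : F) sT' (Jtau _ Jt)) (smooth_is_derive (1 : F) stau Jt).
  have e w : J w -> T' (tau w) = T w by move=> [_ /hS []].
  have [_] := is_derive_near oJ Jt e h; rewrite e1 e2 => k.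
  have v0 : (u' (tau t))^-1 ^+ 2 != 0 by rewrite expf_neq0 // invr_neq0.
  by apply: (mulfI v0); rewrite -k /a; field; rewrite u0 u0'.
apply: affine_normal_form => //; first by apply: open_rect => //; exact: openT.
move=> z [Jz _]; exists J, setT, tau, a, b; split => //.
- by split=> //; exact: openT.
- by move=> t Jt; rewrite dtau // expf_neq0 a0.
- move=> t Jt; have h := is_derive_exp 2 (smooth_is_derive (1 : F) sa Jt).
  have e w : J w -> a w ^+ 2 = 'D_1 tau w by move/dtau.
  have [_ ->] := is_derive_near oJ Jt e h.
  by rewrite dtau // [2.-1]/= expr1; ring.
by move=> t x Jt _; rewrite /phi /= -/(tau t) /b /a; congr (_, _); ring.
Qed.

(** The straightening of [sigma] for E and that of [phi] for E' are the same map [g]. Both E on the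
    prolongation of [sigma] and E' on that of [phi] thus say that the second component of prolonged
    [g] vanishes; as [phi] maps E to E', [sigma] is a symmetry of E. *)
Lemma semi_normalized_order2 : @semi_normalized F 2.
Proof.
move=> E E' Om phi adm z Oz; have [pt [hdom hmap]] := adm; have [oOm sphi jphi] := pt.
have [Ez Ez'] := hdom z Oz.
have [I [u [p [T [st It0 Tt0]]]]] := exists_straightening ms gc hp Ez.
have [I' [u' [p' [T' [st' It0' Tt0']]]]] := exists_straightening ms gc hp Ez'.
have [oI IE [su sp sT] un _] := st; have [oI' IE' [su' sp' sT'] un' _] := st'.
have nzT : 'D_1 T z.1 != 0 by have [u0 ->] := un _ It0; rewrite expf_neq0 // invr_neq0.
have nzT' : 'D_1 T' (phi z).1 != 0 by have [u0 ->] := un' _ It0'; rewrite expf_neq0 // invr_neq0.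
have [K [S [d [oK sS hS d0 hd]]]] := inverse_function mv gc hp oI sT It0 nzT.
have [K' [S' [d' [oK' sS' hS' d0' hd']]]] := inverse_function mv gc hp oI' sT' It0' nzT'.
pose D' : set F := [set t | `|(phi z).1 - t| < d'].
have D'I t : D' t -> I' t by move=> /hd' [].
(* On [D'] the inverse S' undoes T', and values of T' in K can be pulled back by S. *)
pose J : set F := [set t | D' t /\ K (T' t)].
have oJ : open J.
  apply: open_preimage => //; first exact: open_disk.
  by move=> t /D'I; exact: smooth_continuous sT'.
pose U : set (F * F) := [set w | Om w /\ J (phi w).1].
have oU : open U.
  apply: open_preimage => // w Ow; exact: smooth_continuous (smooth_fst oOm sphi) Ow.
have Uz : U z.
  split=> //; split; first by rewrite /D' /= subrr normr0.
  (* Both parameters are normalized to 0 at the base points, which puts T' of the image of z into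
     K. *)
  by rewrite Tt0' -Tt0; have [|_ ] := hd z.1; rewrite ?subrr ?normr0.
have UO : U `<=` Om by move=> w [].
pose psi' := straight u' p' T'.
pose sigma1 (w : F * F) := S (T' (phi w).1).
pose sigma (w : F * F) : F * F :=
  (sigma1 w, u (sigma1 w) * (psi' (phi w)).2 + p (sigma1 w)).
have phiI' w : U w -> I' (phi w).1 by move=> [_ [/D'I]].
have sigI w : U w -> I (sigma w).1 by move=> [_ [_ /hS []]].
have sigT w : U w -> T (sigma w).1 = T' (phi w).1 by move=> [_ [_ /hS []]].
have sigK w : U w -> K' (T (sigma w).1) by move=> Uw; rewrite sigT //; case: Uw => [_ [/hd' []]].
have sigS w : U w -> S' (T (sigma w).1) = (phi w).1.
  by move=> Uw; rewrite sigT //; case: Uw => [_ [/hd' []]].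
have psiE w : U w -> straight u p T (sigma w) = psi' (phi w).
  move=> Uw; rewrite /straight sigT //= [RHS]surjective_pairing; congr (_, _) => /=.
  have [u0 _] := un _ (sigI w Uw).
  by rewrite addrK [u _ * _]mulrC mulfK.
have sphiU : smooth_on U phi by exact: smooth_subset UO sphi.
have s1 : smooth_on U (fun w => (phi w).1) by exact: smooth_fst.
have s2 : smooth_on U (fun w => (phi w).2) by exact: smooth_snd.
have sc' (f : F -> F) : smooth_on I' f -> smooth_on U (fun w => f (phi w).1).
  by move=> sf; exact: (smooth_comp1 (B := I') oU _ sf s1).
have ss1 : smooth_on U sigma1.
  by apply: (smooth_comp1 (B := K) oU _ sS (sc' _ sT')) => w [_ []].
have sc (f : F -> F) : smooth_on I f -> smooth_on U (fun w => f (sigma1 w)).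
  by move=> sf; exact: (smooth_comp1 (B := I) oU _ sf ss1).
have ssig : smooth_on U sigma.
  apply: smooth_pair => //; apply: smooth_add => //; last exact: sc.
  apply: smooth_mul => //; first exact: sc.
  apply: smooth_mul => //; first by apply: smooth_sub => //; exact: sc'.
  by apply: smooth_inv => //; [move=> w /phiI' /un' []|exact: sc'].
have ptU : point_transformation U phi.
  by split=> // w /UO; exact: jphi.
pose g w := psi' (phi w).
have jac' w Uw := @jacobian_straight F E' I' u' p' T' st' U phi g w oU sphiU phiI' (fun _ _ => erefl) Uw.
have jac w Uw := @jacobian_straight F E I u p T st U sigma g w oU ssig sigI psiE Uw.
have pts : point_transformation U sigma.
  (* The Jacobian of [g] is a nonzero multiple of that of [phi] and also of that of [sigma]. *)
  split=> // w Uw; have := jac' w Uw; rewrite (jac w Uw) => e.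
  have : (u (sigma w).1)^-1 ^+ 3 * jacobian_tx sigma w != 0.
    rewrite e mulf_neq0 ?jphi ?expf_neq0 ?invr_neq0 //; last exact: UO.
    by have [] := un' _ (phiI' w Uw).
  by rewrite mulf_eq0 negb_or => /andP[].
pose Om' : set (F * F) := [set t | I t /\ K' (T t)] `*` setT.
pose phi' (w : F * F) : F * F := (S' (T w.1),
  u' (S' (T w.1)) * ((w.2 - p w.1) * (u w.1)^-1) + p' (S' (T w.1))).
have [ptp nfp] : point_transformation Om' phi' /\ normal_form 2 Om' phi' :=
  transition_normal_form st st' oK' sS' hS'.
have eq := equivalence_joint_map mv gc hp hr ptp nfp.
exists U, sigma, Om', phi', (joint_map phi'); split; [by split|split=> //|exact: eq|].
- split=> [w Uw|q Uq Dq].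
    by split; [case: (hdom w (UO w Uw))|apply: IE; exact: sigI].
  have D1 := DT_straight st mv pts sigI psiE Uq.
  have D2 := DT_straight st' mv ptU phiI' (g := g) (fun _ _ => erefl) Uq.
  have Dphi : DT phi q != 0.
    have : (u (sigma (jet_base q)).1)^-1 ^+ 2 * DT sigma q != 0.
      rewrite mulf_neq0 // expf_neq0 // invr_neq0 //.
      by have [] := un _ (sigI _ Uq).
    by rewrite -D1 D2 mulf_eq0 negb_or => /andP[].
  apply: (iff_trans (hmap q (UO _ Uq) Dphi)).
  apply: (iff_trans (satisfies_straight st' mv ptU phiI' (g := g) (fun _ _ => erefl) Uq Dphi)).
  by apply: iff_sym; exact: (satisfies_straight st mv pts sigI psiE Uq Dq).
move=> w Uw; split; first by split=> //; split; [exact: sigI|exact: sigK].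
rewrite /phi' sigS // [LHS]surjective_pairing; congr (_, _).
have [u0 _] := un _ (sigI w Uw); have [u0' _] := un' _ (phiI' w Uw).
have := psiE w Uw => /(congr1 snd) /= ->.
by rewrite mulrC -mulrA mulVf // mulr1 subrK.
Qed.

End SemiNormalized.

(** * The classification over an abstract ground field *)

Section Classification.
Context {F : numFieldType} (ms : mean_value_segment F) (gc : geometric_complete F)
  (hp : half_pow_small F) (r : nat) (hr : (2 <= r)%N).
Let mv : mean_value_ineq F. Proof. exact: mean_value_disk_ineq. Qed.

Lemma equivalence_group_classification branch : sqrt_branch_spec branch ->
  @equivalence_group_is F r (G1_form r branch).
Proof.
move=> spec Om phi oOm; split=> [[Psi eqv] I J dI dJ IJ|h].
  have [pt _ _ _ _] := eqv; have nf := equivalence_normal_form mv hr eqv.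
  exact: (form_of_normal mv hr spec pt nf dI dJ IJ).
have [pt nf] := normal_of_form mv hr spec oOm h.
by exists (joint_map phi); exact: equivalence_joint_map.
Qed.

Lemma normalized_order_ge3 : (3 <= r)%N -> @normalized F r.
Proof.
move=> r3 E E' Om phi adm; have nf := admissible_normal_form mv hr r3 adm.
have [pt hm] := adm; exists (joint_map phi); split; first exact: equivalence_joint_map.
exact: joint_maps_admissible.
Qed.

Lemma semi_normalized_eq2 : r = 2%N -> @semi_normalized F r.
Proof. by move=> ->; exact: semi_normalized_order2. Qed.

End Classification.

Theorem proposition8 (R : realType) (r : nat) (hr : (2 <= r)%N) :
  [/\ @equivalence_group_is R r (@G1_form R r (@real_sqrt_branch R)),
      r = 2%N -> @semi_normalized R r
    & (3 <= r)%N -> @normalized R r] /\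
  [/\ @equivalence_group_is R[i] r (@G1_form R[i] r (@smooth_sqrt_branch R[i])),
      r = 2%N -> @semi_normalized R[i] r
    & (3 <= r)%N -> @normalized R[i] r].
Proof.
have rs := @real_mean_value_segment R; have rc := @real_geometric_complete R.
have rh := @real_half_pow_small R; have rb := @real_sqrt_branch_spec R.
have cs := @complex_mean_value_segment R; have cc := @complex_geometric_complete R.
have ch := @complex_half_pow_small R; have cb := @complex_sqrt_branch_spec R.
split; split.
- exact: equivalence_group_classification.
- exact: semi_normalized_eq2.
- exact: normalized_order_ge3.
- exact: (@equivalence_group_classification (R[i] : numFieldType)).
- exact: (@semi_normalized_eq2 (R[i] : numFieldType)).
- exact: (@normalized_order_ge3 (R[i] : numFieldType)).
Qed.
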